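(* Let $E$ be a Hilbert space and let $f_\varepsilon(u)=\frac12\|u\|^2-F(u)+G(\varepsilon,u)$, with critical manifold $Z=\{z_\theta:\theta\in\mathbb{R}^d\}$ of $f_0$, satisfy hypotheses (H), (F0)–(F3), (G0)–(G3), (F4)', (G4)' and (G5)' listed in the context. Let $\theta\in\mathbb{R}^d$ and suppose that for every small $\varepsilon>0$ there is a critical point $u_\varepsilon\in Z_\varepsilon$ of $f_\varepsilon$ such that $u_\varepsilon=z_{\theta_\varepsilon}+w(\varepsilon,\theta_\varepsilon)$ and $\theta_\varepsilon\to\theta$ as $\varepsilon\to0$. Assume that $z_\theta=\lim_{\varepsilon\to 0} z_{\theta_\varepsilon}$ is nondegenerate for the restriction of $f_0$ to $(T_{z_\theta}Z)^\perp$, with Morse index equal to $m_0$, and that the Hessian matrix $D^2\Gamma(\theta)$ is positive definite or negative definite. Then, for small $\varepsilon$, $u_\varepsilon$ is a nondegenerate critical point of $f_\varepsilon$, with Morse index equal to $m_0$ if $D^2\Gamma(\theta)$ is positive definite, and to $m_0+d$ if $D^2\Gamma(\theta)$ is negative definite. As a consequence, the critical points $u_\varepsilon$ of $f_\varepsilon$ form a continuous curve (i.e. $\varepsilon\mapsto u_\varepsilon$ is continuous for small $\varepsilon>0$).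
   Context: Setting: $E$ is a Hilbert space with scalar product $(\cdot|\cdot)$ and norm $\|\cdot\|$, $I_E$ is its identity map, $L(E,E)$ is the space of continuous linear operators, $F:E\to\mathbb{R}$, $G:\mathbb{R}\times E\to\mathbb{R}$. $F'(u)\in E$ and $F''(u)\in L(E,E)$ are defined by $(F'(u)|v)=DF(u)[v]$, $(F''(u)v|w)=D^2F(u)[v,w]$, and $F'''(u)$ is the bilinear map $E\times E\to E$ with $(F'''(u)[v_1,v_2]|v_3)=D^3F(u)[v_1,v_2,v_3]$; $G'(\varepsilon,u),G''(\varepsilon,u),G'''(\varepsilon,u)$ are defined in the same way, differentiating with respect to $u$. Powers $\varepsilon^\alpha$ and limits $\varepsilon\to0$ are for $\varepsilon>0$. Hypotheses: (F0) $F\in C^2$. (F1) There is a $d$-dimensional $C^2$ manifold $Z\subset E$, $d\ge1$, of critical points of $f_0$, i.e. $z=F'(z)$ for all $z\in Z$. $Z$ is parametrized by a single map $\theta\mapsto z_\theta$, $\theta\in\mathbb{R}^d$; write $\partial_iz_\theta=\partial z_\theta/\partial\theta_i$, $\partial_{ij}z_\theta=\partial^2z_\theta/\partial\theta_i\partial\theta_j$. (F2) $F''(z)$ is compact for all $z\in Z$. (F3) $T_zZ=\ker[I_E-F''(z)]$ for all $z\in Z$, where $T_zZ$ is the tangent space. (F4)' $F$ is of class $C^3$. (H) For all $\theta$: $(\partial_iz_\theta|\partial_jz_\theta)=0$ if $i\ne j$; $\|\partial_iz_\theta\|=c$ with $c$ independent of $i$ and $\theta$; $(\partial_{ij}z_\theta|\partial_lz_\theta)=0$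 for all $i,j,l=1,\dots,d$. (G0) $G$ is continuous on $\mathbb{R}\times E$ and $G(0,u)=0$ for all $u\in E$. (G1) $G$ is of class $C^2$ with respect to $u$. (G2) $(\varepsilon,u)\mapsto G'(\varepsilon,u)$ and $(\varepsilon,u)\mapsto G''(\varepsilon,u)$ are continuous from $\mathbb{R}\times E$ to $E$, resp. to $L(E,E)$. (G3) There are $\alpha>0$ and a continuous $\Gamma:Z\to\mathbb{R}$ such that for all $z\in Z$: $\Gamma(z)=\lim_{\varepsilon\to0}\varepsilon^{-\alpha}G(\varepsilon,z)$ and $G'(\varepsilon,z)=o(\varepsilon^{\alpha/2})$. Write $\Gamma(\theta)=\Gamma(z_\theta)$. (G4)' $G$ is of class $C^3$ with respect to $u$ and $(\varepsilon,u)\mapsto G'''(\varepsilon,u)$ is continuous. (G5)' $G'(\varepsilon,u)=O(\varepsilon^\alpha)$ for all $u\in E$; $\Gamma$ is $C^2$ (as a function of $\theta$) and, whenever $\theta_\varepsilon\to\theta$ as $\varepsilon\to0$, for all $i,j$: $\lim_{\varepsilon\to0}[\varepsilon^{-\alpha}(G'(\varepsilon,z_{\theta_\varepsilon})|\partial_{ij}z_{\theta_\varepsilon})+\varepsilon^{-\alpha}(G''(\varepsilon,z_{\theta_\varepsilon})\partial_iz_{\theta_\varepsilon}|\partial_jz_{\theta_\varepsilon})]=\partial_{ij}\Gamma(\theta)$ and $\lim_{\varepsilon\to0}\varepsilon^{-\alpha/2}G''(\varepsilon,z_{\theta_\varepsilon})\partial_iz_{\theta_\varepsilon}=0$. The reduction: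 by the Implicit Function Theorem, for $\varepsilon$ small and (locally) $z=z_\eta\in Z$ there is a unique small $w=w(\varepsilon,\eta)=w(\varepsilon,z_\eta)\in E$ with $w\perp T_zZ$ and $f_\varepsilon'(z+w)\in T_zZ$ (where $f'_\varepsilon$ is the gradient of $f_\varepsilon$); it satisfies $\|w\|=o(\varepsilon^{\alpha/2})$ and $\|D_zw(\varepsilon,z)\|\to0$ as $\varepsilon\to0$. One sets $Z_\varepsilon=\{z+w(\varepsilon,z)\}$. A critical point $u$ of $f_\varepsilon$ is nondegenerate if the self-adjoint operator representing $D^2f_\varepsilon(u)$ is invertible; its Morse index is the maximal dimension of a subspace on which $D^2f_\varepsilon(u)$ is negative definite. The same terminology is used for the quadratic form $D^2f_0(z_\theta)$ restricted to $(T_{z_\theta}Z)^\perp$.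
   Formalization: In (G5)', ''G'(ε,u)=O(ε^α) for all u∈E'' is taken locally uniformly in u: each point of E has a neighbourhood on which one constant serves for small ε; with a constant depending arbitrarily on u the claim fails already for E=R^2, d=1. *)

(* Defs.v *)
From HB Require Import structures.
From mathcomp Require Import all_boot all_order all_algebra.
From mathcomp Require Import all_classical all_reals all_analysis.

Set Implicit Arguments.
Unset Strict Implicit.
Unset Printing Implicit Defensive.

Import Order.TTheory GRing.Theory Num.Theory.
Import numFieldNormedType.Exports.

Local Open Scope classical_set_scope.
Local Open Scope ring_scope.

HB.mixin Record CompleteNormedModule_isHilbert (R : realType) E
    of CompleteNormedModule R E := {
  dot : E -> E -> R ;
  dotC : forall u v, dot u v = dot v u ;
  dot_linear : forall v, scalar (dot ^~ v) ;
  dot_norm : forall u, dot u u = `|u| ^+ 2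
}.

#[short(type="hilbertType")]
HB.structure Definition Hilbert (R : realType) :=
  {E of CompleteNormedModule R E & CompleteNormedModule_isHilbert R E}.

(* Frechet derivatives up to order three.  A k-linear map is a function on
   k-tuples of vectors, and wt is the product of the norms of its arguments, so
   that "|S p| <= e * wt p for all p" means that S has operator norm at most
   e. *)
Section Calculus.
Context {R : realType}.

Definition continuous_op (X : topologicalType) (P : Type)
    (W : normedModType R) (wt : P -> R) (T : X -> P -> W) : Prop :=
  forall x e, 0 < e ->
    \forall y \near x, forall p, `|T y p - T x p| <= e * wt p.

Definition differentiable_op (V : normedModType R) (P : Type)
    (W : normedModType R) (wt : P -> R) (T : V -> P -> W) : Prop :=
  (forall x p, differentiable (T ^~ p) x) /\
  (forall x e, 0 < e -> \forall h \near (0 : V), forall p,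
     `|T (x + h) p - T x p - 'd (T ^~ p) x h| <= e * `|h| * wt p).

Section Order.
Context {V W : normedModType R}.

Definition wt1 (v : V) : R := `|v|.
Definition wt2 (v : V * V) : R := `|v.1| * `|v.2|.
Definition wt3 (v : V * V * V) : R := `|v.1.1| * `|v.1.2| * `|v.2|.

Definition D2 (f : V -> W) (x v1 v2 : V) : W := 'd (fun y => 'd f y v1) x v2.
Definition D3 (f : V -> W) (x v1 v2 v3 : V) : W :=
  'd (fun y => D2 f y v1 v2) x v3.

Definition C1 (f : V -> W) : Prop :=
  (forall x, differentiable f x) /\
  continuous_op wt1 (fun x v => 'd f x v).

Definition C2 (f : V -> W) : Prop :=
  [/\ C1 f,
      differentiable_op wt1 (fun x v => 'd f x v) &
      continuous_op wt2 (fun x v => D2 f x v.1 v.2)].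

Definition C3 (f : V -> W) : Prop :=
  [/\ C2 f,
      differentiable_op wt2 (fun x v => D2 f x v.1 v.2) &
      continuous_op wt3 (fun x v => D3 f x v.1.1 v.1.2 v.2)].

End Order.

Definition pd (d : nat) (W : normedModType R) (i : 'I_d)
    (f : 'rV[R]_d -> W) (th : 'rV[R]_d) : W :=
  'D_(delta_mx 0 i) f th.

Definition pd2 (d : nat) (W : normedModType R) (i j : 'I_d)
    (f : 'rV[R]_d -> W) : 'rV[R]_d -> W :=
  pd i (pd j f).

Definition hessmx (d : nat) (f : 'rV[R]_d -> R) (th : 'rV[R]_d) : 'M[R]_d :=
  \matrix_(i, j) pd2 i j f th.

Definition posdefmx (d : nat) (H : 'M[R]_d) : Prop :=
  forall x : 'rV[R]_d, x != 0 -> 0 < (x *m H *m x^T) 0 0.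

Definition negdefmx (d : nat) (H : 'M[R]_d) : Prop := posdefmx (- H).

End Calculus.

Section HilbertCalculus.
Context {R : realType} {E : hilbertType R}.

Definition riesz (l : E -> R) : E := get [set g : E | forall v, dot g v = l v].

(* f'(u), f''(u) and f'''(u) with values in E *)
Definition grad (f : E -> R) (u : E) : E := riesz ('d f u).
Definition hess (f : E -> R) (u v : E) : E := riesz (D2 f u v).
Definition third (f : E -> R) (u v1 v2 : E) : E := riesz (D3 f u v1 v2).

Definition compact_op (A : E -> E) : Prop :=
  precompact (A @` [set v | `|v| <= 1]).

Definition orth (S : set E) : set E := [set v | forall t, S t -> dot v t = 0].

Definition lincomb (n : nat) (v : 'I_n -> E) (a : 'I_n -> R) : E :=
  \sum_i a i *: v i.

Definition lin_indep (n : nat) (v : 'I_n -> E) : Prop :=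
  forall a, lincomb v a = 0 -> forall i, a i = 0.

Definition negdef_dim (B : E -> E -> R) (S : set E) (n : nat) : Prop :=
  exists v : 'I_n -> E,
    [/\ lin_indep v, range (lincomb v) `<=` S &
        forall x, range (lincomb v) x -> x != 0 -> B x x < 0].

Definition morse_index (B : E -> E -> R) (S : set E) (m : nat) : Prop :=
  negdef_dim B S m /\ (forall n, negdef_dim B S n -> (n <= m)%N).

(* A is the operator of the closed subspace S representing B restricted to S;
   A' is its inverse. *)
Definition nondegenerate_on (B : E -> E -> R) (S : set E) : Prop :=
  exists A A' : E -> E,
    [/\ forall x, S x -> S (A x) /\ S (A' x),
        forall x y, S x -> S y -> dot (A x) y = B x y,
        forall x, S x -> A' (A x) = x /\ A (A' x) = x &
        {within S, continuous A'}].

Definition critical (f : E -> R) (u : E) : Prop := grad f u = 0.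

Definition functional (F : E -> R) (G : R -> E -> R) (eps : R) (u : E) : R :=
  2^-1 * `|u| ^+ 2 - F u + G eps u.

Section Manifold.
Context {d : nat}.
Implicit Types z : 'rV[R]_d -> E.

(* A C^2 immersion which is open onto its image: equivalently, range z is an
   embedded C^2 submanifold of dimension d, of which z is a (not necessarily
   injective) C^2 parametrization by local diffeomorphisms. *)
Definition C2_parametrization z : Prop :=
  [/\ C2 z,
      forall th, injective ('d z th) &
      forall th U, nbhs th U -> \forall x \near (z th), range z x -> (z @` U) x].

Definition tangent z (th : 'rV[R]_d) : set E := range ('d z th).

Definition auxiliary (f : R -> E -> R) z (eps : R) (th : 'rV[R]_d) (v : E) :
    Prop :=
  orth (tangent z th) v /\ tangent z th (grad (f eps) (z th + v)).

(* w eps th is the small solution of the auxiliary equation.  It is determined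
   only for small eps > 0, locally in th; its other values are arbitrary. *)
Definition reduction (f : R -> E -> R) z (w : R -> 'rV[R]_d -> E) : Prop :=
  forall th0 : 'rV[R]_d,
    (exists2 r, 0 < r &
       \forall eps \near 0^'+ & th \near th0,
         auxiliary f z eps th (w eps th) /\
         (forall v, `|v| < r -> auxiliary f z eps th v -> v = w eps th)) /\
    (fun p => w p.1 p.2) @ filter_prod 0^'+ (nbhs th0) --> (0 : E).

End Manifold.
End HilbertCalculus.

(* Main.v *)
(**
Write S for the orthogonal complement of the tangent space T at z_theta, B0 for
the Hessian form of f_0 at z_theta and e_i for the partial derivatives of z.
Invertibility of B0 on S turns the auxiliary equation into |w| = O(eps^alpha)
and f_eps'(u) = O(eps^alpha). Differentiating e_i = F''(z) e_i and using
(d_ij z | d_l z) = 0, one finds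
   D^2 f_eps(u)[e_i, e_j] = eps^alpha d_ij Gamma + o(eps^alpha),
   D^2 f_eps(u)[e_i, .] = o(eps^(alpha/2)).
Hence, after rescaling T by eps^(-alpha/2), the form D^2 f_eps(u) converges to
the direct sum of D^2 Gamma(theta) on T and B0 on S, which gives nondegeneracy
and the index.

No differentiability of w is needed for the continuity of u: the same estimate
of w applied to two solutions shows that the reduced gradient
Phi_i(t) = (f_eps'(z_t + w(eps, t)) | e_i(t)) satisfies
   Phi(t + h) - Phi(t) = eps^alpha (D^2 Gamma(theta) h + o(1) |h|)
for h small in terms of eps and t, with o(1) uniform near theta. Integrating along
segments, Phi is injective in a fixed ball; its zero there is unique, so by
compactness it depends continuously on eps.
*)

Require Import Defs.
From HB Require Import structures.
From mathcomp Require Import all_boot all_order all_algebra.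
From mathcomp Require Import all_classical all_reals all_analysis.
From mathcomp Require Import ring lra.

Set Implicit Arguments.
Unset Strict Implicit.
Unset Printing Implicit Defensive.

Import Order.TTheory GRing.Theory Num.Theory.
Import numFieldNormedType.Exports.

Local Open Scope classical_set_scope.
Local Open Scope ring_scope.

(* Otherwise unification unfolds the differentials of distinct functions when it
   compares them. *)
#[local] Opaque diff riesz.

(** * Symmetric forms on a Hilbert space *)

(** The limits in the hypotheses are taken along curves, but the continuity claim compares [u] at
    neighbouring parameters, so the estimates are made uniform for (eps, t) near (0, theta): points
    violating one of them could be threaded by a single curve. Two obstacles shape these estimates.
    The tangent spaces turn with t, while B0 is controlled only on the complement at z_theta; the
    frame e_i measures the turn, which is small near theta. And w, known only through its equation,
    has the same order eps^alpha as the tangential Hessian, so its effect -F'''(z)[e_i, e_j, w] is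
    not negligible. It equals -B0[d_ij z, w] up to o(eps^alpha), that is, minus the change of
    (f_eps' | d_ij z) from z to z + w; as f_eps'(z + w) is tangential and d_ij z normal, this is the
    term (G'(eps, z) | d_ij z) of the assumed limit. Index and invertibility are both read off from
    a negative subspace and a complementary positive one, with constants that may depend on eps. *)

Lemma nbhs_distP {R : realType} {V : normedModType R} (x : V) (P : set V) :
  (\forall y \near x, P y) <->
  exists2 r, 0 < r & forall y, `|y - x| < r -> P y.
Proof.
split=> [/nbhs_ballP [r /= r0 h]|[r r0 h]].
  exists r => // y hy; apply: h; by rewrite -ball_normE /ball_ /= distrC.
apply/nbhs_ballP; exists r => //= y; rewrite -ball_normE /ball_ /= distrC.
exact: h.
Qed.

Lemma near_dist_lt {R : realType} {V : normedModType R} (x : V) (e : R) :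
  0 < e -> \forall y \near x, `|x - y| < e.
Proof. by move=> e0; apply/nbhs_distP; exists e => // y; rewrite distrC. Qed.

Definition sym_bilinear {R : realType} {E : lmodType R} (B : E -> E -> R) :=
  (forall x y, B x y = B y x) /\
  (forall a x x' y, B (a *: x + x') y = a * B x y + B x' y).

Definition bounded_form {R : realType} {E : normedModType R}
    (B : E -> E -> R) :=
  exists K, forall x y, `|B x y| <= K * `|x| * `|y|.

Section BilinearAlgebra.
Context {R : realType} {E : lmodType R} {B : E -> E -> R}.
Hypothesis hB : sym_bilinear B.

Lemma bilC x y : B x y = B y x. Proof. exact: hB.1. Qed.

Lemma bilDl x x' y : B (x + x') y = B x y + B x' y.
Proof. by rewrite -[x in LHS]scale1r hB.2 mul1r. Qed.

Lemma bil0l y : B 0 y = 0.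
Proof. by have := bilDl 0 0 y; rewrite addr0; lra. Qed.

Lemma bilZl a x y : B (a *: x) y = a * B x y.
Proof. by rewrite -[a *: x]addr0 hB.2 bil0l addr0. Qed.

Lemma bilNl x y : B (- x) y = - B x y.
Proof. by rewrite -scaleN1r bilZl mulN1r. Qed.

Lemma bilBl x x' y : B (x - x') y = B x y - B x' y.
Proof. by rewrite bilDl bilNl. Qed.

Lemma bilDr x y y' : B x (y + y') = B x y + B x y'.
Proof. by rewrite bilC bilDl !(bilC x). Qed.
Lemma bilZr a x y : B x (a *: y) = a * B x y.
Proof. by rewrite bilC bilZl bilC. Qed.
Lemma bilNr x y : B x (- y) = - B x y.
Proof. by rewrite bilC bilNl bilC. Qed.
Lemma bilBr x y y' : B x (y - y') = B x y - B x y'.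
Proof. by rewrite bilDr bilNr. Qed.

Lemma bil_suml (I : finType) (a : I -> E) y :
  B (\sum_i a i) y = \sum_i B (a i) y.
Proof.
by apply: (big_morph (B ^~ y)) => [x x'|]; [exact: bilDl | exact: bil0l].
Qed.

Lemma bil_sumr (I : finType) (a : I -> E) x :
  B x (\sum_i a i) = \sum_i B x (a i).
Proof. by rewrite bilC bil_suml; apply: eq_bigr => i _; rewrite bilC. Qed.

End BilinearAlgebra.

Lemma bounded_formP {R : realType} {E : normedModType R} (B : E -> E -> R) :
  bounded_form B -> exists2 K, 0 < K & forall x y, `|B x y| <= K * `|x| * `|y|.
Proof.
move=> [K hK]; exists (`|K| + 1) => [|x y]; first by rewrite ltr_wpDl.
apply: le_trans (hK x y) _; rewrite -!mulrA ler_wpM2r ?mulr_ge0//.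
by rewrite (le_trans (ler_norm K)) ?lerDl.
Qed.

(** * Minimisation of a coercive quadratic energy *)

Section Representation.
Context {R : realType} {E : completeNormedModType R}.
Variables (B : E -> E -> R) (l : E -> R) (c K L : R).
Hypotheses (hB : sym_bilinear B) (c_gt0 : 0 < c).
Hypothesis hc : forall x, c * `|x| ^+ 2 <= B x x.
Hypothesis hK : forall x y, `|B x y| <= K * `|x| * `|y|.
Hypothesis hl : forall a x y, l (a *: x + y) = a * l x + l y.
Hypothesis hL : forall x, `|l x| <= L * `|x|.

(** Energy of the equation [B g v = l v]: its first variation at [x] in the direction [v] is
    [2 * (B x v - l v)], so a minimiser represents [l]. *)
Let q (x : E) := B x x - 2 * l x.
Let Q := range q.

Let lD x y : l (x + y) = l x + l y.
Proof. by rewrite -[x in LHS]scale1r hl mul1r. Qed.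

Let lZ a x : l (a *: x) = a * l x.
Proof.
have l0 : l 0 = 0 by have := lD 0 0; rewrite addr0; lra.
by rewrite -[a *: x]addr0 hl l0 addr0.
Qed.

Let q_lb x : - (L ^+ 2 / c) <= q x.
Proof.
have h1 := hc x; have := hL x; have := ler_norm (l x) => h2 h3.
rewrite -(ler_pM2l c_gt0) mulrN mulrCA divff ?gt_eqF// mulr1 /q.
have : c * (c * `|x| ^+ 2 - 2 * (L * `|x|)) <= c * (B x x - 2 * l x).
  by rewrite ler_pM2l//; lra.
apply: le_trans; have := sqr_ge0 (c * `|x| - L); lra.
Qed.

Let Q_inf : has_inf Q.
Proof.
split; first by exists (q 0), 0.
by exists (- (L ^+ 2 / c)) => _ [x _ <-]; exact: q_lb.
Qed.

Let m := inf Q.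

Let m_le x : m <= q x.
Proof. by apply: ge_inf; [exact: Q_inf.2 | exists x]. Qed.

(** The sublevel sets shrinking to the infimum play the role of a minimising sequence. *)
Let F := filter_from [set e : R | 0 < e] (fun e => [set x | q x < m + e]).

Let F_filter : ProperFilter F.
Proof.
apply: filter_from_proper => [|e /= e0].
  apply: filter_from_filter; first by exists 1; rewrite /= ltr01.
  move=> i j /= i0 j0; exists (Num.min i j); first by rewrite /= lt_min i0 j0.
  by move=> x /= h; split; apply: lt_le_trans h _; rewrite lerD2l ge_min lexx// orbT.
have [y [x _ <-] h] := inf_adherent e0 Q_inf.
by exists x.
Qed.

#[local] Existing Instance F_filter.

Let F_near e : 0 < e -> F [set x | q x < m + e].
Proof. by move=> e0; exists e. Qed.

(* the parallelogram identity for B *)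
Let q_near x y e : q x < m + e -> q y < m + e -> c * `|x - y| ^+ 2 <= 4 * e.
Proof.
move=> hx hy; apply: le_trans (hc _) _.
have := m_le (2^-1 *: (x + y)).
rewrite /q in hx hy *.
rewrite (bilBl hB) !(bilBr hB) (bilZl hB) (bilZr hB) (bilDl hB) !(bilDr hB) lZ lD.
by rewrite (bilC hB y x); lra.
Qed.

Let F_cvg : cvg F.
Proof.
apply: cauchy_cvg; apply: (@cauchy_exP R E F _) => e e0.
have h : 0 < c * e ^+ 2 / 8 by rewrite divr_gt0// mulr_gt0// exprn_gt0.
have [x hx] := @filter_ex _ _ F_filter _ (F_near h).
exists x; apply: filterS (F_near h) => y /= hy.
rewrite -ball_normE /ball_ /=.
rewrite -(@ltr_pXn2r _ 2%N)// ?nnegrE//; last exact: ltW.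
rewrite -(ltr_pM2l c_gt0); apply: le_lt_trans (q_near hx hy) _.
have : 0 < c * e ^+ 2 by rewrite mulr_gt0// exprn_gt0.
lra.
Qed.

Let B_cts x : (fun y => B y y) @ x --> B x x.
Proof.
have K0 : 0 <= `|K| + 1 by rewrite addr_ge0.
have hK' u v : `|B u v| <= (`|K| + 1) * `|u| * `|v|.
  apply: le_trans (hK u v) _; rewrite -!mulrA ler_wpM2r ?mulr_ge0//.
  by rewrite (le_trans (ler_norm K)) ?lerDl.
set A := (`|K| + 1) * (2 * `|x| + 1).
have A0 : 0 < A.
  by rewrite mulr_gt0// ltr_wpDl// mulr_ge0.
apply/cvgrPdist_lt => e e0.
near=> y.
have h1 : `|x - y| < 1 by near: y; exact: near_dist_lt.
have h2 : `|x - y| < e / A.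
  by near: y; apply: near_dist_lt; rewrite divr_gt0.
rewrite (_ : B x x - B y y = B (x - y) x + B (x - y) y); last first.
  by rewrite !(bilBl hB) (bilC hB y x); ring.
apply: (@le_lt_trans _ _ (`|x - y| * A)); last first.
  by rewrite -ltr_pdivlMr.
apply: le_trans (ler_normD _ _) _.
apply: le_trans (lerD (hK' _ _) (hK' _ _)) _.
have h3 : `|y| <= `|x| + 1.
  have := ler_normD (y - x) x; rewrite subrK distrC; lra.
rewrite /A -mulrDr -[_ * `|x - y|]mulrC -!mulrA ler_wpM2l// ler_wpM2l//.
lra.
Unshelve. all: by end_near. Qed.

Let l_cts x : l @ x --> l x.
Proof.
have L0 : 0 < `|L| + 1 by rewrite ltr_wpDl.
apply/cvgrPdist_lt => e e0.
near=> y.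
have h2 : `|x - y| < e / (`|L| + 1).
  by near: y; apply: near_dist_lt; rewrite divr_gt0.
have -> : l x - l y = l (x - y) by rewrite lD -[- y]scaleN1r lZ mulN1r.
apply: le_lt_trans (hL _) _.
move: h2; rewrite ltr_pdivlMr// mulrC; apply: le_lt_trans.
by rewrite ler_wpM2r// (le_trans (ler_norm L)) ?lerDl.
Unshelve. all: by end_near. Qed.

(** Serves twice: with [dot] it gives Riesz representation, with [dot (A x) (A y)] the surjectivity
    of a symmetric operator bounded below. *)
Lemma coercive_representation : exists g, forall v, B g v = l v.
Proof.
pose x := lim F.
have qx : q x <= m.
  apply/ler_addgt0Pr => e e0.
  have qF : q @ F --> q x.
    apply: (cvg_trans (cvg_app q F_cvg)).
    by apply: cvgB; [exact: B_cts | apply: cvgM; [exact: cvg_cst | exact: l_cts]].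
  have h : \forall y \near F, q y <= m + e.
    by apply: filterS (F_near e0) => y /= /ltW.
  have <- := cvg_lim (@Rhausdorff R) qF; apply: limr_le => //.
  by apply/cvg_ex; exists (q x).
exists x => v; apply/eqP; rewrite -subr_eq0; set D := B x v - l v.
have h t : 0 <= t ^+ 2 * B v v + 2 * t * D.
  have := le_trans qx (m_le (x + t *: v)); rewrite /q lD lZ.
  rewrite (bilDl hB) !(bilDr hB) !(bilZl hB) !(bilZr hB) (bilC hB v x) /D; lra.
have Bv : 0 <= B v v by apply: le_trans (hc v); rewrite mulr_ge0 ?sqr_ge0// ltW.
have B1 : 0 < B v v + 1 by lra.
(* Nearly the minimiser of this quadratic in [t]; the [+ 1] covers [B v v = 0]. The value is a
   negative multiple of [D ^+ 2], which forces [D = 0]. *)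
have := h (- D / (B v v + 1)).
have -> : (- D / (B v v + 1)) ^+ 2 * B v v + 2 * (- D / (B v v + 1)) * D
        = - (D ^+ 2) * (B v v + 2) / (B v v + 1) ^+ 2.
  by field; rewrite gt_eqF.
rewrite pmulr_lge0 ?invr_gt0 ?exprn_gt0// pmulr_lge0 ?oppr_ge0; last lra.
by move=> hD; rewrite -sqrf_eq0 eq_le hD sqr_ge0.
Qed.

End Representation.

Section HilbertAlgebra.
Context {R : realType} {E : hilbertType R}.
Implicit Types x y : E.

Lemma dot_sym : sym_bilinear (@dot R E).
Proof. by split=> [x y|a x x' y]; [exact: dotC | exact: dot_linear]. Qed.

Lemma dot_ge0 x : 0 <= dot x x. Proof. by rewrite dot_norm sqr_ge0. Qed.

Lemma dot_eq0 x : dot x x = 0 -> x = 0.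
Proof. by rewrite dot_norm => /eqP; rewrite sqrf_eq0 normr_eq0 => /eqP. Qed.

(** Positivity is demanded only on the span of [x] and [y], because the form to which this is
    applied later is semidefinite on a subspace only. *)
Lemma semidef_cauchy_schwarz (B : E -> E -> R) x y :
  sym_bilinear B -> (forall a b, 0 <= B (a *: x + b *: y) (a *: x + b *: y)) ->
  B x y ^+ 2 <= B x x * B y y.
Proof.
move=> hB h.
have e a b : 0 <= a ^+ 2 * B x x + 2 * a * b * B x y + b ^+ 2 * B y y.
  have := h a b.
  rewrite (bilDl hB) !(bilDr hB) !(bilZl hB) !(bilZr hB) (bilC hB y x); lra.
have Bx : 0 <= B x x by have := e 1 0; lra.
have By : 0 <= B y y by have := e 0 1; lra.
have [y0|y0] := eqVneq (B y y) 0.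
  (* For [B y y = 0] the usual combination gives nothing; this one evaluates to minus
     [B x y ^+ 2 * (B x x + 2)]. *)
  have := e (- B x y) (B x x + 1); rewrite y0 mulr0 addr0.
  have := sqr_ge0 (B x y).
  set t := B x x in Bx *; set s := B x y => h1 h2.
  have : 0 <= - (s ^+ 2 * (t + 2)) by lra.
  rewrite oppr_ge0 pmulr_lle0; lra.
have := e (B y y) (- B x y); have y1 : 0 < B y y by rewrite lt_def y0.
have -> : B y y ^+ 2 * B x x + 2 * B y y * - B x y * B x y +
  (- B x y) ^+ 2 * B y y = B y y * (B x x * B y y - B x y ^+ 2) by ring.
by rewrite pmulr_rge0// subr_ge0.
Qed.

Lemma dot_le x y : `|dot x y| <= `|x| * `|y|.
Proof.
rewrite -(@ler_pXn2r _ 2%N)// ?nnegrE ?mulr_ge0//.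
rewrite exprMn -!dot_norm real_normK ?num_real//.
by apply: (semidef_cauchy_schwarz dot_sym) => a b; exact: dot_ge0.
Qed.

Lemma norm_le_dot x (K : R) : 0 <= K ->
  (forall y, dot x y <= K * `|y|) -> `|x| <= K.
Proof.
move=> K0 h; have [->|x0] := eqVneq x 0; first by rewrite normr0.
by have := h x; rewrite dot_norm expr2 ler_pM2r// normr_gt0.
Qed.

Lemma dot_inj x y : (forall v, dot x v = dot y v) -> x = y.
Proof.
move=> h; apply/eqP; rewrite -subr_eq0; apply/eqP/dot_eq0.
by rewrite (bilBl dot_sym) h subrr.
Qed.

Lemma riesz_exists (l : E -> R) (L : R) :
  (forall a x y, l (a *: x + y) = a * l x + l y) ->
  (forall x, `|l x| <= L * `|x|) -> forall v, dot (riesz l) v = l v.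
Proof.
move=> hl hL.
have h : [set g : E | forall v, dot g v = l v] !=set0.
  apply: (@coercive_representation _ _ _ _ 1 1 L dot_sym) => //.
  - by move=> x; rewrite dot_norm mul1r.
  - by move=> x y; rewrite mul1r dot_le.
exact: (getPex h).
Qed.

(** If [dot (A x) (A y) = dot f (A y)] for all [y], then [A x - f] is orthogonal to the range of
    [A]; by symmetry [A] kills it, and the lower bound makes it 0. *)
Lemma bounded_below_bijective (A : E -> E) (K c : R) :
  (forall a x y, A (a *: x + y) = a *: A x + A y) ->
  (forall x, `|A x| <= K * `|x|) ->
  (forall x y, dot (A x) y = dot x (A y)) ->
  0 < c -> (forall x, c * `|x| <= `|A x|) ->
  exists A' : E -> E, (forall x, A' (A x) = x /\ A (A' x) = x) /\ continuous A'.
Proof.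
move=> hA hK sA c0 hc.
have hB : sym_bilinear (fun x y => dot (A x) (A y)).
  split=> [x y|a x x' y]; first exact: dotC.
  by rewrite hA (bilDl dot_sym) (bilZl dot_sym).
have AB x y : A (x - y) = A x - A y.
  by rewrite addrC -scaleN1r hA scaleN1r addrC.
have A0 x : A x = 0 -> x = 0.
  move=> h; have := hc x; rewrite h normr0 pmulr_rle0// normr_le0 => /eqP//.
have Ainj x y : A x = A y -> x = y.
  by move=> h; apply/eqP; rewrite -subr_eq0; apply/eqP/A0; rewrite AB h subrr.
have surj f : exists x, A x = f.
  have [x hx] : exists x, forall y, dot (A x) (A y) = dot f (A y).
    apply: (@coercive_representation _ _ _ _ (c ^+ 2) (K ^+ 2) (`|f| * K) hB).
    - by rewrite exprn_gt0.
    - move=> x; rewrite dot_norm -exprMn ler_pXn2r// ?nnegrE ?mulr_ge0//.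
      exact: ltW.
    - move=> x y; apply: le_trans (dot_le _ _) _.
      rewrite expr2 -mulrA mulrACA ler_pM//.
    - by move=> a x y; rewrite hA (bilDr dot_sym) (bilZr dot_sym).
    - by move=> x; apply: le_trans (dot_le _ _) _; rewrite -mulrA ler_wpM2l.
  exists x; apply: Ainj; apply: dot_inj => v.
  by rewrite sA [RHS]sA hx.
have [A' hA'] := choice surj.
exists A'; split.
  by move=> x; split; [apply: Ainj|]; rewrite hA'.
move=> x; apply/cvgrPdist_lt => e e0; near=> y.
have h : `|x - y| < e * c.
  by near: y; apply: near_dist_lt; rewrite mulr_gt0.
have := hc (A' x - A' y); rewrite AB !hA' => h'.
by rewrite -(ltr_pM2l c0) (le_lt_trans h')// mulrC.
Unshelve. all: by end_near. Qed.

End HilbertAlgebra.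

(** * Second and third differentials *)

Section Differentials.
Context {R : realType} {V W : normedModType R}.
Implicit Types f : V -> W.

Lemma differentiable_remainder f x (e : R) : differentiable f x -> 0 < e ->
  \forall h \near (0 : V), `|f (x + h) - f x - 'd f x h| <= e * `|h|.
Proof.
move=> df e0; have /eqaddoP/(_ _ e0) := diff_locally df.
by apply: filterS => h; rewrite -[_ - _ - _]addrA -opprD (addrC x).
Qed.

Lemma is_diff_remainder f (df : V -> W) x (K : R) :
  (forall a u v, df (a *: u + v) = a *: df u + df v) ->
  (forall h, `|df h| <= K * `|h|) ->
  (forall e, 0 < e -> \forall h \near (0 : V),
     `|f (x + h) - f x - df h| <= e * `|h|) -> is_diff x f df.
Proof.
move=> lin bd rem.
pose dlM := GRing.isLinear.Build _ _ _ _ df lin.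
pose dL : {linear V -> W} := HB.pack df dlM.
have cdL : continuous dL.
  apply: bounded_linear_continuous; apply/linear_boundedP.
  exists K; split; first exact: num_real.
  by move=> r Kr y; apply: le_trans (bd y) _; rewrite ler_wpM2r// ltW.
have ho : f \o shift x = cst (f x) + dL +o_ 0 id.
  apply/eqaddoP => e e0; apply: filterS (rem e e0) => h.
  by rewrite -[_ - _ - _]addrA -opprD (addrC x).
have E : 'd f x = df :> (V -> W) by rewrite (diff_unique cdL ho).
apply: DiffDef => //; apply/diff_locallyP; rewrite E; split; [exact: cdL|exact: ho].
Qed.

Lemma is_diffE f df x h : is_diff x f df -> 'd f x h = df h.
Proof. by move=> D; rewrite (@diff_val _ _ _ _ _ _ _ D). Qed.

Lemma diff_bounded f x : differentiable f x ->
  exists2 K, 0 < K & forall h, `|'d f x h| <= K * `|h|.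
Proof.
move=> /diff_continuous /linear_bounded_continuous /linear_boundedP.
by move=> /pinfty_ex_gt0 [K K0 h]; exists K.
Qed.

Lemma near0P (P : set V) :
  (\forall h \near (0 : V), P h) <->
  exists2 r, 0 < r & forall h, `|h| < r -> P h.
Proof.
rewrite nbhs_distP; split=> -[r r0 h]; exists r => // y hy; apply: h.
  by rewrite subr0.
by rewrite subr0 in hy.
Qed.

Lemma linear_bound (l : V -> W) (r C : R) : 0 < r -> 0 <= C ->
  (forall a u v, l (a *: u + v) = a *: l u + l v) ->
  (forall h, `|h| < r -> `|l h| <= C) -> forall h, `|l h| <= 2 / r * C * `|h|.
Proof.
move=> r0 C0 lin hC h.
have l0 : l 0 = 0.
  apply: (@addIr _ (l 0)); rewrite add0r -[X in X + _](scale1r (l 0)) -lin.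
  by rewrite scale1r addr0.
have [->|h0] := eqVneq h 0; first by rewrite l0 !normr0 mulr0.
have n0 : 0 < `|h| by rewrite normr_gt0.
pose a := r / 2 / `|h|.
have a0 : 0 < a by rewrite !divr_gt0.
have : `|l (a *: h)| <= C.
  apply: hC; rewrite normrZ gtr0_norm// /a divfK ?gt_eqF//.
  by rewrite ltr_pdivrMr// ltr_pMr// ltr1n.
rewrite -[a *: h]addr0 lin l0 addr0 normrZ gtr0_norm// -ler_pdivlMl//.
move=> /le_trans; apply; rewrite le_eqVlt; apply/orP; left; apply/eqP.
by rewrite /a; field; rewrite ?gt_eqF.
Qed.

End Differentials.

Section OperatorDerivative.
Context {R : realType} {V W : normedModType R} {P : Type}.
Variables (wt : P -> R) (T : V -> P -> W).
Hypothesis wt_ge0 : forall p, 0 <= wt p.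
Hypotheses (dT : differentiable_op wt T) (cT : continuous_op wt T).

(** Differentiability bounds the derivative separately for each [p]. Uniformity in [p] comes from
    the uniform remainder together with the continuity of [T] in operator norm, both on one small
    ball. *)
Lemma diff_op_bounded x :
  exists2 K, 0 < K & forall h p, `|'d (T ^~ p) x h| <= K * `|h| * wt p.
Proof.
have /near0P[r r0 hr] := dT.2 x _ ltr01.
have /nbhs_distP[s s0 hs] := cT x ltr01.
pose q := Num.min (Num.min r s) 1.
have q0 : 0 < q by rewrite !lt_min r0 s0 ltr01.
exists (2 / q * 2) => [|h p]; first by rewrite mulr_gt0// divr_gt0.
rewrite mulrAC -[leRHS]mulrA mulrCA !mulrA; set K := (X in _ <= X).
have -> : K = 2 / q * (2 * wt p) * `|h| by rewrite /K; ring.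
apply: linear_bound => //; first by rewrite mulr_ge0.
  by move=> a u v; rewrite linearP.
move=> k; rewrite !lt_min => /andP[/andP[kr ks] k1].
have h1 := hr k kr p; have h2 : `|T (x + k) p - T x p| <= 1 * wt p.
  by apply: hs; rewrite addrC addKr.
have -> : 'd (T ^~ p) x k =
  (T (x + k) p - T x p) - (T (x + k) p - T x p - 'd (T ^~ p) x k).
  by rewrite opprD addrA subrr add0r opprK.
apply: le_trans (ler_normB _ _) _.
have h3 : 1 * `|k| * wt p <= wt p by rewrite mul1r ler_piMl// ltW.
lra.
Qed.

End OperatorDerivative.

Section SecondOrder.
Context {R : realType} {V W : normedModType R}.
Implicit Types f : V -> W.

Lemma wt1_ge0 (v : V) : 0 <= wt1 v. Proof. exact: normr_ge0. Qed.
Lemma wt2_ge0 (v : V * V) : 0 <= wt2 v. Proof. exact: mulr_ge0. Qed.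

Lemma C2_differentiable f x : C2 f -> differentiable f x.
Proof. by move=> [[]]. Qed.

Lemma C2_differentiable_diff f x v : C2 f ->
  differentiable (fun y => 'd f y v) x.
Proof. by move=> [_ [+ _] _] => /(_ x v). Qed.

Lemma D2_linearr f x v a h k :
  D2 f x v (a *: h + k) = a *: D2 f x v h + D2 f x v k.
Proof. exact: linearP. Qed.

Lemma D2_linearl f x a u v h : C2 f ->
  D2 f x (a *: u + v) h = a *: D2 f x u h + D2 f x v h.
Proof.
move=> cf; have du := C2_differentiable_diff x u cf.
have dv := C2_differentiable_diff x v cf.
have D := is_diffD (is_diffZ a (differentiableP du)) (differentiableP dv).
rewrite /D2 (_ : (fun y => 'd f y (a *: u + v)) =
  a *: (fun y => 'd f y u) + (fun y => 'd f y v)).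
  by rewrite (@diff_val _ _ _ _ _ _ _ D).
by apply/funext => y; rewrite !fctE linearP.
Qed.

Lemma D2_bounded f x : C2 f ->
  exists2 K, 0 < K & forall u v, `|D2 f x u v| <= K * `|u| * `|v|.
Proof.
move=> [[_ c1] d1 _]; have [K K0 hK] := diff_op_bounded wt1_ge0 d1 c1 x.
by exists K => // u v; rewrite mulrAC; exact: hK.
Qed.

Lemma C3_differentiable_D2 f x u v : C3 f ->
  differentiable (fun y => D2 f y u v) x.
Proof. by move=> [_ [+ _] _] => /(_ x (u, v)). Qed.

Lemma D3_bounded f x : C3 f ->
  exists2 K, 0 < K &
    forall u v w, `|D3 f x u v w| <= K * `|u| * `|v| * `|w|.
Proof.
move=> [[_ _ c2] d2 _].
have [K K0 hK] := diff_op_bounded wt2_ge0 d2 c2 x.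
exists K => // u v w; have := hK w (u, v); rewrite /wt2 /=.
by congr (_ <= _); ring.
Qed.

End SecondOrder.

Section Segment.
Context {R : realType} {V : normedModType R}.

Lemma segment_MVT (f : V -> R) x h :
  (forall s, 0 <= s <= 1 -> differentiable f (x + s *: h)) ->
  exists2 s, 0 <= s <= 1 & f (x + h) - f x = 'd f (x + s *: h) h.
Proof.
move=> df.
pose g (s : R) := x + s *: h.
have dg s : is_diff s g (fun t => t *: h).
  apply: (@is_diff_remainder _ _ _ _ _ _ `|h|) => [a u v|t|e e0].
  - by rewrite scalerDl scalerA.
  - by rewrite normrZ mulrC.
  - near=> t; rewrite /g scalerDl addrA [_ + t *: h]addrC addrK subrr normr0.
    by rewrite mulr_ge0// ltW.
have dfg (s : R) : 0 <= s <= 1 -> is_derive s 1 (f \o g) ('d f (g s) h).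
  move=> hs; have dfs := df s hs.
  have D : differentiable (f \o g) s by apply: differentiable_comp.
  split; first exact: diff_derivable.
  by rewrite deriveE// diff_comp//= (@diff_val _ _ _ _ _ _ _ (dg s)) scale1r.
have [||s hs] := @MVT_segment _ (f \o g) (fun s => 'd f (g s) h) 0 1 ler01.
- by move=> t; rewrite in_itv/= => /andP[t0 t1]; apply: dfg; rewrite !ltW.
- apply: continuous_in_subspaceT => t; rewrite inE /= in_itv /= => ht.
  apply: differentiable_continuous; apply/derivable1_diffP.
  by have [] := dfg t ht.
- by rewrite in_itv/= in hs; rewrite /g /= scale0r addr0 scale1r subr0 mulr1; exists s.
Unshelve. all: by end_near. Qed.

End Segment.

Section Schwarz.
Context {R : realType} {V : normedModType R}.
Variable f : V -> R.
Hypothesis df : forall x, differentiable f x.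
Hypothesis ddf : forall x v, differentiable (fun y => 'd f y v) x.

(** Mean value theorem for the difference of [f] in the direction [s *: v], taken along [s *: u];
    then the first-order remainder of ['d f _ u] at [x], evaluated at the two points that appear.
    Both are within O(s) of [x], so the remainders are o(s). *)
Let second_difference x u v (e : R) : 0 < e -> \forall s \near (0 : R), 0 < s ->
  `|f (x + s *: u + s *: v) - f (x + s *: u) - f (x + s *: v) + f x -
    s ^+ 2 * D2 f x u v| <= e * s ^+ 2.
Proof.
(* Each of the two displacements has norm at most [s * M / 2], so the two remainders total at most
   [e / M * (s * M) = e * s]. *)
move=> e0; pose M := 2 * (`|u| + `|v| + 1).
have M0 : 0 < M by rewrite mulr_gt0// ltr_wpDl ?addr_ge0.
have /near0P[r r0 hr] : \forall h \near (0 : V),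
    `|'d f (x + h) u - 'd f x u - D2 f x u h| <= e / M * `|h|.
  exact: (differentiable_remainder (ddf x u) (divr_gt0 e0 M0)).
apply/near0P; exists (r / M) => [|s sr s0]; first by rewrite divr_gt0.
rewrite gtr0_norm// ltr_pdivlMr// in sr.
pose g y := f (y + s *: v) - f y.
have dsh y : is_diff y (fun y => y + s *: v) id.
  apply: (@is_diff_remainder _ _ _ _ _ _ 1) => [//|h|d d0]; first by rewrite mul1r.
  near=> h; rewrite (addrAC y) [_ + h]addrC addrK subrr normr0.
  by rewrite mulr_ge0// ltW.
have dg y : is_diff y g (fun h => 'd f (y + s *: v) h - 'd f y h).
  have Df1 : is_diff y (f \o (fun y => y + s *: v)) ('d f (y + s *: v) \o id).
    by apply: is_diff_comp; exact: differentiableP.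
  have Df2 : is_diff y f ('d f y) by exact: differentiableP.
  exact: is_diff_eq (is_diffB Df1 Df2) _.
have [t /andP[t0 t1]] := @segment_MVT _ _ g x (s *: u) (fun s _ => ex_diff (is_diff_def := dg _)).
have lz p : 'd f p (s *: u) = s * 'd f p u by rewrite linearZ.
rewrite (@diff_val _ _ _ _ _ _ _ (dg _)) /= /g.
set y := x + t *: (s *: u); rewrite !lz => E.
have -> : f (x + s *: u + s *: v) - f (x + s *: u) - f (x + s *: v) + f x =
  s * ('d f (y + s *: v) u - 'd f y u).
  by rewrite mulrBr -E; ring.
have n1 : `|t *: (s *: u)| <= s * `|u|.
  rewrite !normrZ (gtr0_norm s0) ger0_norm// ler_piMl// mulr_ge0// ltW//.
have n2 : `|t *: (s *: u) + s *: v| <= s * (`|u| + `|v|).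
  rewrite mulrDr (le_trans (ler_normD _ _))// lerD// normrZ gtr0_norm//.
have sM : s * (`|u| + `|v|) <= s * M / 2.
  by rewrite -mulrA ler_pM2l// /M; lra.
have sMpos : 0 < s * M by rewrite mulr_gt0.
have h1 := hr (t *: (s *: u)).
have h2 := hr (t *: (s *: u) + s *: v).
have su : s * `|u| <= s * M / 2.
  by rewrite -mulrA ler_pM2l// /M; have := normr_ge0 v; lra.
have sr2 : s * M / 2 < r by lra.
have {}h1 := h1 (le_lt_trans n1 (le_lt_trans su sr2)).
have {}h2 := h2 (le_lt_trans n2 (le_lt_trans sM sr2)).
have lD : D2 f x u (t *: (s *: u) + s *: v) =
    D2 f x u (t *: (s *: u)) + s * D2 f x u v.
  by rewrite addrC D2_linearr addrC.
move: h1 h2; rewrite lD addrA -/y.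
set a := 'd f y u; set b := 'd f (y + s *: v) u; set c := 'd f x u.
set k := D2 f x u (t *: _); set D := D2 f x u v => h1 h2.
have -> : s * (b - a) - s ^+ 2 * D = s * ((b - c - (k + s * D)) - (a - c - k)).
  by ring.
rewrite normrM (gtr0_norm s0) expr2 mulrCA ler_pM2l//.
apply: le_trans (ler_normB _ _) _.
apply: le_trans (lerD h2 h1) _.
have -> : e * s = e / M * (s * M) by field; rewrite gt_eqF.
rewrite -mulrDr ler_pM2l ?divr_gt0//; lra.
Unshelve. all: by end_near. Qed.

(** The second difference is symmetric in [u] and [v], and divided by [s ^+ 2] it approximates both
    mixed derivatives. *)
Lemma D2_sym x u v : D2 f x u v = D2 f x v u.
Proof.
apply/eqP; rewrite -subr_eq0 -normr_le0; apply/ler_addgt0Pr => e e0.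
rewrite add0r; have e2 : 0 < e / 2 by rewrite divr_gt0.
have /near0P[r r0 hr] := second_difference x u v e2.
have /near0P[q q0 hq] := second_difference x v u e2.
pose s := Num.min r q / 2.
have s0 : 0 < s by rewrite divr_gt0// lt_min r0.
have sm : s < Num.min r q by rewrite /s ltr_pdivrMr// ltr_pMr ?ltr1n// lt_min r0.
move: sm; rewrite lt_min => /andP[sr sq].
have := hr s; rewrite (gtr0_norm s0) => /(_ sr s0).
have := hq s; rewrite (gtr0_norm s0) => /(_ sq s0).
rewrite (addrAC x (s *: v)).
set A := f _; set a := f _; set b := f _; set c := f _; set D := D2 _ _ _ _.
set D' := D2 _ _ _ _ => h1 h2.
have s2 : 0 < s ^+ 2 by rewrite exprn_gt0.
rewrite -(ler_pM2l s2) -{1}(gtr0_norm s2) -normrM.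
have -> : s ^+ 2 * (D' - D) =
  (A - a - b + c - s ^+ 2 * D) - (A - b - a + c - s ^+ 2 * D') by ring.
apply: le_trans (ler_normB _ _) _; lra.
Qed.

End Schwarz.

Section SymmetricDerivatives.
Context {R : realType} {V : normedModType R}.
Implicit Types f : V -> R.

Lemma C2_sym_bilinear f x : C2 f -> sym_bilinear (D2 f x).
Proof.
move=> cf; split=> [u v|a u v h]; last by rewrite D2_linearl.
apply: D2_sym => [y|y w]; [exact: C2_differentiable | exact: C2_differentiable_diff].
Qed.

Lemma C3_sym12 f x u v w : C3 f -> D3 f x u v w = D3 f x v u w.
Proof.
move=> [cf _ _]; rewrite /D3; congr ('d _ x w); apply/funext => y.
exact: (C2_sym_bilinear y cf).1.
Qed.

(** Schwarz's theorem for the scalar function ['d f _ u]. *)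
Lemma C3_sym23 f x u v w : C3 f -> D3 f x u v w = D3 f x u w v.
Proof.
move=> cf; apply: (@D2_sym _ _ (fun y => 'd f y u)) => [y|y h].
  by apply: C2_differentiable_diff; case: cf.
exact: C3_differentiable_D2 y u h cf.
Qed.

End SymmetricDerivatives.

Section Gradients.
Context {R : realType} {E : hilbertType R}.
Implicit Types f : E -> R.

Lemma grad_dot f x v : differentiable f x -> dot (grad f x) v = 'd f x v.
Proof.
move=> df; have [K _ hK] := diff_bounded df.
by apply: (@riesz_exists _ _ _ K) => // a u w; rewrite linearP.
Qed.

Lemma C2_grad_dot f x v : C2 f -> dot (grad f x) v = 'd f x v.
Proof. by move=> cf; apply: grad_dot; exact: C2_differentiable. Qed.

Lemma hess_dot f x v w : C2 f -> dot (hess f x v) w = D2 f x v w.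
Proof.
move=> cf; have [K _ hK] := D2_bounded x cf.
apply: (@riesz_exists _ _ _ (K * `|v|)) => [a u w'|w']; last exact: hK.
exact: D2_linearr.
Qed.

Lemma third_dot f x u v w : C3 f -> dot (third f x u v) w = D3 f x u v w.
Proof.
move=> cf; have [K _ hK] := D3_bounded x cf.
apply: (@riesz_exists _ _ _ (K * `|u| * `|v|)) => [a h k|w']; last exact: hK.
by rewrite /D3 linearP.
Qed.

Lemma norm_dot_diff (x y : E) (K : R) : 0 <= K ->
  (forall v, `|dot x v - dot y v| <= K * `|v|) -> `|x - y| <= K.
Proof.
move=> K0 h; apply: norm_le_dot => // v.
by rewrite (bilBl dot_sym) (le_trans (ler_norm _)).
Qed.

Lemma grad_continuous f : C2 f -> continuous (grad f).
Proof.
move=> cf x; apply/cvgrPdist_le => e e0.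
have [[_ c1] _ _] := cf.
apply: filterS (c1 x e e0) => y hy; rewrite distrC.
apply: norm_dot_diff => [|v]; first exact: ltW.
by rewrite !(C2_grad_dot _ _ cf); exact: hy.
Qed.

Lemma is_diff_half_sqr_norm (x : E) :
  is_diff x (fun u : E => 2^-1 * `|u| ^+ 2) (dot x).
Proof.
apply: (@is_diff_remainder _ _ _ _ _ _ `|x|) => [a u v|h|e e0].
- by rewrite (bilDr dot_sym) (bilZr dot_sym).
- exact: dot_le.
- apply/near0P; exists e => // h he.
  rewrite -!dot_norm (bilDl dot_sym) !(bilDr dot_sym) (dotC h x).
  have -> : 2^-1 * (dot x x + dot x h + (dot x h + dot h h)) - 2^-1 * dot x x
    - dot x h = 2^-1 * dot h h by field.
  rewrite dot_norm ger0_norm ?mulr_ge0 ?sqr_ge0// expr2 mulrA.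
  rewrite ler_wpM2r//; have := normr_ge0 h; lra.
Qed.

Lemma is_diff_dotr (x v : E) : is_diff x (dot ^~ v) (dot ^~ v).
Proof.
apply: (@is_diff_remainder _ _ _ _ _ _ `|v|) => [a u w|h|e e0].
- by rewrite (bilDl dot_sym) (bilZl dot_sym).
- by rewrite mulrC dot_le.
- near=> h; rewrite (bilDl dot_sym) (addrC (dot x v)) addrK subrr normr0.
  by rewrite mulr_ge0// ltW.
Unshelve. all: by end_near. Qed.

End Gradients.

Lemma D2E {R : realType} {V W : normedModType R} (f : V -> W) x u v :
  D2 f x u v = 'd (fun y => 'd f y u) x v.
Proof. by []. Qed.

Lemma D3E {R : realType} {V W : normedModType R} (f : V -> W) x u v w :
  D3 f x u v w = 'd (fun y => D2 f y u v) x w.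
Proof. by []. Qed.

#[local] Opaque D2 D3 grad hess third.

Lemma segment_dist_lt {R : realType} {V : normedModType R} (p u h : V) (r s : R) :
  0 <= s <= 1 -> `|u - p| < r -> `|u + h - p| < r -> `|u + s *: h - p| < r.
Proof.
move=> /andP[s0 s1] hu hh.
have -> : u + s *: h - p = (1 - s) *: (u - p) + s *: (u + h - p).
  by rewrite (addrAC u h) (addrAC u (s *: h)) scalerBl scale1r [s *: (_ + h)]scalerDr addrA subrK.
apply: le_lt_trans (ler_normD _ _) _.
rewrite !normrZ (ger0_norm s0) ger0_norm ?subr_ge0//.
have [->|sn] := eqVneq s 0; first by rewrite subr0 mul1r mul0r addr0.
have s0' : 0 < s by rewrite lt_def sn.
have : s * `|u + h - p| < s * r by rewrite ltr_pM2l.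
have : (1 - s) * `|u - p| <= (1 - s) * r by rewrite ler_wpM2l ?subr_ge0// ltW.
lra.
Qed.

(** * Gradient and Hessian of the functional, uniformly near eps = 0 *)

Section Functional.
Context {R : realType} {E : hilbertType R}.
Variables (F : E -> R) (G : R -> E -> R).
Hypotheses (hF0 : C2 F) (hG1 : forall eps, C2 (G eps)).

Lemma is_diff_functional e x :
  is_diff x (functional F G e) (fun v => dot x v - 'd F x v + 'd (G e) x v).
Proof.
have := is_diffD (is_diffB (is_diff_half_sqr_norm x)
  (differentiableP (C2_differentiable x hF0)))
  (differentiableP (C2_differentiable x (hG1 e))).
exact.
Qed.

Lemma diff_functional e x v :
  'd (functional F G e) x v = dot x v - 'd F x v + 'd (G e) x v.
Proof. exact: (is_diffE v (is_diff_functional e x)). Qed.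

Lemma grad_functional_dot e x v :
  dot (grad (functional F G e) x) v = 'd (functional F G e) x v.
Proof. by apply: grad_dot; have [] := is_diff_functional e x. Qed.

Lemma grad_functionalE e x :
  grad (functional F G e) x = x - grad F x + grad (G e) x.
Proof.
apply: dot_inj => v; rewrite grad_functional_dot diff_functional.
rewrite (bilDl dot_sym) (bilBl dot_sym).
by congr (_ - _ + _); symmetry; apply: C2_grad_dot; [exact: hF0 | exact: hG1].
Qed.

Lemma is_diff_diff_functional e x v :
  is_diff x (fun y => 'd (functional F G e) y v)
    (fun h => dot h v - D2 F x v h + D2 (G e) x v h).
Proof.
rewrite (_ : (fun y => _) = (dot ^~ v) - (fun y => 'd F y v) + (fun y => 'd (G e) y v)).
  have := is_diffD (is_diffB (is_diff_dotr x v)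
    (differentiableP (C2_differentiable_diff x v hF0)))
    (differentiableP (C2_differentiable_diff x v (hG1 e))).
  exact.
by apply/funext => y; rewrite diff_functional.
Qed.

Lemma D2_functional e x v h :
  D2 (functional F G e) x v h = dot v h - D2 F x v h + D2 (G e) x v h.
Proof.
by rewrite (dotC v) D2E; exact: (is_diffE h (is_diff_diff_functional e x v)).
Qed.

Lemma D2_functional_sym e x : sym_bilinear (D2 (functional F G e) x).
Proof.
have hF := C2_sym_bilinear x hF0; have hG := C2_sym_bilinear x (hG1 e).
split=> [u v|a u u' v]; rewrite !D2_functional.
  by rewrite dotC (bilC hF) (bilC hG).
rewrite (bilDl dot_sym) (bilZl dot_sym) (bilDl hF) (bilZl hF).
rewrite (bilDl hG) (bilZl hG).
move: (D2 F x u v) (D2 F x u' v) (D2 (G e) x u v) (D2 (G e) x u' v) => p q r s.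
ring.
Qed.

Lemma D2_functional_bounded e x : bounded_form (D2 (functional F G e) x).
Proof.
have [K _ hK] := D2_bounded x hF0; have [L _ hL] := D2_bounded x (hG1 e).
exists (1 + K + L) => u v; rewrite D2_functional.
apply: le_trans (ler_normD _ _) _; rewrite !mulrDl mul1r lerD//.
by apply: le_trans (ler_normB _ _) _; rewrite lerD// dot_le.
Qed.

(** The gradient is tested against [v] because the mean value equality is scalar. The intermediate
    point depends on [v], which is harmless where the Hessian is controlled on a whole ball. *)
Lemma grad_functional_MVT e x h v : exists2 s, 0 <= s <= 1 &
  dot (grad (functional F G e) (x + h) - grad (functional F G e) x) v =
  D2 (functional F G e) (x + s *: h) h v.
Proof.
have [t _|s hs es] := @segment_MVT _ _ (fun y => 'd (functional F G e) y v) x h.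
  by have [] := is_diff_diff_functional e (x + t *: h) v.
exists s => //; rewrite (bilBl dot_sym) !grad_functional_dot es.
by rewrite -D2E (bilC (D2_functional_sym e _)).
Qed.

Section ThirdOrder.
Hypotheses (hF4 : C3 F) (hG4 : forall eps, C3 (G eps)).

Lemma D2_functional_MVT e x h u v : exists2 s, 0 <= s <= 1 &
  D2 (functional F G e) (x + h) u v - D2 (functional F G e) x u v =
  - D3 F (x + s *: h) u v h + D3 (G e) (x + s *: h) u v h.
Proof.
have D y : is_diff y (fun y => - D2 F y u v + D2 (G e) y u v)
    (fun h => - D3 F y u v h + D3 (G e) y u v h).
  have := is_diffD (is_diffN (differentiableP (C3_differentiable_D2 y u v hF4)))
    (differentiableP (C3_differentiable_D2 y u v (hG4 e))).
  exact.
have [t _|s hs es] := @segment_MVT _ _ (fun y => - D2 F y u v + D2 (G e) y u v) x h.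
  by have [] := D (x + t *: h).
exists s => //; rewrite !D2_functional.
have <- := is_diffE h (D (x + s *: h)).
move: es => <-; move: (D2 F _ u v) (D2 F x u v) (D2 (G e) _ u v) (D2 (G e) x u v) => p q r q'; ring.
Qed.

End ThirdOrder.

Hypothesis hG2 : continuous (fun p : R * E => grad (G p.1) p.2).
Hypothesis hG2' : continuous_op wt1 (fun (p : R * E) v => hess (G p.1) p.2 v).
Hypothesis hG00 : forall u, G 0 u = 0.

Lemma grad_functional_continuous :
  continuous (fun p : R * E => grad (functional F G p.1) p.2).
Proof.
move=> p.
rewrite (_ : (fun q => _) = fun q : R * E => q.2 - grad F q.2 + grad (G q.1) q.2).
  apply: cvgD; last exact: hG2.
  apply: cvgB; first exact: cvg_snd.
  apply: (cvg_comp (fun q : R * E => q.2) (grad F)); first exact: cvg_snd.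
  exact: grad_continuous.
by apply/funext => q; rewrite grad_functionalE.
Qed.

Lemma near_pairP (p : E) (Q : R -> E -> Prop) :
  (\forall q \near ((0, p) : R * E), Q q.1 q.2) ->
  exists2 r, 0 < r & forall e u, `|e| < r -> `|u - p| < r -> Q e u.
Proof.
move=> /nbhs_distP[r r0 h]; exists r => // e u he hu; apply: (h (e, u)).
by rewrite prod_normE /= gt_max subr0 he hu.
Qed.

Let G0E : G 0 = cst 0. Proof. exact/funext. Qed.

Let D2G0 x u v : D2 (G 0) x u v = 0.
Proof.
rewrite D2E (_ : (fun y => _) = cst 0); first by rewrite diff_cst.
by apply/funext => y; rewrite G0E diff_cst.
Qed.

Lemma D2_functional0 x u v : D2 (functional F G 0) x u v = dot u v - D2 F x u v.
Proof. by rewrite D2_functional D2G0 addr0. Qed.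

Lemma grad_functional0 x : grad (functional F G 0) x = x - grad F x.
Proof.
rewrite grad_functionalE -[RHS]addr0; congr (_ + _).
apply: dot_inj => v; rewrite (bil0l dot_sym).
by rewrite (C2_grad_dot x v (hG1 0)) G0E diff_cst.
Qed.

(** As [G 0] vanishes identically, continuity of its Hessian at [(0, p)] makes the contribution of
    [G] small near that point. *)
Lemma D2_functional_near p (eta : R) : 0 < eta ->
  exists2 r, 0 < r & forall e u, `|e| < r -> `|u - p| < r -> forall x y,
    `|D2 (functional F G e) u x y - D2 (functional F G 0) p x y|
      <= eta * `|x| * `|y|.
Proof.
move=> eta0; have e2 : 0 < eta / 2 by rewrite divr_gt0.
have [_ _ cF] := hF0.
have /nbhs_distP[r1 r10 h1] := cF p _ e2.
have [r2 r20 h2] := near_pairP (Q := fun e u => forall v,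
  `|hess (G e) u v - hess (G 0) p v| <= eta / 2 * wt1 v) (hG2' (0, p) e2).
exists (Num.min r1 r2) => [|e u]; first by rewrite lt_min r10.
rewrite !lt_min => /andP[_ er] /andP[ur1 ur2] x y.
have := h1 u ur1 (x, y); rewrite /wt2 /=; have := h2 e u er ur2 x.
rewrite D2_functional D2_functional0 /wt1 => k1 k2.
have k3 : `|D2 (G e) u x y| <= eta / 2 * `|x| * `|y|.
  have -> : D2 (G e) u x y = dot (hess (G e) u x) y - dot (hess (G 0) p x) y.
    have e1 := hess_dot u x y (hG1 e).
    have e3 : dot (hess (G 0) p x) y = 0.
      exact: etrans (hess_dot p x y (hG1 0)) (D2G0 p x y).
    exact: etrans (esym (subr0 _)) (congr2 (fun a b => a - b) (esym e1) (esym e3)).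
  rewrite -(bilBl dot_sym).
  by apply: le_trans (dot_le _ _) _; rewrite ler_wpM2r.
have arith (D a b c k l : R) : `|a - b| <= k -> `|c| <= l ->
    `|D - a + c - (D - b)| <= k + l.
  move=> h h'; rewrite (_ : _ - (D - b) = - (a - b) + c); last by ring.
  by rewrite (le_trans (ler_normD _ _))// normrN lerD.
apply: le_trans (arith _ _ _ _ _ _ k2 k3) _.
by rewrite le_eqVlt; apply/orP; left; apply/eqP; field.
Qed.

Lemma D2_functional_continuous e p (eta : R) : 0 < eta ->
  exists2 r, 0 < r & forall u, `|u - p| < r -> forall x y,
    `|D2 (functional F G e) u x y - D2 (functional F G e) p x y|
      <= eta * `|x| * `|y|.
Proof.
move=> eta0; have e2 : 0 < eta / 2 by rewrite divr_gt0.
have [_ _ cF] := hF0; have [_ _ cG] := hG1 e.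
have /nbhs_distP[r1 r10 h1] := cF p _ e2.
have /nbhs_distP[r2 r20 h2] := cG p _ e2.
exists (Num.min r1 r2) => [|u]; first by rewrite lt_min r10.
rewrite lt_min => /andP[ur1 ur2] x y.
have := h1 u ur1 (x, y); have := h2 u ur2 (x, y); rewrite /wt2 /= => k1 k2.
rewrite !D2_functional.
have arith (D a b a' b' k l : R) : `|a - b| <= k -> `|a' - b'| <= l ->
    `|D - a + a' - (D - b + b')| <= k + l.
  move=> h h'; rewrite (_ : _ - (D - b + b') = - (a - b) + (a' - b')); last by ring.
  by rewrite (le_trans (ler_normD _ _))// normrN lerD.
apply: le_trans (arith _ _ _ _ _ _ _ k2 k1) _.
by rewrite le_eqVlt; apply/orP; left; apply/eqP; field.
Qed.

(** Strict differentiability, uniform in [e]: both points are free, yet the reference form stays the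
    unperturbed one at [p]. All later gradient differences can thus be compared through a single
    form. *)
Lemma grad_functional_near p (eta : R) : 0 < eta ->
  exists2 r, 0 < r & forall e u u', `|e| < r -> `|u - p| < r -> `|u' - p| < r ->
    forall y, `|dot (grad (functional F G e) u' - grad (functional F G e) u) y -
      D2 (functional F G 0) p (u' - u) y| <= eta * `|u' - u| * `|y|.
Proof.
move=> eta0; have [r r0 hr] := D2_functional_near p eta0.
exists r => // e u u' er ur ur' y.
have [s hs] := grad_functional_MVT e u (u' - u) y.
have E1 : u + (u' - u) = u' by rewrite addrC subrK.
rewrite E1 => ->; apply: hr => //.
by apply: segment_dist_lt => //; rewrite E1.
Qed.

End Functional.

Section FunctionalThirdOrder.
Context {R : realType} {E : hilbertType R}.
Variables (F : E -> R) (G : R -> E -> R).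
Hypotheses (hF4 : C3 F) (hG4 : forall eps, C3 (G eps)).
Hypothesis hG00 : forall u, G 0 u = 0.
Hypothesis hG4' : continuous_op wt2
  (fun (p : R * E) v => third (G p.1) p.2 v.1 v.2).

Let hF0 : C2 F. Proof. by case: hF4. Qed.
Let hG1 eps : C2 (G eps). Proof. by case: (hG4 eps). Qed.

Let D3G0 x u v w : D3 (G 0) x u v w = 0.
Proof.
have G0E : G 0 = cst 0 by exact/funext.
rewrite D3E (_ : (fun y => _) = cst 0); first by rewrite diff_cst.
apply/funext => y; rewrite D2E (_ : (fun y => _) = cst 0); first by rewrite diff_cst.
by apply/funext => t; rewrite G0E diff_cst.
Qed.

(** The plus sign comes from [- F] in the functional: the quadratic term has no third derivative,
    and that of [G] is small because [G 0] vanishes. *)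
Lemma D2_functional_increment p (eta : R) : 0 < eta ->
  exists2 r, 0 < r & forall e u u', `|e| < r -> `|u - p| < r -> `|u' - p| < r ->
    forall x y, `|D2 (functional F G e) u' x y - D2 (functional F G e) u x y +
      D3 F p x y (u' - u)| <= eta * `|u' - u| * `|x| * `|y|.
Proof.
move=> eta0; have e2 : 0 < eta / 2 by rewrite divr_gt0.
have [_ _ cF] := hF4.
have /nbhs_distP[r1 r10 h1] := cF p _ e2.
have [r2 r20 h2] := near_pairP (Q := fun e u => forall v,
  `|third (G e) u v.1 v.2 - third (G 0) p v.1 v.2| <= eta / 2 * wt2 v)
  (hG4' (0, p) e2).
exists (Num.min r1 r2) => [|e u u']; first by rewrite lt_min r10.
rewrite !lt_min => /andP[_ er] /andP[ur1 ur2] /andP[ur1' ur2'] x y.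
have [s hs] := D2_functional_MVT hF0 hG1 hF4 hG4 e u (u' - u) x y.
have E1 : u + (u' - u) = u' by rewrite addrC subrK.
rewrite E1 => ->; set h := u' - u; set q := u + s *: h.
have qr1 : `|q - p| < r1 by apply: segment_dist_lt => //; rewrite E1.
have qr2 : `|q - p| < r2 by apply: segment_dist_lt => //; rewrite E1.
have k1 : `|D3 F q x y h - D3 F p x y h| <= eta / 2 * (`|x| * `|y| * `|h|).
  exact: (h1 q qr1 (x, y, h)).
have k2 : `|D3 (G e) q x y h| <= eta / 2 * (`|x| * `|y|) * `|h|.
  have -> : D3 (G e) q x y h = dot (third (G e) q x y) h - dot (third (G 0) p x y) h.
    have e1 := third_dot q x y h (hG4 e).
    have e3 : dot (third (G 0) p x y) h = 0.
      exact: etrans (third_dot p x y h (hG4 0)) (D3G0 p x y h).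
    exact: etrans (esym (subr0 _)) (congr2 (fun a b => a - b) (esym e1) (esym e3)).
  rewrite -(bilBl dot_sym).
  by apply: le_trans (dot_le _ _) _; rewrite ler_wpM2r//; exact: (h2 e q er qr2 (x, y)).
have arith (a b c k l : R) : `|a - b| <= k -> `|c| <= l -> `|- a + c + b| <= k + l.
  move=> g g'; rewrite (_ : _ + b = - (a - b) + c); last by ring.
  by rewrite (le_trans (ler_normD _ _))// normrN lerD.
apply: le_trans (arith _ _ _ _ _ k1 k2) _.
by rewrite le_eqVlt; apply/orP; left; apply/eqP; field.
Qed.

End FunctionalThirdOrder.

(** * Index of a form *)

Section DefiniteMatrices.
Context {R : realType} {d : nat}.
Implicit Types (H M : 'M[R]_d) (x : 'rV[R]_d).

(** Row vectors carry the sup norm; this is the source of the dimension factors in the sums over the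
    frame. *)
Lemma rV_entry_le n (x : 'rV[R]_n) i : `|x 0 i| <= `|x|.
Proof.
rewrite [leRHS]/Num.norm /= mx_normrE.
have /mapP[j Hj ->] : `|x 0 i| \in [seq `|x p.1 p.2| | p : 'I_1 * 'I_n].
  by apply/mapP; exists (ord0, i) => //=; rewrite mem_enum.
by apply/bigmax_geP; right => /=; exists j.
Qed.

Lemma quadE H x :
  (x *m H *m x^T) 0 0 = \sum_i \sum_j x 0 i * x 0 j * H i j.
Proof.
rewrite mxE exchange_big /=; apply: eq_bigr => j _.
rewrite mxE big_distrl /=; apply: eq_bigr => i _.
by rewrite !mxE; ring.
Qed.

Let continuous_sumr n (f : 'I_n -> 'rV[R]_d -> R) :
  (forall i, continuous (f i)) -> continuous (fun x => \sum_i f i x).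
Proof.
move=> cf; rewrite (_ : (fun x => _) = \sum_i f i).
  apply: (big_ind (fun g : 'rV[R]_d -> R => continuous g)) => //.
  - exact: cst_continuous.
  - by move=> g h cg ch x; apply: continuousD; [exact: cg|exact: ch].
by apply/funext => x; rewrite fct_sumE.
Qed.

Lemma posdefmx_coercive H : posdefmx H ->
  exists2 c, 0 < c & forall x, c * `|x| ^+ 2 <= (x *m H *m x^T) 0 0.
Proof.
move=> hH.
pose q x := (x *m H *m x^T) 0 0.
have cq : continuous q.
  rewrite (_ : q = fun x => \sum_i \sum_j x 0 i * x 0 j * H i j).
    apply: continuous_sumr => i; apply: continuous_sumr => j x.
    apply: (@continuousM _ _ (fun x : 'rV[R]_d => x 0 i * x 0 j) (fun=> H i j)).
      by apply: (@continuousM _ _ (fun x : 'rV[R]_d => x 0 i) (fun x => x 0 j));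
        exact: coord_continuous.
    exact: cst_continuous.
  by apply/funext => x; exact: quadE.
pose A := [set x : 'rV[R]_d | `|x| = 1].
have cA : compact A.
  apply: bounded_closed_compact.
    by exists 1; split => [|M M1 x /= ->]; [exact: num_real | exact: ltW].
  have -> : A = (fun x => `|x|) @^-1` [set 1].
    by [].
  apply: closed_comp => [x _|]; [exact: norm_continuous | exact: closed_eq].
have unit x : x != 0 -> A (`|x|^-1 *: x).
  by move=> x0; rewrite /A /= normrZ normfV normr_id mulVf// normr_eq0.
have homo x : x != 0 -> q x = `|x| ^+ 2 * q (`|x|^-1 *: x).
  move=> x0; rewrite /q !quadE mulr_sumr; apply: eq_bigr => i _.
  rewrite mulr_sumr; apply: eq_bigr => j _; rewrite !mxE.
  by field; rewrite normr_eq0.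
(* For [d = 0] the unit sphere is empty and 0 is the only vector. *)
have [A0|A0] := pselect (A !=set0); last first.
  exists 1 => // x; have [->|x0] := eqVneq x 0.
    by rewrite normr0 expr0n /= mulr0 !mul0mx mxE.
  by case: A0; exists (`|x|^-1 *: x); exact: unit.
have [c cA' hc] : exists2 c, c \in A & forall t, t \in A -> q c <= q t.
  by apply: EVT_min_rV => //; exact: continuous_subspaceT.
have q0 : 0 < q c.
  apply: hH; rewrite inE /A /= in cA'.
  by rewrite -normr_eq0 cA' oner_eq0.
exists (q c) => // x; have [->|x0] := eqVneq x 0.
  by rewrite normr0 expr0n /= mulr0 !mul0mx mxE.
change (q c * `|x| ^+ 2 <= q x).
rewrite (homo x x0) mulrC ler_wpM2l ?sqr_ge0//.
by apply: hc; rewrite inE; exact: unit.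
Qed.

Lemma negdefmx_coercive H : negdefmx H ->
  exists2 c, 0 < c & forall x, (x *m H *m x^T) 0 0 <= - (c * `|x| ^+ 2).
Proof.
move=> /posdefmx_coercive[c c0 hc]; exists c => // x.
by have := hc x; rewrite mulmxN mulNmx mxE; lra.
Qed.

Lemma unitmx_kernel M : (forall x, x *m M = 0 -> x = 0) -> M \in unitmx.
Proof.
move=> h; rewrite -row_free_unit -kermx_eq0; apply/eqP/row_matrixP => i.
by rewrite row0; apply: h; rewrite -row_mul mulmx_ker row0.
Qed.

End DefiniteMatrices.

Lemma wide_kernel {R : realType} n m (M : 'M[R]_(n, m)) : (m < n)%N ->
  exists2 x : 'rV[R]_n, x != 0 & x *m M = 0.
Proof.
move=> mn; have : kermx M != 0.
  rewrite kermx_eq0 /row_free; apply/negP => /eqP e.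
  by have := rank_leq_col M; rewrite e leqNgt mn.
move=> h; exists (nz_row (kermx M)); first by rewrite nz_row_eq0.
by apply/sub_kermxP; exact: nz_row_sub.
Qed.

Section Index.
Context {R : realType} {E : hilbertType R}.
Implicit Types (S : set E) (x y : E).

Lemma lincomb_le n (v : 'I_n -> E) : exists2 L, 0 < L &
  forall a : 'rV[R]_n, `|lincomb v (a 0)| <= L * `|a|.
Proof.
exists (\sum_i `|v i| + 1) => [|a].
  by rewrite ltr_wpDl// sumr_ge0.
apply: le_trans (ler_norm_sum _ _ _) _.
apply: (@le_trans _ _ (\sum_i `|v i| * `|a|)).
  by apply: ler_sum => i _; rewrite normrZ mulrC ler_wpM2l// rV_entry_le.
by rewrite -mulr_suml ler_wpM2r// lerDl.
Qed.

Section Form.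
Context {B : E -> E -> R}.
Hypothesis hB : sym_bilinear B.

Lemma bil_lincombl n (v : 'I_n -> E) a y :
  B (lincomb v a) y = \sum_i a i * B (v i) y.
Proof.
by rewrite (bil_suml hB); apply: eq_bigr => i _; rewrite (bilZl hB).
Qed.

Lemma bil_lincomb n (v : 'I_n -> E) (a : 'rV[R]_n) :
  B (lincomb v (a 0)) (lincomb v (a 0)) =
  (a *m (\matrix_(i, j) B (v i) (v j)) *m a^T) 0 0.
Proof.
rewrite quadE bil_lincombl; apply: eq_bigr => i _.
rewrite (bilC hB) bil_lincombl mulr_sumr; apply: eq_bigr => j _.
by rewrite mxE (bilC hB (v j)) mulrA.
Qed.

Lemma lincomb_row n (v : 'I_n -> E) (a : 'I_n -> R) :
  lincomb v a = lincomb v ((\row_i a i) 0).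
Proof. by apply: eq_bigr => i _; rewrite mxE. Qed.

Lemma neg_lincomb_coercive n (v : 'I_n -> E) : lin_indep v ->
  (forall x, range (lincomb v) x -> x != 0 -> B x x < 0) ->
  exists2 c, 0 < c & forall a : 'rV[R]_n,
    B (lincomb v (a 0)) (lincomb v (a 0)) <= - (c * `|a| ^+ 2).
Proof.
move=> li neg; set H := \matrix_(i, j) B (v i) (v j).
have [|c c0 hc] := @negdefmx_coercive _ _ H.
  move=> a a0; rewrite mulmxN mulNmx mxE -bil_lincomb oppr_gt0.
  apply: neg; first by exists (a 0).
  apply/negP => /eqP /li h; move/eqP: a0; apply; apply/rowP => i.
  by rewrite h mxE.
by exists c => // a; rewrite bil_lincomb.
Qed.

(* If B is negative on the span of the m vectors v k and positive on the common
   kernel of m functionals, these two subspaces are complementary; comparing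
   n + p with p - n makes the mixed terms of B cancel. *)
Lemma index_split m (v : 'I_m -> E) (L : 'I_m -> E -> R) c :
  (forall k a x y, L k (a *: x + y) = a * L k x + L k y) -> 0 < c ->
  lin_indep v ->
  (forall x, range (lincomb v) x -> B x x <= - (c * `|x| ^+ 2)) ->
  (forall x, (forall k, L k x = 0) -> c * `|x| ^+ 2 <= B x x) ->
  morse_index B setT m /\
  exists2 c', 0 < c' & forall x k, 0 <= k ->
    (forall y, B x y <= k * `|y|) -> c' * `|x| <= k.
Proof.
move=> lin c0 li neg pos.
have L0 k : L k 0 = 0 by have := lin k 1 0 0; rewrite scale1r addr0; lra.
have Llin k n (w : 'I_n -> E) a : L k (lincomb w a) = \sum_i a i * L k (w i).
  rewrite (big_morph (L k) (id1 := 0) (op1 := +%R)) => [|x y|]; last exact: L0.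
    apply: eq_bigr => i _.
    by rewrite -[a i *: _]addr0 lin L0 addr0.
  by rewrite -[x in LHS]scale1r lin mul1r.
have sq0 x : c * `|x| ^+ 2 <= 0 -> x = 0.
  move=> h; apply/eqP; rewrite -normr_eq0 -sqrf_eq0 eq_le sqr_ge0 andbT.
  by rewrite pmulr_rle0 in h.
split; first split.
- exists v; split => // x vx x0; apply: le_lt_trans (neg x vx) _.
  by rewrite oppr_lt0 mulr_gt0// exprn_gt0// normr_gt0.
- move=> n [w [lw _ negw]]; rewrite leqNgt; apply/negP => mn.
  (* With more than [m] vectors, some nonzero combination is killed by all [m] functionals, so [B]
     is nonnegative on it. *)
  have [a a0 ha] := wide_kernel (\matrix_(i, k) L k (w i)) mn.
  set x := lincomb w (a 0).
  have x0 : x != 0.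
    apply/negP => /eqP /lw h; move/eqP: a0; apply; apply/rowP => i.
    by rewrite h mxE.
  have Lx k : L k x = 0.
    suff -> : L k x = (a *m (\matrix_(i, k) L k (w i))) 0 k by rewrite ha mxE.
    by rewrite /x Llin mxE; apply: eq_bigr => i _; rewrite mxE.
  have := pos x Lx; have := negw x (ex_intro2 _ _ (a 0) I erefl) x0.
  have : 0 <= c * `|x| ^+ 2 by rewrite mulr_ge0 ?sqr_ge0// ltW.
  lra.
(* Invertibility of [M] means that the span meets the common kernel only in 0; it allows splitting
   [x] into [n] in the span and [p] in the kernel. *)
pose M := \matrix_(i, k) L k (v i).
have Mu : M \in unitmx.
  apply: unitmx_kernel => a ha; set x := lincomb v (a 0).
  have Lx k : L k x = 0.
    suff -> : L k x = (a *m M) 0 k by rewrite ha mxE.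
    by rewrite /x Llin mxE; apply: eq_bigr => i _; rewrite mxE.
  have x0 : x = 0.
    apply: sq0; have := pos x Lx; have := neg x (ex_intro2 _ _ (a 0) I erefl).
    lra.
  by apply/rowP => i; rewrite (li _ x0) mxE.
(* The factor 2 is lost in passing from |n|^2 + |p|^2 to (|n| + |p|)^2. *)
exists (c / 2) => [|x k k0 hk]; first by rewrite divr_gt0.
pose a := (\row_k L k x) *m invmx M.
pose n := lincomb v (a 0); pose p := x - n.
have Lp j : L j p = 0.
  have -> : p = -1 *: n + x by rewrite scaleN1r addrC.
  rewrite lin; have -> : L j x = (a *m M) 0 j by rewrite mulmxKV// mxE.
  rewrite /n Llin mxE mulN1r addrC; apply/eqP; rewrite subr_eq0.
  by apply/eqP; apply: eq_bigr => i _; rewrite [M _ _]mxE.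
have Bp := pos p Lp; have Bn := neg n (ex_intro2 _ _ (a 0) I erefl).
have xE : x = n + p by rewrite addrC subrK.
have cancel (y z : E) : B (y + z) (z - y) = B z z - B y y.
  by rewrite (bilDl hB) !(bilBr hB) (bilC hB z y); ring.
have e : B x (p - n) = B p p - B n n by rewrite {1}xE cancel.
have tri : `|x| <= `|n| + `|p| by rewrite xE ler_normD.
set t := `|n| + `|p|.
have t0 : 0 <= t by rewrite addr_ge0.
have h1 : c / 2 * t ^+ 2 <= k * t.
  have h := hk (p - n); rewrite e in h.
  have h2 : k * `|p - n| <= k * t.
    by rewrite ler_wpM2l// /t [leRHS]addrC ler_normB.
  apply: le_trans (le_trans _ h) h2.
  have h3 : c * (`|p| ^+ 2 + `|n| ^+ 2) <= B p p - B n n by lra.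
  apply: le_trans _ h3.
  rewrite -mulrA ler_pM2l// /t; have := sqr_ge0 (`|n| - `|p|); lra.
have [t00|tn] := eqVneq t 0.
  have -> : `|x| = 0 by apply/eqP; rewrite eq_le normr_ge0 andbT -t00.
  by rewrite mulr0.
have tp : 0 < t by rewrite lt_def tn.
rewrite expr2 mulrA ler_pM2r// in h1.
by apply: le_trans h1; rewrite ler_wpM2l// divr_ge0// ltW.
Qed.

End Form.
End Index.

(** * Coercivity complementary to a maximal negative subspace *)

Section Splitting.
Context {R : realType} {E : hilbertType R}.
Variables (B : E -> E -> R) (S : set E) (m : nat).
Hypothesis hB : sym_bilinear B.
Hypothesis hS0 : S 0.
Hypothesis hS : forall a x y, S x -> S y -> S (a *: x + y).

Let SZ a x : S x -> S (a *: x).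
Proof. by move=> h; have := hS a h hS0; rewrite addr0. Qed.

Let SD x y : S x -> S y -> S (x + y).
Proof. by move=> h k; have := hS 1 h k; rewrite scale1r. Qed.

Let SB x y : S x -> S y -> S (x - y).
Proof. by move=> h k; rewrite addrC -scaleN1r; exact: hS. Qed.

Let Slin n (v : 'I_n -> E) a : (forall i, S (v i)) -> S (lincomb v a).
Proof.
move=> Sv; apply: (big_ind S) => [//|x y|i _]; [exact: SD | exact: SZ].
Qed.

(** [A] and [A'] are bare functions. Homogeneity on [S] is recovered from the representation of [B]
    and its uniqueness; the bound on [A'] then follows from its continuity at 0 within [S]. *)
Lemma nondegenerate_on_bounded_below : nondegenerate_on B S ->
  exists2 C, 0 < C & forall x k, S x -> 0 <= k ->
    (forall y, S y -> B x y <= k * `|y|) -> `|x| <= C * k.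
Proof.
move=> [A [A' [SA AB AA' cA']]].
have Sinj x y : S x -> S y -> (forall v, S v -> dot x v = dot y v) -> x = y.
  move=> Sx Sy h; apply/eqP; rewrite -subr_eq0; apply/eqP/dot_eq0.
  by rewrite (bilBl dot_sym) h ?subrr//; exact: SB.
have A0 : A 0 = 0.
  apply: Sinj => [||v Sv]; [exact: (SA 0 hS0).1 | exact: hS0 |].
  by rewrite AB// (bil0l hB) (bil0l dot_sym).
have A'0 : A' 0 = 0 by rewrite -{1}A0; exact: (AA' 0 hS0).1.
have AZ a x : S x -> A (a *: x) = a *: A x.
  move=> Sx; apply: Sinj => [||v Sv].
  - exact: (SA _ (SZ a Sx)).1.
  - by apply: SZ; exact: (SA _ Sx).1.
  - by rewrite AB//; [rewrite (bilZl hB) (bilZl dot_sym) AB | exact: SZ].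
have A'Z a x : S x -> A' (a *: x) = a *: A' x.
  move=> Sx; have SA'x := (SA _ Sx).2.
  by rewrite -{1}((AA' _ Sx).2) -AZ// (AA' _ (SZ a SA'x)).1.
have [r r0 hr] : exists2 r, 0 < r & forall y, S y -> `|y| < r -> `|A' y| <= 1.
  have /cvgrPdist_le/(_ _ ltr01) : A' @ (within S (nbhs (0 : E))) --> A' 0.
    have := cA' 0; rewrite /continuous_at /=.
    by rewrite /prop_near1 nbhs_subspace_in.
  rewrite A'0.
  move=> /near0P[r r0 hr]; exists r => // y Sy yr.
  by have := hr y yr Sy; rewrite sub0r normrN.
have bd y : S y -> `|A' y| <= 2 / r * `|y|.
  move=> Sy; have [->|y0] := eqVneq y 0; first by rewrite A'0 !normr0 mulr0.
  have n0 : 0 < `|y| by rewrite normr_gt0.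
  pose a := r / 2 / `|y|.
  have a0 : 0 < a by rewrite !divr_gt0.
  have : `|A' (a *: y)| <= 1.
    apply: hr; first exact: SZ.
    rewrite normrZ gtr0_norm// /a divfK ?gt_eqF//.
    by rewrite ltr_pdivrMr// ltr_pMr// ltr1n.
  rewrite A'Z// normrZ gtr0_norm// -ler_pdivlMl// mulr1 => /le_trans; apply.
  rewrite le_eqVlt; apply/orP; left; apply/eqP.
  by rewrite /a; field; rewrite ?gt_eqF.
exists (2 / r) => [|x k Sx k0 hk]; first by rewrite divr_gt0.
rewrite -{1}((AA' _ Sx).1); apply: le_trans (bd _ (SA _ Sx).1) _.
rewrite ler_wpM2l//; first by rewrite divr_ge0// ltW.

have [->|Ax] := eqVneq (A x) 0; first by rewrite normr0.
have := hk _ (SA _ Sx).1; rewrite -(AB x (A x) Sx (SA _ Sx).1) dot_norm.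
by rewrite expr2 ler_pM2r// normr_gt0.
Qed.

Hypotheses (hBb : bounded_form B) (hnd : nondegenerate_on B S).
Hypothesis hm : morse_index B S m.

(** On the vectors of [S] that are [B]-orthogonal to a maximal negative subspace, [B] is nonnegative
    by maximality. Cauchy-Schwarz for this semidefinite form, combined with the invertibility of [B]
    on [S], upgrades nonnegativity to coercivity. *)
Lemma form_splitting : exists (v : 'I_m -> E) (c : R),
  [/\ 0 < c, lin_indep v, forall k, S (v k),
      forall x, range (lincomb v) x -> B x x <= - (c * `|x| ^+ 2) &
      forall x, S x -> (forall k, B x (v k) = 0) -> c * `|x| ^+ 2 <= B x x].
Proof.
have [[v [li vS neg]] hmax] := hm.
have Sv k : S (v k).
  apply: vS; exists (fun i => (i == k)%:R) => //.
  rewrite /lincomb (bigD1 k)//= eqxx scale1r big1 ?addr0// => i /negbTE ->.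
  by rewrite scale0r.
have [L L0 hL] := lincomb_le v.
have [c c0 hc] := neg_lincomb_coercive hB li neg.
have [K K0 hK] := bounded_formP hBb.
have [C C0 hC] := nondegenerate_on_bounded_below hnd.
pose c1 := c / L ^+ 2.
have c10 : 0 < c1 by rewrite divr_gt0// exprn_gt0.
have neg1 x : range (lincomb v) x -> B x x <= - (c1 * `|x| ^+ 2).
  move=> [a _ <-]; rewrite lincomb_row; set b := \row_i a i.
  apply: le_trans (hc b) _; rewrite lerN2 /c1 mulrAC ler_pdivrMr ?exprn_gt0//.
  rewrite -mulrA ler_pM2l// -exprMn ler_pXn2r ?nnegrE// ?mulr_ge0//; last exact: ltW.
  by rewrite mulrC.
have orthv x a : (forall k, B x (v k) = 0) -> B x (lincomb v a) = 0.
  move=> h; rewrite (bilC hB) (bil_lincombl hB) big1// => i _.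
  by rewrite (bilC hB) h mulr0.
have pos0 x : S x -> (forall k, B x (v k) = 0) -> 0 <= B x x.
  move=> Sx hx; rewrite leNgt; apply/negP => xneg.
  (* Adjoining [x] to [v] would give a larger negative subspace, because [x] is [B]-orthogonal to
     the span of [v]. *)
  suff /hmax : negdef_dim B S m.+1 by rewrite ltnn.
  pose v' (i : 'I_m.+1) := if unlift ord_max i is Some j then v j else x.
  have v'E a : lincomb v' a =
      lincomb v (fun i => a (lift ord_max i)) + a ord_max *: x.
    rewrite /lincomb big_ord_recr /=; congr (_ + _); last first.
      by rewrite /v' unlift_none.
    apply: eq_bigr => i _; have -> : widen_ord (leqnSn m) i = lift ord_max i.
      by apply: val_inj => /=; rewrite /bump leqNgt ltn_ord.
    by rewrite /v' liftK.
  have BE a t : B (lincomb v a + t *: x) (lincomb v a + t *: x) =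
      B (lincomb v a) (lincomb v a) + t ^+ 2 * B x x.
    rewrite (bilDl hB) !(bilDr hB) !(bilZl hB) !(bilZr hB).
    by rewrite (bilC hB (lincomb v a) x) (orthv x)//; ring.
  have li' a : lincomb v' a = 0 -> forall i, a i = 0.
    rewrite v'E => h.
    have t0 : a ord_max = 0.
      have : B (lincomb v (fun i => a (lift ord_max i)) + a ord_max *: x) x = 0.
        by rewrite h (bil0l hB).
      rewrite (bilDl hB) (bilZl hB) (bilC hB _ x) (orthv x)// add0r => /eqP.
      by rewrite mulf_eq0 (lt_eqF xneg) orbF => /eqP.
    have h' : lincomb v (fun i => a (lift ord_max i)) = 0.
      by rewrite -[RHS]h t0 scale0r addr0.
    move=> i; case: (unliftP ord_max i) => [j ->|->]; last exact: t0.
    exact: (li _ h' j).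
  exists v'; split=> //.
    move=> _ [a _ <-]; rewrite v'E; apply: SD; [exact: Slin | exact: SZ].
  move=> _ [a _ <-] nz; rewrite v'E BE.
  set w := lincomb v _; set t := a ord_max.
  have Bw : B w w <= 0.
    have := neg1 w (ex_intro2 _ _ _ I erefl).
    have : 0 <= c1 * `|w| ^+ 2 by rewrite mulr_ge0 ?sqr_ge0// ltW.
    lra.
  have [t0|t0] := eqVneq t 0.
    rewrite t0 expr0n /= mul0r addr0; apply: neg; first by exists (fun i => a (lift ord_max i)).
    by move: nz; rewrite v'E -/t t0 scale0r addr0.
  have : t ^+ 2 * B x x < 0 by rewrite pmulr_rlt0// exprn_even_gt0.
  lra.
pose M := \matrix_(i, j) B (v i) (v j).
have Mu : M \in unitmx.
  apply: unitmx_kernel => a ha; have := hc a.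
  rewrite (bil_lincomb hB) -/M ha mul0mx mxE oppr_ge0 pmulr_rle0//.
  move=> h; apply/eqP; rewrite -normr_eq0 -sqrf_eq0 eq_le h sqr_ge0//.
have decomp y : exists2 n, range (lincomb v) n & forall k, B (y - n) (v k) = 0.
  pose a := (\row_k B y (v k)) *m invmx M.
  exists (lincomb v (a 0)); first by exists (a 0).
  move=> k; rewrite (bilBl hB) (bil_lincombl hB).
  have -> : B y (v k) = (a *m M) 0 k by rewrite mulmxKV// mxE.
  rewrite mxE; apply/eqP; rewrite subr_eq0; apply/eqP.
  by apply: eq_bigr => i _; rewrite [M _ _]mxE.
(* Bound for [B q q = B y y - B n n] in terms of |y|^2: [K] for the first term, and [K ^+ 2 / c1]
   for the second, since |n| is at most [K / c1] times |y|. *)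
pose D := K + K ^+ 2 / c1.
have D0 : 0 < D by rewrite addr_gt0// divr_gt0// exprn_gt0.
pose c2 := (C ^+ 2 * D)^-1.
have c20 : 0 < c2 by rewrite invr_gt0 mulr_gt0// exprn_gt0.
exists v, (Num.min c1 c2); split => //.
- by rewrite lt_min c10.
- move=> x vx; apply: le_trans (neg1 x vx) _; rewrite lerN2.
  by rewrite ler_wpM2r ?sqr_ge0// ge_min lexx.
move=> x Sx hx; apply: (@le_trans _ _ (c2 * `|x| ^+ 2)).
  by rewrite ler_wpM2r ?sqr_ge0// ge_min lexx orbT.
have Bx := pos0 x Sx hx.
rewrite /c2 mulrC ler_pdivrMr ?mulr_gt0 ?exprn_gt0//.
(* Since [B x y = B x q], Cauchy-Schwarz and the bound [D] give [B x y] at most [k] times |y|.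
   Invertibility then bounds |x| by [C * k], and squaring gives coercivity with constant [c2]. *)
set k := Num.sqrt (D * B x x).
have DB : 0 <= D * B x x by rewrite mulr_ge0// ltW.
have k0 : 0 <= k by rewrite sqrtr_ge0.
have kE : k ^+ 2 = D * B x x by rewrite sqr_sqrtr.
have : `|x| <= C * k.
  apply: hC => // y Sy.
  have [n vn hq] := decomp y; set q := y - n in hq.
  have Sn : S n by case: vn => a _ <-; exact: Slin.
  have Sq : S q by exact: SB.
  have Bnq : B q n = 0 by case: vn => a _ <-; exact: orthv.
  have Bxn : B x n = 0 by case: vn => a _ <-; exact: orthv.
  have yE : y = q + n by rewrite subrK.
  clearbody q.
  have Bny : B n y = B n n by rewrite yE (bilDr hB) (bilC hB n q) Bnq add0r.
  have Bqq : B q q = B y y - B n n.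
    by rewrite yE (bilDl hB) !(bilDr hB) (bilC hB n q) Bnq; ring.
  have nle : `|n| <= K / c1 * `|y|.
    have [->|n0] := eqVneq n 0; first by rewrite normr0 mulr_ge0// divr_ge0// ltW.
    have h := neg1 n vn; have := hK n y; rewrite Bny => h2.
    have h3 := le_trans (ler_norm (- B n n)) _; rewrite normrN in h3.
    have {h2 h3}h3 := h3 _ h2.
    have : c1 * `|n| * `|n| <= K * `|y| * `|n|.
      have : c1 * `|n| ^+ 2 = c1 * `|n| * `|n| by rewrite expr2 mulrA.
      have : K * `|n| * `|y| = K * `|y| * `|n| by rewrite mulrAC.
      lra.
    rewrite ler_pM2r ?normr_gt0// -ler_pdivlMl//.
    by move=> /le_trans; apply; rewrite mulrA [c1^-1 * _]mulrC.
  have Bqle : B q q <= D * `|y| ^+ 2.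
    have h1 : B y y <= K * `|y| * `|y| := le_trans (ler_norm _) (hK y y).
    have h2 : - B n n <= K * `|n| * `|y|.
      by rewrite -Bny; apply: le_trans (ler_norm _) _; rewrite normrN hK.
    have h3 : K * `|n| * `|y| <= K * (K / c1 * `|y|) * `|y|.
      by rewrite ler_wpM2r// ler_pM2l.
    rewrite Bqq /D mulrDl; apply: le_trans (lerD h1 (le_trans h2 h3)) _.
    by rewrite le_eqVlt; apply/orP; left; apply/eqP; field; rewrite gt_eqF.
  have cs : B x q ^+ 2 <= B x x * B q q.
    apply: semidef_cauchy_schwarz => // a b; apply: pos0.
      by apply: SD; exact: SZ.
    by move=> i; rewrite (bilDl hB) !(bilZl hB) hx hq !mulr0 addr0.
  have e : B x y = B x q by rewrite yE (bilDr hB) Bxn addr0.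
  rewrite e; apply: le_trans (ler_norm _) _.
  rewrite -(@ler_pXn2r _ 2%N)// ?nnegrE ?mulr_ge0//.
  rewrite real_normK ?num_real// exprMn kE.
  apply: le_trans cs _; rewrite mulrAC [leRHS]mulrC ler_wpM2l//.
move=> h; have : `|x| ^+ 2 <= (C * k) ^+ 2.
  by rewrite ler_pXn2r// ?nnegrE ?mulr_ge0// ltW.
by rewrite exprMn kE mulrA [leRHS]mulrC.
Qed.

End Splitting.

Lemma nondegenerate_of_bounded_below {R : realType} {E : hilbertType R}
    (B : E -> E -> R) (c : R) :
  sym_bilinear B -> bounded_form B -> 0 < c ->
  (forall x k, 0 <= k -> (forall y, B x y <= k * `|y|) -> c * `|x| <= k) ->
  nondegenerate_on B setT.
Proof.
move=> hB /bounded_formP[K K0 hK] c0 hc.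
pose A x := riesz (B x).
have AE x y : dot (A x) y = B x y.
  apply: (@riesz_exists _ _ _ (K * `|x|)) => [a u v|v]; last exact: hK.
  by rewrite (bilDr hB) (bilZr hB).
have [|||x|A' [AA' cA']] := @bounded_below_bijective _ _ A K c _ _ _ c0.
- move=> a x y; apply: dot_inj => v.
  by rewrite (bilDl dot_sym) (bilZl dot_sym) !AE hB.2.
- move=> x; apply: norm_le_dot => [|y]; first by rewrite mulr_ge0// ltW.
  by rewrite AE (le_trans (ler_norm _)).
- by move=> x y; rewrite AE dotC AE (bilC hB).
- apply: hc => // y; rewrite -AE.
  exact: le_trans (ler_norm _) (dot_le _ _).
exists A, A'; split=> //.
by apply: continuous_subspaceT.
Qed.

(** * The reduction near the critical manifold *)

Ltac positivity := repeat first
  [ assumption | by apply: ltW; assumption | exact: normr_ge0 | exact: sqr_ge0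
  | exact: ler0n | exact: ltr01 | exact: ler01 | by rewrite ltr0n
  | by rewrite exprn_gt0 | apply: addr_gt0 | apply: mulr_gt0 | apply: addr_ge0
  | apply: mulr_ge0 ].

Section Filters.
Context {R : realType}.

(** Explicit form of the filter [filter_prod 0^'+ (nbhs x)], with one radius for both variables. *)
Definition near0 {V : normedModType R} (x : V) (P : R -> V -> Prop) : Prop :=
  exists2 r, 0 < r &
    forall eps y, 0 < eps -> eps < r -> `|y - x| < r -> P eps y.

Lemma near_right_prodP {V : normedModType R} (x : V) (P : R -> V -> Prop) :
  (\forall q \near filter_prod 0^'+ (nbhs x), P q.1 q.2) <-> near0 x P.
Proof.
split=> [[[/= A C] [hA hC] h]|[r r0 h]].
  have /nbhs_distP[r1 r10 h1] : \forall eps \near (0 : R), 0 < eps -> A eps by [].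
  have /nbhs_distP[r2 r20 h2] := hC.
  exists (Num.min r1 r2) => [|eps y]; first by rewrite lt_min r10.
  rewrite !lt_min => e0 /andP[er _] /andP[_ yr]; apply: (h (eps, y)); split => /=.
    by apply: h1 => //; rewrite subr0 gtr0_norm.
  exact: h2.
exists ([set eps : R | 0 < eps < r], [set y | `|y - x| < r]) => /=.
  split; last by apply/nbhs_distP; exists r.
  have : \forall eps \near (0 : R), 0 < eps -> 0 < eps < r.
    apply/nbhs_distP; exists r => // y; rewrite subr0 /= => yr y0.
    by rewrite y0 (le_lt_trans (ler_norm _)).
  exact.
by move=> [eps y] /= [/andP[e0 er] yr]; exact: h.
Qed.

Lemma near0_and {V : normedModType R} (x : V) P Q :
  near0 x P -> near0 x Q -> near0 x (fun eps y => P eps y /\ Q eps y).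
Proof.
move=> [r r0 hP] [s s0 hQ]; exists (Num.min r s) => [|eps y e0].
  by rewrite lt_min r0.
by rewrite !lt_min => /andP[er es] /andP[yr ys]; split; [exact: hP|exact: hQ].
Qed.

Lemma near0_imp {V : normedModType R} (x : V) (P Q : R -> V -> Prop) :
  (forall eps y, 0 < eps -> P eps y -> Q eps y) -> near0 x P -> near0 x Q.
Proof. by move=> h [r r0 hP]; exists r => // eps y e0 er yr; exact/h/hP. Qed.

Lemma near0_ball {V : normedModType R} (x : V) (r : R) : 0 < r ->
  near0 x (fun eps y => eps < r /\ `|y - x| < r).
Proof. by move=> r0; exists r. Qed.

Lemma near0_nbhs {V : normedModType R} (x : V) (P : V -> Prop) :
  (\forall y \near x, P y) -> near0 x (fun _ y => P y).
Proof. by move=> /nbhs_distP[r r0 h]; exists r => // eps y _ _; exact: h. Qed.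

Lemma near0_forall_ord {V : normedModType R} n (x : V)
    (P : 'I_n -> R -> V -> Prop) :
  (forall i, near0 x (P i)) -> near0 x (fun eps y => forall i, P i eps y).
Proof.
elim: n P => [|n IH] P h; first by exists 1 => // eps y _ _ _ [].
have h1 := near0_and (h ord0) (IH _ (fun i => h (lift ord0 i))).
apply: near0_imp h1 => eps y _ [h0 h1] i.
by case: (unliftP ord0 i) => [j ->|->].
Qed.

Lemma near0_powR {V : normedModType R} (x : V) (b eta : R) : 0 < b -> 0 < eta ->
  near0 x (fun eps _ => eps `^ b <= eta).
Proof.
move=> b0 eta0; exists (eta `^ b^-1); first by rewrite powR_gt0.
move=> eps y e0 er _.
have -> : eta = (eta `^ b^-1) `^ b by rewrite -powRrM mulVf ?gt_eqF// powRr1// ltW.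
by rewrite ge0_ler_powR ?nnegrE ?powR_ge0// ltW.
Qed.

Lemma near_forall_ord {V : normedModType R} n (x : V) (P : 'I_n -> V -> Prop) :
  (forall i, \forall y \near x, P i y) -> \forall y \near x, forall i, P i y.
Proof. exact: filter_forall. Qed.

End Filters.

(* The facts on f_eps near the critical manifold that the proof uses: g and B
   are the gradient and the Hessian form of f_eps, e i and e2 i j the first and
   second partial derivatives of z, and T t the third derivative of F at z t. *)
Record expansion {R : realType} {E : hilbertType R} {d : nat}
    (z : 'rV[R]_d -> E) (e : 'I_d -> 'rV[R]_d -> E)
    (e2 : 'I_d -> 'I_d -> 'rV[R]_d -> E)
    (g : R -> E -> E) (B : R -> E -> E -> E -> R)
    (T : 'rV[R]_d -> E -> E -> E -> R) (H : 'M[R]_d)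
    (al c : R) (theta : 'rV[R]_d) : Prop := Expansion {
  ex_sym : forall eps u, sym_bilinear (B eps u) ;
  ex_bounded : forall eps u, bounded_form (B eps u) ;
  ex_B_near : forall eta, 0 < eta -> exists2 r, 0 < r & forall eps u,
    `|eps| < r -> `|u - z theta| < r -> forall x y,
    `|B eps u x y - B 0 (z theta) x y| <= eta * `|x| * `|y| ;
  ex_g_near : forall eta, 0 < eta -> exists2 r, 0 < r & forall eps u u',
    `|eps| < r -> `|u - z theta| < r -> `|u' - z theta| < r -> forall y,
    `|dot (g eps u' - g eps u) y - B 0 (z theta) (u' - u) y|
      <= eta * `|u' - u| * `|y| ;
  ex_B_incr : forall eta, 0 < eta -> exists2 r, 0 < r & forall eps u u',
    `|eps| < r -> `|u - z theta| < r -> `|u' - z theta| < r -> forall x y,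
    `|B eps u' x y - B eps u x y + T theta x y (u' - u)|
      <= eta * `|u' - u| * `|x| * `|y| ;
  ex_g_diff : forall eps u eta, 0 < eta -> \forall h \near (0 : E), forall y,
    `|dot (g eps (u + h) - g eps u) y - B eps u h y| <= eta * `|h| * `|y| ;
  ex_g_cts : forall eps0 u0 eta, 0 < eta -> exists2 r, 0 < r & forall eps u,
    `|eps - eps0| < r -> `|u - u0| < r -> `|g eps u - g eps0 u0| < eta ;
  ex_z_diff : forall t eta, 0 < eta -> \forall h \near (0 : 'rV[R]_d),
    `|z (t + h) - z t - \sum_k h 0 k *: e k t| <= eta * `|h| ;
  ex_e_diff : forall i t eta, 0 < eta -> \forall h \near (0 : 'rV[R]_d),
    `|e i (t + h) - e i t - \sum_k h 0 k *: e2 k i t| <= eta * `|h| ;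
  ex_c_gt0 : 0 < c ;
  ex_e_norm : forall i t, `|e i t| = c ;
  ex_e_orth : forall i j t, i != j -> dot (e i t) (e j t) = 0 ;
  ex_e2_orth : forall i j l t, dot (e2 i j t) (e l t) = 0 ;
  ex_e2_bounded : exists M, forall i j,
    \forall t \near theta, `|e2 i j t| <= M ;
  ex_T_bounded : exists K, forall x y v,
    `|T theta x y v| <= K * `|x| * `|y| * `|v| ;
  ex_T_near : forall eta, 0 < eta -> \forall t \near theta, forall x y v,
    `|T t x y v - T theta x y v| <= eta * `|x| * `|y| * `|v| ;
  ex_critical : forall t, g 0 (z t) = 0 ;
  ex_kernel : forall i t y, B 0 (z t) (e i t) y = 0 ;
  ex_T : forall i j t y, B 0 (z t) (e2 i j t) y = T t (e i t) (e j t) y ;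
  ex_al_gt0 : 0 < al ;
  ex_g_O : exists K, near0 theta (fun eps t => `|g eps (z t)| <= K * eps `^ al) ;
  ex_B_o : forall i eta, 0 < eta -> near0 theta (fun eps t => forall y,
    `|B eps (z t) (e i t) y| <= eta * eps `^ (al / 2) * `|y|) ;
  ex_H : forall i j eta, 0 < eta -> near0 theta (fun eps t =>
    `|dot (g eps (z t)) (e2 i j t) + B eps (z t) (e i t) (e j t) -
      eps `^ al * H i j| <= eta * eps `^ al) }.

Lemma sum_le_const {R : realType} d (f : 'I_d -> R) K :
  (forall k, f k <= K) -> \sum_k f k <= d%:R * K.
Proof.
move=> h; apply: le_trans (ler_sum _ (fun k _ => h k)) _.
by rewrite sumr_const card_ord mulr_natl.
Qed.

Section Frame.
Context {R : realType} {E : hilbertType R} {d : nat}.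
Variables (e : 'I_d -> E) (c : R).
Hypotheses (c_gt0 : 0 < c) (e_norm : forall i, `|e i| = c).
Hypothesis e_orth : forall i j, i != j -> dot (e i) (e j) = 0.

Lemma dot_frame a i : dot (lincomb e a) (e i) = c ^+ 2 * a i.
Proof.
rewrite (bil_lincombl dot_sym) (bigD1 i)//= big1 => [|j ji]; last first.
  by rewrite e_orth ?mulr0.
by rewrite addr0 dot_norm e_norm mulrC.
Qed.

Lemma frame_coord_le a i : c * `|a i| <= `|lincomb e a|.
Proof.
have := dot_le (lincomb e a) (e i).
rewrite dot_frame e_norm => h; rewrite -(ler_pM2r c_gt0).
apply: le_trans h; rewrite normrM ger0_norm ?sqr_ge0// le_eqVlt.
by apply/orP; left; apply/eqP; ring.
Qed.

Lemma frame_projection x :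
  exists s, (forall k, dot s (e k) = 0) /\
    x = s + lincomb e (fun k => dot x (e k) / c ^+ 2).
Proof.
exists (x - lincomb e (fun k => dot x (e k) / c ^+ 2)); split; last by rewrite subrK.
move=> k; rewrite (bilBl dot_sym) dot_frame mulrC divfK ?subrr//.
by rewrite sqrf_eq0 gt_eqF.
Qed.

End Frame.

Section LocalReduction.
Context {R : realType} {E : hilbertType R} {d : nat}.
Variables (z : 'rV[R]_d -> E) (e : 'I_d -> 'rV[R]_d -> E)
  (e2 : 'I_d -> 'I_d -> 'rV[R]_d -> E)
  (g : R -> E -> E) (B : R -> E -> E -> E -> R)
  (T : 'rV[R]_d -> E -> E -> E -> R) (H : 'M[R]_d)
  (al c : R) (theta : 'rV[R]_d).
Hypothesis hex : expansion z e e2 g B T H al c theta.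

(** The auxiliary equation in frame coordinates, without the smallness that singles out [w]; the
    trivial solution 0 at [eps = 0] is an instance and serves as a term of comparison. *)
Definition solves (eps : R) (t : 'rV[R]_d) (v : E) : Prop :=
  (forall k, dot v (e k t) = 0) /\
  (exists a, g eps (z t + v) = lincomb (e^~ t) a).

Variable C : R.
Hypothesis C_gt0 : 0 < C.
Hypothesis hC : forall x (k : R), (forall i, dot x (e i theta) = 0) -> 0 <= k ->
  (forall y, (forall i, dot y (e i theta) = 0) ->
    B 0 (z theta) x y <= k * `|y|) -> `|x| <= C * k.

Lemma z_continuous t (eps : R) : 0 < eps ->
  exists2 r, 0 < r & forall y, `|y - t| < r -> `|z y - z t| < eps.
Proof.
move=> eps0; have c0 := ex_c_gt0 hex.
have /near0P[r r0 hr] := ex_z_diff hex t ltr01.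
pose M := 1 + d%:R * c.
have M0 : 0 < M by rewrite ltr_pwDl// mulr_ge0// ltW.
exists (Num.min r (eps / M)) => [|y].
  by rewrite lt_min r0 divr_gt0.
rewrite lt_min ltr_pdivlMr// => /andP[yr ye].
have := hr (y - t) yr; rewrite [t + _]addrC subrK.
set h := y - t => hz; apply: le_lt_trans ye.
have -> : z y - z t = (z y - z t - \sum_k h 0 k *: e k t) + \sum_k h 0 k *: e k t.
  by rewrite subrK.
apply: le_trans (ler_normD _ _) _; rewrite mulrDr mulr1 lerD//.
  by move: hz; rewrite mul1r.
apply: le_trans (ler_norm_sum _ _ _) _.
rewrite mulrCA; apply: sum_le_const => k; rewrite normrZ (ex_e_norm hex) ler_wpM2r ?rV_entry_le//.
exact: ltW.
Qed.

Lemma e_locally_lipschitz i t : exists L, \forall h \near (0 : 'rV[R]_d),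
  `|e i (t + h) - e i t| <= L * `|h|.
Proof.
exists (1 + \sum_k `|e2 k i t|).
apply: filterS (ex_e_diff hex i t ltr01) => h hz.
have -> : e i (t + h) - e i t =
  (e i (t + h) - e i t - \sum_k h 0 k *: e2 k i t) + \sum_k h 0 k *: e2 k i t.
  by rewrite subrK.
apply: le_trans (ler_normD _ _) _; rewrite mulrDl lerD//.
apply: le_trans (ler_norm_sum _ _ _) _; rewrite mulr_suml.
apply: ler_sum => k _; rewrite normrZ mulrC ler_wpM2l ?rV_entry_le//.
Qed.

Lemma e_continuous i t (eps : R) : 0 < eps ->
  exists2 r, 0 < r & forall y, `|y - t| < r -> `|e i y - e i t| < eps.
Proof.
move=> eps0; have [L /near0P[r r0 hr]] := e_locally_lipschitz i t.
exists (Num.min r (eps / (`|L| + 1))) => [|y].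
  by rewrite lt_min r0 divr_gt0// ltr_wpDl.
rewrite lt_min ltr_pdivlMr ?ltr_wpDl// => /andP[yr ye].
have := hr (y - t) yr; rewrite [t + _]addrC subrK => /le_lt_trans; apply.
apply: le_lt_trans ye; rewrite mulrC ler_wpM2l//.
by rewrite (le_trans (ler_norm _))// lerDl.
Qed.

Lemma e_near_theta (eta : R) : 0 < eta ->
  \forall t \near theta, forall i, `|e i t - e i theta| <= eta.
Proof.
move=> eta0; apply: near_forall_ord => i.
have [r r0 h] := e_continuous i theta eta0.
by apply/nbhs_distP; exists r => // y /h /ltW.
Qed.

(* The tangential part of x is controlled by its frame coordinates and the rest
   by B, whose kernel contains the frame. *)
Lemma coercive_mod_frame : exists2 C', 0 < C' & forall x (m k : R),
  0 <= m -> 0 <= k -> (forall i, `|dot x (e i theta)| <= m) ->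
  (forall y, (forall i, dot y (e i theta) = 0) ->
    B 0 (z theta) x y <= k * `|y|) -> `|x| <= C' * (m + k).
Proof.
have c0 := ex_c_gt0 hex.
have D0 : 0 <= d%:R / c :> R by rewrite divr_ge0// ltW.
exists (C + d%:R / c) => [|x m k m0 k0 hm hk]; first by rewrite ltr_pwDl.
have [s [hs xE]] := frame_projection c0 (fun i => ex_e_norm hex i theta)
  (fun i j => ex_e_orth hex theta (i:=i) (j:=j)) x.
have Bs y : B 0 (z theta) x y = B 0 (z theta) s y.
  rewrite {1}xE (bilDl (ex_sym hex _ _)) (bil_lincombl (ex_sym hex _ _)).
  by rewrite big1 ?addr0// => i _; rewrite (ex_kernel hex) mulr0.
have sle : `|s| <= C * k.
  by apply: (hC hs k0) => y Sy; rewrite -Bs; exact: hk.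
rewrite xE; apply: le_trans (ler_normD _ _) _.
have h : `|lincomb (e^~ theta) (fun i => dot x (e i theta) / c ^+ 2)| <= d%:R / c * m.
  apply: le_trans (ler_norm_sum _ _ _) _.
  rewrite -mulrA; apply: sum_le_const => i.
  rewrite normrZ (ex_e_norm hex) normrM normfV (ger0_norm (sqr_ge0 c)).
  have -> : c^-1 * m = m / c ^+ 2 * c by field; rewrite gt_eqF.
  by rewrite ler_pM2r// ler_pM2r ?invr_gt0 ?exprn_gt0.
have h1 : 0 <= C * m by rewrite mulr_ge0// ltW.
have h2 : 0 <= d%:R / c * k by rewrite mulr_ge0.
by rewrite mulrDl !mulrDr; lra.
Qed.

End LocalReduction.

(** * Comparison of two solutions of the auxiliary equation *)

Section ReductionEstimates.
Context {R : realType} {E : hilbertType R} {d : nat}.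
Variables (z : 'rV[R]_d -> E) (e : 'I_d -> 'rV[R]_d -> E)
  (e2 : 'I_d -> 'I_d -> 'rV[R]_d -> E)
  (g : R -> E -> E) (B : R -> E -> E -> E -> R)
  (T : 'rV[R]_d -> E -> E -> E -> R) (H : 'M[R]_d)
  (al c : R) (theta : 'rV[R]_d).
Hypothesis hex : expansion z e e2 g B T H al c theta.

Variable C : R.
Hypothesis C_gt0 : 0 < C.
Hypothesis hC : forall x (m k : R),
  0 <= m -> 0 <= k -> (forall i, `|dot x (e i theta)| <= m) ->
  (forall y, (forall i, dot y (e i theta) = 0) ->
    B 0 (z theta) x y <= k * `|y|) -> `|x| <= C * (m + k).

Let D := d%:R / c.
Let c_gt0 : 0 < c := ex_c_gt0 hex.
Let D_ge0 : 0 <= D. Proof. by rewrite divr_ge0// ltW. Qed.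

Let lincomb_coord_le t a i : `|a i| <= c^-1 * `|lincomb (e^~ t) a|.
Proof.
rewrite ler_pdivlMl//.
apply: (frame_coord_le c_gt0) => [k|k l]; first exact: ex_e_norm hex k t.
exact: (ex_e_orth hex).
Qed.

(* The difference is close to a vector of the span at t1, which is almost
   orthogonal to the complement of the span at theta. *)
Lemma frame_diff_orth t0 t1 a b eta delta s :
  (forall i, `|e i t1 - e i theta| <= eta) ->
  (forall i, `|e i t1 - e i t0| <= delta) ->
  (forall i, dot s (e i theta) = 0) ->
  `|dot (lincomb (e^~ t1) a - lincomb (e^~ t0) b) s| <=
    (D * eta * (`|lincomb (e^~ t1) a - lincomb (e^~ t0) b| +
       D * delta * `|lincomb (e^~ t0) b|) +
     D * delta * `|lincomb (e^~ t0) b|) * `|s|.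
Proof.
move=> heta hdelta hs.
set g1 := lincomb (e^~ t1) a; set g0 := lincomb (e^~ t0) b.
pose g2 := lincomb (e^~ t1) b.
have h2 : `|g2 - g0| <= D * delta * `|g0|.
  have -> : g2 - g0 = \sum_i b i *: (e i t1 - e i t0).
    by rewrite /g2 /g0 /lincomb -sumrB; apply: eq_bigr => i _; rewrite scalerBr.
  apply: le_trans (ler_norm_sum _ _ _) _.
  rewrite /D -!mulrA; apply: sum_le_const => i; rewrite normrZ.
  have -> : c^-1 * (delta * `|g0|) = c^-1 * `|g0| * delta by ring.
  by rewrite ler_pM//; exact: lincomb_coord_le.
have h1 : `|dot (g1 - g2) s| <= D * eta * `|g1 - g2| * `|s|.
  have gE : g1 - g2 = lincomb (e^~ t1) (fun i => a i - b i).
    by rewrite /g1 /g2 /lincomb -sumrB; apply: eq_bigr => i _; rewrite scalerBl.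
  rewrite {1}gE (bil_lincombl dot_sym); apply: le_trans (ler_norm_sum _ _ _) _.
  rewrite /D -!mulrA; apply: sum_le_const => i; rewrite normrM.
  have k1 : `|dot (e i t1) s| <= eta * `|s|.
    have -> : dot (e i t1) s = dot (e i t1 - e i theta) s.
      by rewrite (bilBl dot_sym) (dotC (e i theta)) hs subr0.
    by apply: le_trans (dot_le _ _) _; rewrite ler_wpM2r.
  have k2 : `|a i - b i| <= c^-1 * `|g1 - g2|.
    by rewrite gE; exact: (lincomb_coord_le t1 (fun i => a i - b i)).
  have -> : c^-1 * (eta * (`|g1 - g2| * `|s|)) = c^-1 * `|g1 - g2| * (eta * `|s|).
    by ring.
  by rewrite ler_pM.
have h3 : `|g1 - g2| <= `|g1 - g0| + D * delta * `|g0|.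
  have -> : g1 - g2 = (g1 - g0) - (g2 - g0) by rewrite opprB addrA subrK.
  by apply: le_trans (ler_normB _ _) _; rewrite lerD2l.
have e01 : g1 - g0 = (g1 - g2) + (g2 - g0) by rewrite addrA subrK.
rewrite {1}e01 (bilDl dot_sym); apply: le_trans (ler_normD _ _) _.
rewrite mulrDl lerD//.
  apply: le_trans h1 _; rewrite ler_wpM2r//.
  (* The sign of [eta] can be read only from a frame vector; without any, the factor [D] is 0. *)
  have [d0|d0] := posnP d.
    by rewrite /D; move: h3 => _; rewrite (_ : d%:R = 0) ?d0// !mul0r.
  have eta0 : 0 <= eta := le_trans (normr_ge0 _) (heta (Ordinal d0)).
  by rewrite ler_wpM2l// mulr_ge0.
by apply: le_trans (dot_le _ _) _; rewrite ler_wpM2r.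
Qed.

(** The difference [W] is almost normal at [theta], and against a normal [y] the form B0 at [W] is
    nearly the pairing with the difference of the two gradients, minus that with the change at fixed
    [w0]. Both gradients are tangential, hence almost orthogonal to [y]. Every term in |W| carries a
    factor [eta] and is absorbed. The estimate is used three times: for the order of [w], for its
    increments in [t], and for its continuity. *)
Lemma reduction_lipschitz : exists2 K, 0 < K & exists2 r, 0 < r &
  forall ep0 ep1 t0 t1 w0 w1 (delta : R),
  `|ep0| < r -> `|ep1| < r -> `|t0 - theta| < r -> `|t1 - theta| < r ->
  `|w0| < r -> `|w1| < r ->
  solves z e g ep0 t0 w0 -> solves z e g ep1 t1 w1 -> 0 <= delta ->
  (forall i, `|e i t1 - e i t0| <= delta) ->
  `|w1 - w0| <= K * (`|g ep1 (z t1 + w0) - g ep0 (z t0 + w0)| +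
     (`|w0| + `|g ep0 (z t0 + w0)|) * delta).
Proof.
have [K0 K00 hK0] := bounded_formP (ex_bounded hex 0 (z theta)).
(* [L] collects the coefficients of [eta] times |W|: one from the frame coordinates, one from
   [gnear], and [D * (K0 + 1)] from [frame_diff_orth]. With [C * L * eta <= 1 / 2] half of |W|
   survives on the left, whence the factor 2 in [K]. *)
pose L := 2 + D * (K0 + 1).
have L0 : 0 < L by rewrite ltr_wpDr// mulr_ge0// ltW// ltr_wpDl// ltW.
pose eta := Num.min 1 (1 / (2 * (C * L))).
have CL0 : 0 < C * L by rewrite mulr_gt0.
have eta0 : 0 < eta by rewrite lt_min ltr01 divr_gt0// mulr_gt0.
have eta1 : eta <= 1 by rewrite ge_min lexx.
have etaCL : C * L * eta <= 1 / 2.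
  have : eta <= 1 / (2 * (C * L)) by rewrite ge_min lexx orbT.
  rewrite -(ler_pM2l CL0) => /le_trans; apply; rewrite le_eqVlt.
  by apply/orP; left; apply/eqP; field; rewrite !gt_eqF.
have [r1 r10 hr1] := ex_g_near hex eta0.
have /nbhs_distP[r2 r20 hr2] := e_near_theta hex eta0.
have r12 : 0 < r1 / 2 by rewrite divr_gt0.
have [r3 r30 hr3] := z_continuous hex theta r12.
exists (2 * (C * (1 + D + D ^+ 2))).
  by rewrite !mulr_gt0// ltr_wpDr ?sqr_ge0// ltr_wpDr.
exists (Num.min (Num.min (r1 / 2) r2) r3) => [|ep0 ep1 t0 t1 w0 w1 delta].
  by rewrite !lt_min r12 r20.
rewrite !lt_min => /andP[/andP[h01 _] _] /andP[/andP[h02 _] _] /andP[/andP[_ h04] h05].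
move=> /andP[/andP[_ h06] h07] /andP[/andP[h08 _] _] /andP[/andP[h09 _] _].
move=> [w0orth [b gb]] [w1orth [a ga]] delta0 hdelta.
have zp t : `|t - theta| < r3 -> forall w, `|w| < r1 / 2 -> `|z t + w - z theta| < r1.
  move=> ht w hw; rewrite addrAC; apply: le_lt_trans (ler_normD _ _) _.
  by rewrite [r1]splitr ltrD// hr3.
set W := w1 - w0.
set Y := g ep1 (z t1 + w0) - g ep0 (z t0 + w0).
set g1 := g ep1 (z t1 + w1) in ga; set g0 := g ep0 (z t0 + w0) in gb *.
set g' := g ep1 (z t1 + w0).
have gnear y : `|dot (g1 - g') y - B 0 (z theta) W y| <= eta * `|W| * `|y|.
  have -> : W = (z t1 + w1) - (z t1 + w0) by rewrite opprD addrACA subrr add0r.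
  apply: hr1; [|exact: zp..].
  by apply: lt_le_trans h02 _; rewrite ler_pdivrMr// ler_pMr// ler1n.
have g10 : `|g1 - g0| <= (K0 + 1) * `|W| + `|Y|.
  have -> : g1 - g0 = (g1 - g') + Y by rewrite addrA subrK.
  apply: le_trans (ler_normD _ _) _; rewrite lerD2r.
  apply: norm_le_dot => [|y]; first by rewrite mulr_ge0// addr_ge0// ltW.
  have := gnear y; have := hK0 W y; rewrite !ler_norml => /andP[_ k1] /andP[_ k2].
  have k3 : eta * `|W| * `|y| <= `|W| * `|y| by rewrite -mulrA ler_piMl// mulr_ge0.
  rewrite mulrDl mul1r mulrDl; lra.
have m0 : 0 <= eta * `|W| + `|w0| * delta.
  by rewrite addr_ge0 ?mulr_ge0// ltW.
have hm i : `|dot W (e i theta)| <= eta * `|W| + `|w0| * delta.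
  (* [w1] is orthogonal to the frame at [t1] and [w0] to the frame at [t0], so only differences of
     frame vectors remain. *)
  have -> : dot W (e i theta) = - dot W (e i t1 - e i theta) - dot w0 (e i t1 - e i t0).
    have Wt : dot W (e i t1) = - dot w0 (e i t1).
      by rewrite (bilBl dot_sym) w1orth sub0r.
    by rewrite !(bilBr dot_sym) w0orth Wt; ring.
  apply: le_trans (ler_normB _ _) _; rewrite normrN lerD//.
    by apply: le_trans (dot_le _ _) _; rewrite mulrC ler_wpM2r// hr2.
  by apply: le_trans (dot_le _ _) _; rewrite ler_wpM2l.
set G0 := `|g0|.
pose k := eta * `|W| + `|Y| + (D * eta * ((K0 + 1) * `|W| + `|Y| + D * delta * G0) + D * delta * G0).
have G00 : 0 <= G0 by exact: normr_ge0.
have K10 : 0 <= K0 + 1 by rewrite addr_ge0// ltW.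
have k0 : 0 <= k.
  rewrite /k; repeat first [exact: D_ge0 | exact: G00 | exact: K10 |
    exact: normr_ge0 | exact: ltW | assumption | apply: addr_ge0 | apply: mulr_ge0].
have hW : `|W| <= C * (eta * `|W| + `|w0| * delta + k).
  apply: hC => //.
  move=> y hy.
  have := frame_diff_orth a b (hr2 _ h06) hdelta hy; rewrite -ga -gb -/G0 => k1.
  have := gnear y; rewrite ler_norml => /andP[k2 _].
  have k3 : dot (g1 - g') y = dot (g1 - g0) y - dot Y y.
    by rewrite -(bilBl dot_sym) /Y opprB addrA subrK.
  have := dot_le Y y; rewrite ler_norml => /andP[k4 _].
  move: k1; rewrite ler_norml => /andP[_ k1].
  have k5 : D * eta * (`|g1 - g0| + D * delta * G0) <=
    D * eta * ((K0 + 1) * `|W| + `|Y| + D * delta * G0).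
    by rewrite ler_wpM2l ?lerD2r// mulr_ge0// ltW.
  have k6 : (D * eta * (`|g1 - g0| + D * delta * G0) + D * delta * G0) * `|y| <=
    (D * eta * ((K0 + 1) * `|W| + `|Y| + D * delta * G0) + D * delta * G0) * `|y|.
    by rewrite ler_wpM2r// lerD2r.
  rewrite k3 in k2; rewrite /k mulrDl (mulrDl (eta * _)).
  move: k1 k2 k4 k6; move: (dot (g1 - g0) y) (dot Y y) (B _ _ _ _) => p q s.
  set A1 := (_ + _) * `|y|; set A2 := (_ + _) * `|y|.
  set A3 := eta * _ * _; set A4 := `|Y| * _; lra.
set X := `|Y| + (`|w0| + G0) * delta.
have X1 : `|Y| * (1 + D * eta) + `|w0| * delta + G0 * delta * (D ^+ 2 * eta + D)
    <= (1 + D + D ^+ 2) * X.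
  have D0 : 0 <= D := D_ge0.
  have De : D * eta <= D by rewrite ler_piMr.
  have D2e : D ^+ 2 * eta <= D ^+ 2 by rewrite ler_piMr// sqr_ge0.
  have q1 : `|Y| * (1 + D * eta) <= `|Y| * (1 + D + D ^+ 2).
    by rewrite ler_wpM2l//; have := sqr_ge0 D; lra.
  have q2 : `|w0| * delta * 1 <= `|w0| * delta * (1 + D + D ^+ 2).
    have wd : 0 <= `|w0| * delta by exact: mulr_ge0.
    by rewrite (ler_wpM2l wd)//; have := sqr_ge0 D; lra.
  have q3 : G0 * delta * (D ^+ 2 * eta + D) <= G0 * delta * (1 + D + D ^+ 2).
    have Gd : 0 <= G0 * delta by exact: mulr_ge0.
    by rewrite (ler_wpM2l Gd)//; lra.
  by rewrite /X; lra.
have X2 : C * (eta * `|W| + `|w0| * delta + k) <=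
    C * L * eta * `|W| + C * ((1 + D + D ^+ 2) * X).
  have -> : eta * `|W| + `|w0| * delta + k = L * eta * `|W| +
      (`|Y| * (1 + D * eta) + `|w0| * delta + G0 * delta * (D ^+ 2 * eta + D)).
    by rewrite /k /L; ring.
  by rewrite mulrDr lerD ?ler_pM2l// !mulrA.
have X3 : C * L * eta * `|W| <= 1 / 2 * `|W| by rewrite ler_wpM2r.
rewrite -/X -!mulrA; move: (le_trans hW X2) X3.
set P := C * (_ * X); set Q := C * L * eta * `|W|; lra.
Qed.

End ReductionEstimates.

(** * Size of w and the rescaled Hessian *)

Section ReducedHessian.
Context {R : realType} {E : hilbertType R} {d : nat}.
Variables (z : 'rV[R]_d -> E) (e : 'I_d -> 'rV[R]_d -> E)
  (e2 : 'I_d -> 'I_d -> 'rV[R]_d -> E)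
  (g : R -> E -> E) (B : R -> E -> E -> E -> R)
  (T : 'rV[R]_d -> E -> E -> E -> R) (H : 'M[R]_d)
  (al c : R) (theta : 'rV[R]_d).
Hypothesis hex : expansion z e e2 g B T H al c theta.

Variable C : R.
Hypothesis C_gt0 : 0 < C.
Hypothesis hC : forall x (m k : R),
  0 <= m -> 0 <= k -> (forall i, `|dot x (e i theta)| <= m) ->
  (forall y, (forall i, dot y (e i theta) = 0) ->
    B 0 (z theta) x y <= k * `|y|) -> `|x| <= C * (m + k).

Variable w : R -> 'rV[R]_d -> E.
Hypothesis w_solves : near0 theta (fun eps t => solves z e g eps t (w eps t)).
Hypothesis w_small : forall eta : R, 0 < eta ->
  near0 theta (fun eps t => `|w eps t| <= eta).

Let c_gt0 : 0 < c := ex_c_gt0 hex.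
Let al_gt0 : 0 < al := ex_al_gt0 hex.

Lemma near0_balls (r : R) : 0 < r -> near0 theta (fun eps t =>
  [/\ `|eps| < r, `|z t - z theta| < r, `|z t + w eps t - z theta| < r &
      `|t - theta| < r /\ `|w eps t| < r]).
Proof.
move=> r0; have r2 : 0 < r / 2 by rewrite divr_gt0.
have r4 : 0 < r / 4 by rewrite divr_gt0.
have [s s0 hs] := z_continuous hex theta r2.
have h := near0_and (w_small r4) (near0_and (near0_ball theta s0) (near0_ball theta r0)).
apply: near0_imp h => eps t e0 [h1 [[_ h2] [h3 h4]]].
have h5 := hs _ h2; split; [| |rewrite addrAC|split=> //].
- by rewrite gtr0_norm.
- lra.
- by apply: le_lt_trans (ler_normD _ _) _; lra.
- lra.
Qed.

(** Compares [w eps t] with the solution 0 at [eps = 0] and the same [t]: the frames coincide, and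
    the gradients at [w0 = 0] differ by [g eps (z t)], which is O(eps^al). *)
Lemma w_order : exists2 K, 0 < K & near0 theta (fun eps t =>
  `|w eps t| <= K * eps `^ al /\ `|g eps (z t + w eps t)| <= K * eps `^ al).
Proof.
have [K K0 [r r0 hK]] := reduction_lipschitz hex C_gt0 hC.
have [Kg hg] := ex_g_O hex.
have [K1 K10 hB] := bounded_formP (ex_bounded hex 0 (z theta)).
have [s s0 hs] := ex_g_near hex ltr01.
have q0 : 0 < Num.min r s by rewrite lt_min r0.
pose M := `|Kg| + 1.
have M0 : 0 < M by rewrite ltr_wpDl.
have P0 : 0 < K * M + ((K1 + 1) * (K * M) + M).
  by positivity.
exists (K * M + ((K1 + 1) * (K * M) + M)) => //.
have h := near0_and hg (near0_and w_solves (near0_balls q0)).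
apply: near0_imp h => eps t e0 [h1 [h2 [h3 h4 h5 [h6 h7]]]].
rewrite !lt_min in h3 h4 h5 h6 h7.
case/andP: h3 => h3 h3'; case/andP: h4 => h4 h4'; case/andP: h5 => h5 h5'.
case/andP: h6 => h6 _; case/andP: h7 => h7 _.
set p := eps `^ al in h1 *; have p0 : 0 < p by rewrite powR_gt0.
have g1 : `|g eps (z t)| <= M * p.
  apply: le_trans h1 _; rewrite ler_pM2r//.
  by rewrite (le_trans (ler_norm _))// lerDl.
have S0 : solves z e g 0 t 0.
  split=> [k|]; first by rewrite (bil0l dot_sym).
  exists (fun=> 0); rewrite addr0 (ex_critical hex) /lincomb big1// => i _.
  by rewrite scale0r.
have wle : `|w eps t| <= K * M * p.
  have := @hK 0 eps t t 0 (w eps t) 0.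
  rewrite !normr0 !subr0 addr0 (ex_critical hex) subr0 mulr0 addr0.
  move=> /(_ r0 h3 h6 h6 r0 h7 S0 h2 (lexx 0)) h.
  apply: le_trans (h _) _; first by move=> i; rewrite subrr normr0.
  by rewrite -mulrA ler_pM2l.
have KMp : 0 < K * M * p by rewrite !mulr_gt0.
have gle : `|g eps (z t + w eps t)| <= (K1 + 1) * (K * M * p) + M * p.
  have -> : g eps (z t + w eps t) = (g eps (z t + w eps t) - g eps (z t)) + g eps (z t).
    by rewrite subrK.
  apply: le_trans (ler_normD _ _) _; rewrite lerD//.
  apply: (@le_trans _ _ ((K1 + 1) * `|w eps t|)); last first.
    by rewrite ler_pM2l// addr_gt0.
  apply: norm_le_dot => [|y]; first by rewrite mulr_ge0// addr_ge0// ltW.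
  have := hs eps _ _ h3' h4' h5' y; rewrite [z t + _ - z t]addrAC subrr add0r.
  have := hB (w eps t) y; rewrite !ler_norml => /andP[_ k1] /andP[_ k2].
  have k3 : (K1 + 1) * `|w eps t| * `|y| =
    K1 * `|w eps t| * `|y| + 1 * `|w eps t| * `|y| by ring.
  lra.
have -> : (K * M + ((K1 + 1) * (K * M) + M)) * p =
  K * M * p + ((K1 + 1) * (K * M * p) + M * p) by ring.
have t1 : 0 < (K1 + 1) * (K * M * p) by positivity.
have t2 : 0 < M * p by rewrite mulr_gt0.
split; first by apply: le_trans wle _; rewrite lerDl ltW// addr_gt0.
by apply: le_trans gle _; rewrite lerDr ltW.
Qed.

Let powR_half eps : 0 < eps -> eps `^ al = eps `^ (al / 2) * eps `^ (al / 2).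
Proof.
move=> e0; rewrite -powRD; last by rewrite (gt_eqF e0) implybT.
by congr (_ `^ _); field.
Qed.

(** Moving from [z] to [z + w] changes the Hessian by a multiple of |w|, which is O(eps^al) and
    hence o(eps^(al/2)). *)
Lemma hessian_frame_o i (eta : R) : 0 < eta -> near0 theta (fun eps t =>
  forall y, `|B eps (z t + w eps t) (e i t) y| <= eta * eps `^ (al / 2) * `|y|).
Proof.
move=> eta0; have eta2 : 0 < eta / 2 by rewrite divr_gt0.
have [K K0 hK] := w_order.
have [KT hT] := ex_T_bounded hex.
have [s s0 hs] := ex_B_incr hex ltr01.
pose M := (`|KT| + 1) * K * c.
have M0 : 0 < M by rewrite !mulr_gt0// ltr_wpDl.
have b0 : 0 < al / 2 by rewrite divr_gt0.
have h := near0_and hK (near0_and (ex_B_o hex i eta2) (near0_and (near0_balls s0)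
  (near0_powR theta b0 (divr_gt0 eta2 M0)))).
apply: near0_imp h => eps t e0 [[h1 _] [h2 [[h3 h4 h5 _] h6]]] y.
have k1 := h2 y; have k2 := hs _ _ _ h3 h4 h5 (e i t) y.
rewrite [z t + _ - z t]addrAC subrr add0r in k2.
have k3 := hT (e i t) y (w eps t).
rewrite (ex_e_norm hex) in k2 k3.
rewrite (powR_half e0) in h1.
set p := eps `^ (al / 2) in h1 h6 k1 *; have p0 : 0 < p by rewrite powR_gt0.
have k4 : `|w eps t| * (`|KT| + 1) * c <= eta / 2 * p.
  apply: (@le_trans _ _ (K * (p * p) * (`|KT| + 1) * c)).
    by rewrite ler_pM2r// ler_pM2r// ltr_wpDl.
  have -> : K * (p * p) * (`|KT| + 1) * c = M * p * p by rewrite /M; ring.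
  by rewrite ler_pM2r// mulrC -ler_pdivlMr.
have k5 : `|w eps t| * (`|KT| + 1) * c * `|y| <= eta / 2 * p * `|y|.
  by rewrite ler_wpM2r.
have k6 : KT * c * `|y| * `|w eps t| <= `|KT| * c * `|y| * `|w eps t|.
  by rewrite !ler_wpM2r ?ler_norm// ltW.
have arith (a b q m1 m2 m3 : R) : `|b| <= m1 -> `|a - b + q| <= m2 -> `|q| <= m3 ->
    `|a| <= m1 + m2 + m3.
  move=> l1 l2 l3; rewrite (_ : a = b + (a - b + q) - q); last by ring.
  by rewrite (le_trans (ler_normB _ _))// lerD// (le_trans (ler_normD _ _))// lerD.
apply: le_trans (arith _ _ _ _ _ _ k1 k2 k3) _.
rewrite mul1r; nra.
Qed.

(** The correction through [T] is of the order of the limit itself. By [ex_T] it is B0 at [e2 i j t]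
    and [w], hence nearly the increment of [dot g (e2 i j t)]. That pairing vanishes at [z + w], so
    what remains is its value at [z], and the sum with the Hessian at [z] is the quantity in
    [ex_H]. *)
Lemma hessian_frame_frame (eta : R) : 0 < eta -> near0 theta (fun eps t =>
  forall i j, `|B eps (z t + w eps t) (e i t) (e j t) - eps `^ al * H i j|
    <= eta * eps `^ al).
Proof.
move=> eta0; apply: near0_forall_ord => i; apply: near0_forall_ord => j.
have eta2 : 0 < eta / 2 by rewrite divr_gt0.
have [K K0 hK] := w_order.
have [M0 hM0] := ex_e2_bounded hex.
pose M := `|M0| + 1.
have Mpos : 0 < M by rewrite ltr_wpDl.
(* Four replacements cost [nu] times |w| each, two with the factor [c ^+ 2] and two with [M]; with
   |w| at most [K * p] they total [eta / 2 * p]. *)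
pose Q := 2 * (2 * c ^+ 2 + 2 * M) * K.
have Q0 : 0 < Q by positivity.
pose nu := eta / Q.
have nu0 : 0 < nu by rewrite divr_gt0.
have [r1 r10 hr1] := ex_B_incr hex nu0.
have [r2 r20 hr2] := ex_B_near hex nu0.
have [r3 r30 hr3] := ex_g_near hex nu0.
have rr0 : 0 < Num.min r1 (Num.min r2 r3) by rewrite !lt_min r10 r20.
have h := near0_and hK (near0_and (ex_H hex i j eta2) (near0_and (near0_balls rr0)
  (near0_and w_solves (near0_and (near0_nbhs (ex_T_near hex nu0))
  (near0_nbhs (hM0 i j)))))).
apply: near0_imp h => eps t e0 [[h1 _] [h2 [[h3 h4 h5 _] [[_ [a ga]] [h7 h8]]]]].
rewrite !lt_min in h3 h4 h5.
case/and3P: h3 => h31 h32 h33; case/and3P: h4 => h41 h42 h43.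
case/and3P: h5 => h51 h52 h53.
set W := w eps t in h1 h51 h52 h53 ga *.
set p := eps `^ al in h1 h2 *; have p0 : 0 < p by rewrite powR_gt0.
have WE : z t + W - z t = W by rewrite addrAC subrr add0r.
have e2M : `|e2 i j t| <= M by rewrite (le_trans h8)// (le_trans (ler_norm _))// lerDl.
have nz : `|(0 : R)| < r2 by rewrite normr0.
have k1 := hr1 _ _ _ h31 h41 h51 (e i t) (e j t).
have k2 := h7 (e i t) (e j t) W.
have k3 := hr2 0 (z t) nz h42 (e2 i j t) W.
have k4 := hr3 _ _ _ h33 h43 h53 (e2 i j t).
have ge2 : dot (g eps (z t + W)) (e2 i j t) = 0.
  rewrite ga (bil_lincombl dot_sym) big1// => l _.
  by rewrite dotC (ex_e2_orth hex) mulr0.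
rewrite WE !(ex_e_norm hex) in k1; rewrite !(ex_e_norm hex) in k2.
rewrite -(ex_T hex) in k2.
rewrite WE (bilBl dot_sym) ge2 (bilC (ex_sym hex 0 (z theta)) W) in k4.
move: k1 k2 k3 k4 h2.
move: (B eps (z t + W) (e i t) (e j t)) (B eps (z t) (e i t) (e j t)) (T theta _ _ _)
  (B 0 (z t) _ _) (B 0 (z theta) _ _) (dot (g eps (z t)) _) => b1 b2 b3 b4 b5 b6.
rewrite !ler_norml => /andP[k1 k1'] /andP[k2 k2'] /andP[k3 k3'] /andP[k4 k4'] /andP[h2 h2'].
have l1 : nu * `|W| * c * c = nu * `|W| * c ^+ 2 by ring.
have l2 : nu * c * c * `|W| = nu * `|W| * c ^+ 2 by ring.
have l3 : nu * `|e2 i j t| * `|W| <= nu * `|W| * M.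
  by rewrite mulrAC ler_wpM2l//; positivity.
have l4 : nu * `|W| * `|e2 i j t| <= nu * `|W| * M by rewrite ler_wpM2l//; positivity.
have l5 : nu * `|W| * c ^+ 2 + nu * `|W| * c ^+ 2 + nu * `|W| * M + nu * `|W| * M
    <= eta / 2 * p.
  have -> : nu * `|W| * c ^+ 2 + nu * `|W| * c ^+ 2 + nu * `|W| * M + nu * `|W| * M
    = nu * (2 * c ^+ 2 + 2 * M) * `|W| by ring.
  have -> : eta / 2 * p = nu * (2 * c ^+ 2 + 2 * M) * (K * p).
    have K1 : K != 0 by rewrite gt_eqF.
    have K2 : 2 * c ^+ 2 + 2 * M != 0.
      by rewrite gt_eqF//; positivity.
    by rewrite /nu /Q; field; rewrite K1 K2.
  by rewrite ler_wpM2l//; positivity.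
rewrite l1 in k1 k1'; rewrite l2 in k2 k2'.
apply/andP; split; lra.
Qed.

(* The form of D^2 f_eps(u) in coordinates adapted to T_z Z, rescaled by
   eps^(-alpha/2), and its complement. *)
Lemma hessian_block (eta : R) : 0 < eta -> near0 theta (fun eps t =>
  forall (b : 'rV[R]_d) s,
  `|B eps (z t + w eps t)
      (eps `^ (- (al / 2)) *: lincomb (e^~ t) (b 0) + s)
      (eps `^ (- (al / 2)) *: lincomb (e^~ t) (b 0) + s)
    - ((b *m H *m b^T) 0 0 + B 0 (z theta) s s)|
  <= eta * (`|b| ^+ 2 + `|s| ^+ 2)).
Proof.
move=> eta0; pose n : R := d%:R.
have n0 : 0 <= n by exact: ler0n.
(* The errors are counted as [n ^+ 2] for the tangential entries, [n] for the mixed ones, where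
   2|b||s| is at most |b|^2 + |s|^2, and 1 for the normal block. *)
pose nu := eta / (n ^+ 2 + n + 1).
have n1 : 0 < n ^+ 2 + n + 1 by rewrite ltr_wpDl// addr_ge0// sqr_ge0.
have nu0 : 0 < nu by rewrite divr_gt0.
have [r r0 hr] := ex_B_near hex nu0.
have h := near0_and (near0_forall_ord (fun i => hessian_frame_o i nu0))
  (near0_and (hessian_frame_frame nu0) (near0_balls r0)).
apply: near0_imp h => eps t e0 [h1 [h2 [h3 _ h4 _]]] b s.
have hB := ex_sym hex eps (z t + w eps t).
have hh := powR_half e0.
have k3 := hr _ _ h3 h4 s s.
rewrite powRN; set q := eps `^ (al / 2) in h1 hh *.
have q0 : 0 < q by rewrite powR_gt0.
set V := z t + w eps t in h1 h2 hB k3 *.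
set x := lincomb (e^~ t) (b 0).
have bb := rV_entry_le b.
have k1 : `|B eps V x s| <= n * (nu * q * `|b| * `|s|).
  rewrite (bil_lincombl hB); apply: le_trans (ler_norm_sum _ _ _) _.
  apply: sum_le_const => i; rewrite normrM.
  have -> : nu * q * `|b| * `|s| = `|b| * (nu * q * `|s|) by ring.
  by rewrite ler_pM.
have k2 : `|B eps V x x - q ^+ 2 * (b *m H *m b^T) 0 0| <=
    n * (n * (`|b| ^+ 2 * (nu * q ^+ 2))).
  have -> : B eps V x x - q ^+ 2 * (b *m H *m b^T) 0 0 =
    \sum_i \sum_j b 0 i * b 0 j * (B eps V (e i t) (e j t) - q ^+ 2 * H i j).
    rewrite quadE mulr_sumr (bil_lincombl hB) -sumrB; apply: eq_bigr => i _.
    rewrite (bilC hB) (bil_lincombl hB) !mulr_sumr -sumrB; apply: eq_bigr => j _.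
    by rewrite (bilC hB (e j t)); ring.
  apply: le_trans (ler_norm_sum _ _ _) _; apply: sum_le_const => i.
  apply: le_trans (ler_norm_sum _ _ _) _; apply: sum_le_const => j.
  rewrite !normrM expr2 ler_pM ?mulr_ge0// ?ler_pM//.
  by have := h2 i j; rewrite hh -expr2.
have -> : B eps V (q^-1 *: x + s) (q^-1 *: x + s) =
    q^-2 * B eps V x x + 2 * q^-1 * B eps V x s + B eps V s s.
  rewrite (bilDl hB) !(bilDr hB) !(bilZl hB) !(bilZr hB) (bilC hB s x); field.
  by rewrite gt_eqF.
move: k1 k2 k3.
move: (B eps V x x) (B eps V x s) (B eps V s s) (B 0 _ s s) ((b *m H *m b^T) 0 0)
  => b1 b2 b3 b4 b5 k1 k2 k3.
have m1 : `|q^-2 * b1 - b5| <= n ^+ 2 * nu * `|b| ^+ 2.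
  have -> : q^-2 * b1 - b5 = q^-2 * (b1 - q ^+ 2 * b5) by field; rewrite gt_eqF.
  rewrite normrM ger0_norm ?invr_ge0 ?sqr_ge0// ler_pdivrMl ?exprn_gt0//.
  by apply: le_trans k2 _; rewrite le_eqVlt; apply/orP; left; apply/eqP; ring.
have m2 : `|2 * q^-1 * b2| <= n * nu * (2 * `|b| * `|s|).
  have qi : 0 <= q^-1 by rewrite invr_ge0 ltW.
  rewrite -mulrA mulrCA normrM (ger0_norm qi) ler_pdivrMl//.
  rewrite normrM ger0_norm//.
  have : 2 * `|b2| <= 2 * (n * (nu * q * `|b| * `|s|)) by rewrite ler_pM2l.
  move=> /le_trans; apply; rewrite le_eqVlt; apply/orP; left; apply/eqP; ring.
have m2' : n * nu * (2 * `|b| * `|s|) <= n * nu * (`|b| ^+ 2 + `|s| ^+ 2).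
  rewrite ler_wpM2l//; first by positivity.
  by have := sqr_ge0 (`|b| - `|s|); lra.
have m3 : `|b3 - b4| <= nu * `|s| ^+ 2 by rewrite expr2 mulrA.
have m4 : eta * (`|b| ^+ 2 + `|s| ^+ 2) =
  n ^+ 2 * nu * (`|b| ^+ 2 + `|s| ^+ 2) + n * nu * (`|b| ^+ 2 + `|s| ^+ 2) +
  nu * (`|b| ^+ 2 + `|s| ^+ 2).
  by rewrite /nu; field; rewrite gt_eqF.
have m5 : n ^+ 2 * nu * `|b| ^+ 2 <= n ^+ 2 * nu * (`|b| ^+ 2 + `|s| ^+ 2).
  by rewrite ler_wpM2l ?lerDl ?sqr_ge0//; positivity.
have m6 : nu * `|s| ^+ 2 <= nu * (`|b| ^+ 2 + `|s| ^+ 2).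
  by rewrite ler_pM2l// lerDr sqr_ge0.
have -> : q^-2 * b1 + 2 * q^-1 * b2 + b3 - (b5 + b4) =
  (q^-2 * b1 - b5) + 2 * q^-1 * b2 + (b3 - b4) by ring.
apply: le_trans (ler_normD _ _) _; apply: le_trans (lerD (ler_normD _ _) m3) _.
rewrite m4; apply: lerD m6; apply: lerD (le_trans m1 m5) (le_trans m2 m2').
Qed.

End ReducedHessian.

(** * Index and invertibility of the Hessian *)

Section ReducedIndex.
Context {R : realType} {E : hilbertType R} {d : nat}.
Variables (z : 'rV[R]_d -> E) (e : 'I_d -> 'rV[R]_d -> E)
  (e2 : 'I_d -> 'I_d -> 'rV[R]_d -> E)
  (g : R -> E -> E) (B : R -> E -> E -> E -> R)
  (T : 'rV[R]_d -> E -> E -> E -> R) (H : 'M[R]_d)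
  (al c : R) (theta : 'rV[R]_d).
Hypothesis hex : expansion z e e2 g B T H al c theta.

Let S : set E := [set x | forall i, dot x (e i theta) = 0].
Variables (m : nat) (v : 'I_m -> E) (c0 : R).
Hypotheses (c0_gt0 : 0 < c0) (v_indep : lin_indep v) (v_S : forall k, S (v k)).
Hypothesis v_neg : forall x, range (lincomb v) x ->
  B 0 (z theta) x x <= - (c0 * `|x| ^+ 2).
Hypothesis v_pos : forall x, S x -> (forall k, B 0 (z theta) x (v k) = 0) ->
  c0 * `|x| ^+ 2 <= B 0 (z theta) x x.

Variable w : R -> 'rV[R]_d -> E.
Hypothesis block : forall eta : R, 0 < eta -> near0 theta (fun eps t =>
  forall (b : 'rV[R]_d) s,
  `|B eps (z t + w eps t)
      (eps `^ (- (al / 2)) *: lincomb (e^~ t) (b 0) + s)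
      (eps `^ (- (al / 2)) *: lincomb (e^~ t) (b 0) + s)
    - ((b *m H *m b^T) 0 0 + B 0 (z theta) s s)|
  <= eta * (`|b| ^+ 2 + `|s| ^+ 2)).

Let c_gt0 : 0 < c := ex_c_gt0 hex.

(** A vector normal at [t] differs from its normal part at [theta] by a tangential vector, which
    lies in the kernel of B0. The form is therefore unchanged, while the norm drops at most by the
    factor 2; hence [c0 / 4]. *)
Lemma normal_coercive : near0 theta (fun _ t => forall s,
  (forall i, dot s (e i t) = 0) -> (forall k, B 0 (z theta) s (v k) = 0) ->
  c0 / 4 * `|s| ^+ 2 <= B 0 (z theta) s s).
Proof.
pose n : R := d%:R.
have n0 : 0 <= n by exact: ler0n.
(* Makes the tangential part at [theta] at most half of [s]. *)
pose eta := c / (2 * (n + 1)).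
have eta0 : 0 < eta by rewrite divr_gt0// mulr_gt0// ltr_wpDl.
apply: near0_imp (near0_nbhs (e_near_theta hex eta0)) => _ t _ ht s hs hv.
have hB := ex_sym hex 0 (z theta).
have [s' [hs' sE]] := frame_projection c_gt0 (fun i => ex_e_norm hex i theta)
  (fun i j => ex_e_orth hex theta (i:=i) (j:=j)) s.
set p := lincomb _ _ in sE.
have Bp y : B 0 (z theta) p y = 0.
  by rewrite (bil_lincombl hB) big1// => i _; rewrite (ex_kernel hex) mulr0.
have Bs y : B 0 (z theta) s y = B 0 (z theta) s' y.
  by rewrite sE (bilDl hB) Bp addr0.
have ple : `|p| <= 2^-1 * `|s|.
  have h : `|p| <= n * (c^-1 * (eta * `|s|)).
    apply: le_trans (ler_norm_sum _ _ _) _; apply: sum_le_const => i.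
    rewrite normrZ (ex_e_norm hex) normrM normfV (ger0_norm (sqr_ge0 c)).
    have -> : c^-1 * (eta * `|s|) = eta * `|s| / c ^+ 2 * c.
      by field; rewrite gt_eqF.
    rewrite ler_pM2r// ler_pM2r ?invr_gt0 ?exprn_gt0//.
    have -> : dot s (e i theta) = dot s (e i theta - e i t).
      by rewrite (bilBr dot_sym) hs subr0.
    by apply: le_trans (dot_le _ _) _; rewrite mulrC ler_wpM2r// distrC.
  apply: le_trans h _; rewrite mulrA mulrA ler_wpM2r//.
  have -> : n * c^-1 * eta = n / (2 * (n + 1)).
    by rewrite /eta; field; rewrite !gt_eqF// ltr_wpDl.
  by rewrite ler_pdivrMr; [lra | rewrite mulr_gt0// ltr_wpDl].
have sle : `|s| <= 2 * `|s'|.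
  have : `|s| <= `|s'| + `|p| by rewrite {1}sE ler_normD.
  lra.
have pos : c0 * `|s'| ^+ 2 <= B 0 (z theta) s' s'.
  by apply: v_pos => // k; rewrite -Bs.
have -> : B 0 (z theta) s s = B 0 (z theta) s' s' by rewrite Bs (bilC hB) Bs.
apply: le_trans pos; rewrite -mulrA ler_pM2l//.
have : `|s| ^+ 2 <= (2 * `|s'|) ^+ 2.
  by rewrite ler_pXn2r// ?nnegrE// mulr_ge0.
by rewrite exprMn; lra.
Qed.

Lemma frame_lincomb_le t (b : 'rV[R]_d) :
  `|lincomb (e^~ t) (b 0)| <= d%:R * (c * `|b|).
Proof.
apply: le_trans (ler_norm_sum _ _ _) _; apply: sum_le_const => i.
by rewrite normrZ (ex_e_norm hex) mulrC ler_pM2l// rV_entry_le.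
Qed.

(** Bounds the squared norm of a vector by its rescaled coordinates. For [q = eps^(-al/2)] it grows
    as eps tends to 0, which is harmless: index and invertibility are asked at each [eps]
    separately. *)
Let kappa (q : R) := 2 * (q * (d%:R * c)) ^+ 2 + 2.

Let kappa_gt0 q : 0 < kappa q.
Proof. by rewrite /kappa ltr_wpDl// mulr_ge0// sqr_ge0. Qed.

Let block_norm t q (b : 'rV[R]_d) s : 0 <= q ->
  `|q *: lincomb (e^~ t) (b 0) + s| ^+ 2 <= kappa q * (`|b| ^+ 2 + `|s| ^+ 2).
Proof.
move=> q0; set x := _ + s; set y := q * (d%:R * c).
have y0 : 0 <= y by rewrite /y; positivity.
have h : `|x| <= y * `|b| + `|s|.
  apply: le_trans (ler_normD _ _) _; rewrite lerD2r normrZ ger0_norm//.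
  by rewrite /y -mulrA ler_wpM2l// -mulrA frame_lincomb_le.
have h2 : `|x| ^+ 2 <= (y * `|b| + `|s|) ^+ 2.
  by rewrite ler_pXn2r// ?nnegrE//; positivity.
apply: le_trans h2 _; rewrite /kappa -/y.
have k1 := sqr_ge0 (y * `|b| - `|s|).
have k2 : 0 <= y ^+ 2 * `|s| ^+ 2 by rewrite mulr_ge0 ?sqr_ge0.
have k3 := sqr_ge0 `|b|.
have -> : (2 * y ^+ 2 + 2) * (`|b| ^+ 2 + `|s| ^+ 2) =
  (y * `|b| + `|s|) ^+ 2 + (y * `|b| - `|s|) ^+ 2 + 2 * (y ^+ 2 * `|s| ^+ 2) + 2 * `|b| ^+ 2.
  by ring.
lra.
Qed.

Let proj_block t q x : 0 < q -> exists (b : 'rV[R]_d) s,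
  [/\ x = q *: lincomb (e^~ t) (b 0) + s, forall i, dot s (e i t) = 0 &
   s = x - lincomb (e^~ t) (fun i => dot x (e i t) / c ^+ 2)].
Proof.
move=> q0; have [s [hs xE]] := frame_projection c_gt0 (fun i => ex_e_norm hex i t)
  (fun i j => ex_e_orth hex t (i:=i) (j:=j)) x.
exists (\row_i (q^-1 * (dot x (e i t) / c ^+ 2))), s; split => //.
  rewrite {1}xE addrC; congr (_ + _).
  rewrite /lincomb scaler_sumr; apply: eq_bigr => i _.
  by rewrite mxE scalerA mulrA divff ?mul1r// gt_eqF.
by apply: (canRL (addrK _)); exact: esym xE.
Qed.

(** [index_split] with the negative vectors [v] of B0. The functionals [L] see only the part of [x]
    normal at [t], so their common kernel contains all tangential directions, where [H] supplies
    positivity. *)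
Lemma reduced_index_pos : posdefmx H -> near0 theta (fun eps t =>
  morse_index (B eps (z t + w eps t)) setT m /\
  nondegenerate_on (B eps (z t + w eps t)) setT).
Proof.
move=> /posdefmx_coercive[cH cH0 hH].
(* Half of the smaller of the tangential and normal coercivity constants, so that the block error
   leaves at least [eta] on either summand. *)
pose eta := Num.min cH (c0 / 4) / 2.
have c4 : 0 < c0 / 4 by rewrite divr_gt0.
have min0 : 0 < Num.min cH (c0 / 4) by rewrite lt_min cH0.
have eta0 : 0 < eta by rewrite divr_gt0.
have eta1 : 2 * eta <= cH by rewrite /eta mulrC divfK// ge_min lexx.
have eta2 : 2 * eta <= c0 / 4 by rewrite /eta mulrC divfK// ge_min lexx orbT.
apply: near0_imp (near0_and (block eta0) normal_coercive) => eps t ep0 [hb hn].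
set V := z t + w eps t in hb *.
set q := eps `^ _ in hb; have q0 : 0 < q by rewrite powR_gt0.
have hB := ex_sym hex eps V.
have hB0 := ex_sym hex 0 (z theta).
(* This is B0 of the normal part of [x] with [v k]. The subtraction is necessary because B0 vanishes
   on the frame at [theta], which differs from the frame at [t]. *)
pose L k x := B 0 (z theta) x (v k) -
  \sum_i dot x (e i t) / c ^+ 2 * B 0 (z theta) (e i t) (v k).
pose c' := eta / kappa q.
have c'0 : 0 < c' by rewrite divr_gt0.
have [|y [a _ <-]|x hx|ind [c2 c20 low]] := @index_split _ _ _ hB m v L c' _ c'0 v_indep.
- move=> k a x y; rewrite /L (bilDl hB0) (bilZl hB0) mulrBr mulr_sumr.
  rewrite -[_ + _ - _]addrA.
  rewrite -!addrA; congr (_ + _).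
  rewrite [RHS]addrCA; congr (_ + _); rewrite -opprD; congr (- _).
  rewrite -big_split; apply: eq_bigr => i _ /=.
  by rewrite (bilDl dot_sym) (bilZl dot_sym); ring.
(* The block estimate accepts any [s], so it applies to the [v k], which are normal at [theta] but
   perhaps not at [t]. *)
- have := hb 0 (lincomb v a).
  have -> : lincomb (e^~ t) ((0 : 'rV[R]_d) 0) = 0.
    by rewrite /lincomb big1// => i _; rewrite mxE scale0r.
  rewrite scaler0 add0r !mul0mx mxE normr0 expr0n /= !add0r.
  have := v_neg (ex_intro2 _ _ a I erefl).
  set x := lincomb v a => h1; rewrite ler_norml => /andP[_ h2].
  have x0 := sqr_ge0 `|x|.
  have h3 : c' * `|x| ^+ 2 <= eta * `|x| ^+ 2.
    rewrite ler_wpM2r// /c' ler_pdivrMr// ler_peMr ?ltW//.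
    rewrite /kappa ltr_wpDl ?ltr1n//; positivity.
  have h4 : 2 * eta * `|x| ^+ 2 <= c0 / 4 * `|x| ^+ 2 by rewrite ler_wpM2r.
  have h5 : 0 <= c0 * `|x| ^+ 2 by rewrite mulr_ge0// ltW.
  lra.
- have [b [s [xE hs sE]]] := proj_block t x q0.
  have hv k : B 0 (z theta) s (v k) = 0.
    rewrite sE (bilBl hB0) (bil_lincombl hB0); exact: hx.
  have := hb b s; rewrite -xE ler_norml => /andP[h1 _].
  have h2 := hn s hs hv; have h3 := hH b.
  have h4 := block_norm t b s (ltW q0); rewrite -xE in h4.
  have b0 := sqr_ge0 `|b|; have s0 := sqr_ge0 `|s|.
  have h5 : 2 * eta * `|b| ^+ 2 <= cH * `|b| ^+ 2 by rewrite ler_wpM2r.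
  have h6 : 2 * eta * `|s| ^+ 2 <= c0 / 4 * `|s| ^+ 2 by rewrite ler_wpM2r.
  have h7 : c' * `|x| ^+ 2 <= eta * (`|b| ^+ 2 + `|s| ^+ 2).
    by rewrite /c' mulrAC ler_pdivrMr// -[leRHS]mulrA ler_pM2l// [leRHS]mulrC.
  lra.
split=> //.
exact: (nondegenerate_of_bounded_below hB (ex_bounded hex _ _) c20 low).
Qed.

(** Here the frame at [t] joins [v] as negative directions and its coordinates join the functionals,
    whose common kernel is thereby normal at [t]. *)
Lemma reduced_index_neg : negdefmx H -> near0 theta (fun eps t =>
  morse_index (B eps (z t + w eps t)) setT (m + d) /\
  nondegenerate_on (B eps (z t + w eps t)) setT).
Proof.
move=> /negdefmx_coercive[cH cH0 hH].
pose eta := Num.min cH (c0 / 4) / 2.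
have c4 : 0 < c0 / 4 by rewrite divr_gt0.
have min0 : 0 < Num.min cH (c0 / 4) by rewrite lt_min cH0.
have eta0 : 0 < eta by rewrite divr_gt0.
have eta1 : 2 * eta <= cH by rewrite /eta mulrC divfK// ge_min lexx.
have eta2 : 2 * eta <= c0 / 4 by rewrite /eta mulrC divfK// ge_min lexx orbT.
apply: near0_imp (near0_and (block eta0) normal_coercive) => eps t ep0 [hb hn].
set V := z t + w eps t in hb *.
set q := eps `^ _ in hb; have q0 : 0 < q by rewrite powR_gt0.
have hB := ex_sym hex eps V.
have hB0 := ex_sym hex 0 (z theta).
pose L (k : 'I_(m + d)) (x : E) : R := match fintype.split k with
  | inl k => B 0 (z theta) x (v k) | inr i => dot x (e i t) end.
pose v' (k : 'I_(m + d)) : E := match fintype.split k with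
  | inl k => v k | inr i => e i t end.
pose c' := eta / kappa q.
have c'0 : 0 < c' by rewrite divr_gt0.
have v'E a : exists (b : 'rV[R]_d) (s : E), [/\
    lincomb v' a = q *: lincomb (e^~ t) (b 0) + s,
    s = lincomb v (fun k => a (lshift d k)) &
    forall i, a (rshift m i) = q * b 0 i].
  exists (\row_i (q^-1 * a (rshift m i))), (lincomb v (fun k => a (lshift d k))).
  split=> // [|i]; last by rewrite mxE mulrA divff ?mul1r// gt_eqF.
  rewrite /lincomb big_split_ord addrC /=; congr (_ + _).
    by apply: eq_bigr => i _; rewrite /v' (unsplitK (inl i)).
  rewrite scaler_sumr; apply: eq_bigr => i _.
  by rewrite mxE scalerA mulrA divff ?gt_eqF// mul1r /v' (unsplitK (inr i)).
have neg (b : 'rV[R]_d) (s : E) : range (lincomb v) s ->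
    B eps V (q *: lincomb (e^~ t) (b 0) + s) (q *: lincomb (e^~ t) (b 0) + s)
      <= - (eta * (`|b| ^+ 2 + `|s| ^+ 2)).
  move=> /v_neg h1; have := hb b s; rewrite ler_norml => /andP[_ h2].
  have h3 := hH b; have b0 := sqr_ge0 `|b|; have s0 := sqr_ge0 `|s|.
  have h5 : 2 * eta * `|b| ^+ 2 <= cH * `|b| ^+ 2 by rewrite ler_wpM2r.
  have h6 : 2 * eta * `|s| ^+ 2 <= c0 / 4 * `|s| ^+ 2 by rewrite ler_wpM2r.
  have h7 : 0 <= c0 * `|s| ^+ 2 by rewrite mulr_ge0// ltW.
  lra.
(* The negative bound in the coordinates [b] and [s] forces both to vanish when the combination is
   0; independence of [v] then finishes. *)
have indep : lin_indep v'.
  move=> a; have [b [s [-> sE ab]]] := v'E a => x0.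
  have := neg b s; rewrite x0 (bil0l hB) oppr_ge0 pmulr_rle0//.
  have h : range (lincomb v) s by rewrite sE; exists (fun k => a (lshift d k)).
  move=> /(_ h) h0.
  have b0 := sqr_ge0 `|b|; have s0 := sqr_ge0 `|s|.
  have {h0}[hb0 hs0] : `|b| ^+ 2 = 0 /\ `|s| ^+ 2 = 0 by split; lra.
  have bz : b = 0 by apply/eqP; rewrite -normr_eq0 -sqrf_eq0 hb0.
  have sz : s = 0 by apply/eqP; rewrite -normr_eq0 -sqrf_eq0 hs0.
  move=> i; rewrite -(fintype.splitK i); case: (fintype.split i) => j /=; last first.
    by rewrite ab bz mxE mulr0.
  by apply: (v_indep (a := fun k => a (lshift d k))); rewrite -sE.
have [|y [a _ <-]|x hx|ind [c2 c20 low]] := @index_split _ _ _ hB (m + d)%N v' L c' _ c'0 indep.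
- by move=> k a x y; rewrite /L; case: (fintype.split k) => i;
    [rewrite (bilDl hB0) (bilZl hB0) | rewrite (bilDl dot_sym) (bilZl dot_sym)].
- have [b [s [-> sE _]]] := v'E a.
  have h : range (lincomb v) s by rewrite sE; exists (fun k => a (lshift d k)).
  apply: le_trans (neg b s h) _; rewrite lerN2.
  rewrite /c' mulrAC ler_pdivrMr// -[leRHS]mulrA ler_pM2l// [leRHS]mulrC.
  exact: block_norm (ltW q0).
- have hs i : dot x (e i t) = 0 by have := hx (rshift m i); rewrite /L (unsplitK (inr i)).
  have hv k : B 0 (z theta) x (v k) = 0.
    by have := hx (lshift d k); rewrite /L (unsplitK (inl k)).
  have := hb 0 x.
  have -> : lincomb (e^~ t) ((0 : 'rV[R]_d) 0) = 0.
    by rewrite /lincomb big1// => i _; rewrite mxE scale0r.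
  rewrite scaler0 add0r !mul0mx mxE normr0 expr0n /= !add0r.
  rewrite ler_norml => /andP[h2 _]; have h1 := hn x hs hv.
  have x0 := sqr_ge0 `|x|.
  have h3 : c' * `|x| ^+ 2 <= eta * `|x| ^+ 2.
    rewrite ler_wpM2r// /c' ler_pdivrMr// ler_peMr ?ltW//.
    rewrite /kappa ltr_wpDl ?ltr1n//; positivity.
  have h4 : 2 * eta * `|x| ^+ 2 <= c0 / 4 * `|x| ^+ 2 by rewrite ler_wpM2r.
  lra.
split=> //.
exact: (nondegenerate_of_bounded_below hB (ex_bounded hex _ _) c20 low).
Qed.

End ReducedIndex.

(** * Injectivity of the reduced gradient and continuity of the critical points *)

(** The admissible radius depends on the point, so continuation to the supremum replaces a fixed
    subdivision: the supremum is reached by the estimate at itself and cannot lie below 1. *)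
Lemma locally_lipschitz_segment {R : realType} (f : R -> R) (L : R) :
  (forall s, 0 <= s <= 1 -> exists2 r, 0 < r & forall s', 0 <= s' <= 1 ->
     `|s' - s| < r -> `|f s' - f s| <= L * `|s' - s|) ->
  `|f 1 - f 0| <= L.
Proof.
move=> hf; pose A := [set s : R | 0 <= s <= 1 /\ `|f s - f 0| <= L * s].
have A0 : A 0 by split; rewrite ?lexx ?ler01// subrr normr0 mulr0.
have ubA : ubound A 1 by move=> s [/andP[]].
have supA : has_sup A by split; [exists 0|exists 1].
set b := sup A.
have b01 : 0 <= b <= 1.
  by rewrite (ub_le_sup supA.2 A0) (ge_sup supA.1 ubA).
have [r r0 hr] := hf b b01.
have Ab : A b.
  have [s As sb] := sup_adherent r0 supA; have [s01 hs] := As; rewrite -/b in sb.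
  have sleb : s <= b by exact: (ub_le_sup supA.2).
  have bs : 0 <= b - s by rewrite subr_ge0.
  have sr : `|s - b| < r by rewrite distrC ger0_norm//; lra.
  split=> //; have h := hr s s01 sr.
  rewrite distrC (distrC s) (ger0_norm bs) in h.
  have -> : f b - f 0 = (f b - f s) + (f s - f 0) by ring.
  by apply: le_trans (ler_normD _ _) _; lra.
have [b1|b1] := eqVneq b 1; first by case: Ab => _; rewrite b1 mulr1.
case/andP: (b01) => b0 ble1; have blt : b < 1 by rewrite lt_neqAle b1.
pose s := Num.min 1 (b + r / 2).
have r2 : 0 < r / 2 by rewrite divr_gt0.
have bs : b < s by rewrite lt_min blt ltrDl.
have s1 : s <= 1 by rewrite ge_min lexx.
have s2 : s <= b + r / 2 by rewrite ge_min lexx orbT.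
have s01 : 0 <= s <= 1 by rewrite s1 andbT; lra.
have n1 : `|s - b| = s - b by rewrite gtr0_norm// subr_gt0.
have sr : `|s - b| < r by rewrite n1; lra.
have As : A s.
  split=> //; have h := hr s s01 sr; rewrite n1 in h; have [_ h2] := Ab.
  have -> : f s - f 0 = (f s - f b) + (f b - f 0) by ring.
  by apply: le_trans (ler_normD _ _) _; lra.
by have : s <= b by [exact: (ub_le_sup supA.2)]; rewrite leNgt bs.
Qed.

Section ReducedInjectivity.
Context {R : realType} {E : hilbertType R} {d : nat}.
Variables (z : 'rV[R]_d -> E) (e : 'I_d -> 'rV[R]_d -> E)
  (e2 : 'I_d -> 'I_d -> 'rV[R]_d -> E)
  (g : R -> E -> E) (B : R -> E -> E -> E -> R)
  (T : 'rV[R]_d -> E -> E -> E -> R) (H : 'M[R]_d)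
  (al c : R) (theta : 'rV[R]_d).
Hypothesis hex : expansion z e e2 g B T H al c theta.

Variable C : R.
Hypothesis C_gt0 : 0 < C.
Hypothesis hC : forall x (m k : R),
  0 <= m -> 0 <= k -> (forall i, `|dot x (e i theta)| <= m) ->
  (forall y, (forall i, dot y (e i theta) = 0) ->
    B 0 (z theta) x y <= k * `|y|) -> `|x| <= C * (m + k).

Variable w : R -> 'rV[R]_d -> E.
Hypothesis w_solves : near0 theta (fun eps t => solves z e g eps t (w eps t)).
Hypothesis w_small : forall eta : R, 0 < eta ->
  near0 theta (fun eps t => `|w eps t| <= eta).

Let c_gt0 : 0 < c := ex_c_gt0 hex.
Let al_gt0 : 0 < al := ex_al_gt0 hex.

Lemma e2_near : exists2 M, 0 < M & near0 theta (fun _ t =>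
  forall i j, `|e2 i j t| <= M).
Proof.
have [M0 hM0] := ex_e2_bounded hex; exists (`|M0| + 1); first by rewrite ltr_wpDl.
apply: near0_forall_ord => i; apply: near0_forall_ord => j.
apply: near0_imp (near0_nbhs (hM0 i j)) => _ t _ h.
by rewrite (le_trans h)// (le_trans (ler_norm _))// lerDl.
Qed.

(** The increment [D] of [w] is o(eps^(al/2)) |h| by the comparison estimate. Tested against
    [e j t], the Hessian contributes another o(eps^(al/2)), so [w] influences the increment only by
    o(eps^al) |h|; no derivative of [w] enters. *)
Lemma reduced_gradient_increment (eta : R) : 0 < eta ->
  near0 theta (fun eps t => exists2 rho, 0 < rho & forall h, `|h| < rho ->
    forall j, `|dot (g eps (z (t + h) + w eps (t + h))) (e j (t + h)) -
      dot (g eps (z t + w eps t)) (e j t) -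
      eps `^ al * \sum_i h 0 i * H i j| <= eta * eps `^ al * `|h|).
Proof.
move=> eta0; pose n : R := d%:R.
have n0 : 0 <= n by exact: ler0n.
have [K K0 [rK rK0 hK]] := reduction_lipschitz hex C_gt0 hC.
have [Kw Kw0 hKw] := w_order hex C_gt0 hC w_solves w_small.
have [M M0 hM] := e2_near.
pose A := K * (n + 2); have A0 : 0 < A by rewrite mulr_gt0// ltr_wpDl.
(* The errors sum to [n] for the Hessian entries, [A] for the increment of [w], and three terms
   [nu * p] times |h|. [nu <= 1] absorbs a square of [nu]. *)
pose nu := Num.min 1 (eta / (n + A + 3)).
have n3 : 0 < n + A + 3 by rewrite ltr_wpDl// addr_ge0// ltW.
have nu0 : 0 < nu by rewrite lt_min ltr01 divr_gt0.
have nu1 : nu <= 1 by rewrite ge_min lexx.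
have nueta : nu * (n + A + 3) <= eta by rewrite -ler_pdivlMr// ge_min lexx orbT.
pose Le := n * M + 1; have Le0 : 0 < Le by rewrite ltr_wpDl// mulr_ge0// ltW.
have al2 : 0 < al / 2 by rewrite divr_gt0.
(* With this bound on [q], the frame term of the comparison estimate, [2 * (Kw * p) * Le] times |h|,
   is at most [nu * q] times |h|. *)
have q'0 : 0 < Num.min 1 (nu / (2 * Kw * Le)).
  by rewrite lt_min ltr01 divr_gt0// !mulr_gt0.
have [r0 r00 hr0] := near0_and (near0_and hKw hM) (near0_and (near0_and w_solves
  (near0_balls hex w_small rK0)) (near0_and (near0_powR theta al2 q'0)
  (near0_and (near0_forall_ord (fun i => hessian_frame_o hex C_gt0 hC w_solves w_small i nu0))
    (hessian_frame_frame hex C_gt0 hC w_solves w_small nu0)))).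
exists r0 => // eps t ep0 epr tr.
have [[[w0le g0le] hMt] [[sol0 [epK _ _ [tK w0K]]] [hq [hE3 hE4]]]] := hr0 eps t ep0 epr tr.
set q := eps `^ (al / 2) in hq hE3.
have pq : eps `^ al = q * q.
  rewrite /q -powRD; last by rewrite (gt_eqF ep0) implybT.
  by congr (_ `^ _); field.
have q0 : 0 < q by rewrite powR_gt0.
rewrite !le_min in hq; case/andP: hq => q1 q2.
set p := eps `^ al in w0le g0le hE4 pq *.
have p0 : 0 < p by rewrite powR_gt0.
have pleq : p <= q by rewrite pq ler_piMl// ltW.
have ple1 : p <= 1 := le_trans pleq q1.
set W0 := w eps t in w0le g0le w0K sol0 hE3 hE4 *.
set u0 := z t + W0 in g0le hE3 hE4 *.
set g0 := g eps u0 in g0le *.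
have hB := ex_sym hex eps u0.
have [KB KB0 hKB] := bounded_formP (ex_bounded hex eps u0).
pose Z := n * c + 1.
have Z0 : 0 < Z by rewrite ltr_wpDl// mulr_ge0// ltW.
(* [KB] bounds the Hessian at [u0], so [X], [mu] and finally [rho] depend on [eps] and [t]. Choosing
   [mu * X <= nu * p] makes the first-order remainders negligible at the scale [p]. *)
pose X := KB + Z + ((Z + A) * c + KB * c) + Kw.
have X0 : 0 < X by rewrite /X; positivity.
pose mu := Num.min 1 (nu * p / X).
have mu0 : 0 < mu by rewrite lt_min ltr01 divr_gt0// mulr_gt0.
have mu1 : mu <= 1 by rewrite ge_min lexx.
have muX : mu * X <= nu * p by rewrite -ler_pdivlMr// ge_min lexx orbT.
have [ra ra0 ha] : exists2 r, 0 < r & forall h, `|h| < r ->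
    `|z (t + h) - z t - \sum_k h 0 k *: e k t| <= mu * `|h|.
  by apply/near0P; exact: (ex_z_diff hex).
have [rb rb0 hb] : exists2 r, 0 < r & forall h, `|h| < r -> forall j,
    `|e j (t + h) - e j t - \sum_k h 0 k *: e2 k j t| <= mu * `|h|.
  by apply/near0P; apply: near_forall_ord => j; exact: (ex_e_diff hex).
have [rc rc0 hc] : exists2 r, 0 < r & forall h, `|h| < r -> forall y,
    `|dot (g eps (u0 + h) - g eps u0) y - B eps u0 h y| <= mu * `|h| * `|y|.
  by apply/near0P; exact: (ex_g_diff hex).
pose ZA := Z + A; have ZA0 : 0 < ZA by rewrite addr_gt0.
(* Coefficient of the quadratic term in |h|, from the simultaneous changes of gradient and frame;
   |h| below [nu * p / Q] brings that term down to [nu * p] times |h|. *)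
pose Q := (KB + 1) * ZA * (n * M) + 1.
have Q0 : 0 < Q.
  by rewrite ltr_wpDl// /Q; positivity.
pose rho := Num.min (Num.min ra rb) (Num.min (rc / ZA) (Num.min (nu * p / Q) (r0 - `|t - theta|))).
exists rho; first by rewrite !lt_min ra0 rb0 subr_gt0 tr !divr_gt0// mulr_gt0.
move=> h; rewrite !lt_min => /andP[/andP[hra hrb] /and3P[hrc hrQ hrr]] j.
rewrite ltr_pdivlMr// in hrc; rewrite ltr_pdivlMr// in hrQ.
set t1 := t + h.
have t1r : `|t1 - theta| < r0.
  rewrite /t1 addrAC; apply: le_lt_trans (ler_normD _ _) _.
  by rewrite [ltLHS]addrC -ltrBrDr.
have [[[_ g1le] _] [[sol1 [_ _ _ [t1K w1K]]] _]] := hr0 eps t1 ep0 epr t1r.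
set W1 := w eps t1 in sol1 w1K g1le *; set g1 := g eps (z t1 + W1) in g1le *.
set D := W1 - W0; pose zeta := z t1 - z t.
have h0 := normr_ge0 h.
have {}ha := ha h hra; have {}hb := hb h hrb; rewrite -/t1 -/zeta in ha hb.
set sz := \sum_k _ in ha.
have szle : `|sz| <= n * c * `|h|.
  apply: le_trans (ler_norm_sum _ _ _) _; rewrite -mulrA.
  apply: sum_le_const => k.
  by rewrite normrZ (ex_e_norm hex) mulrC ler_pM2l// rV_entry_le.
have zetale : `|zeta| <= Z * `|h|.
  have -> : zeta = (zeta - sz) + sz by rewrite subrK.
  apply: le_trans (ler_normD _ _) _; rewrite /Z mulrDl mul1r addrC lerD//.
  by apply: le_trans ha _; rewrite ler_piMl.
have s2le i : `|\sum_k h 0 k *: e2 k i t| <= n * M * `|h|.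
  apply: le_trans (ler_norm_sum _ _ _) _; rewrite -mulrA.
  apply: sum_le_const => k.
  by rewrite normrZ mulrC ler_pM// rV_entry_le.
have dele i : `|e i t1 - e i t| <= Le * `|h|.
  have -> : e i t1 - e i t = (e i t1 - e i t - \sum_k h 0 k *: e2 k i t) +
    \sum_k h 0 k *: e2 k i t by rewrite subrK.
  apply: le_trans (ler_normD _ _) _; rewrite /Le mulrDl mul1r addrC lerD//.
  by apply: le_trans (hb i) _; rewrite ler_piMl.
have Bsz y : `|B eps u0 sz y| <= n * (`|h| * (nu * q * `|y|)).
  rewrite (bil_suml hB); apply: le_trans (ler_norm_sum _ _ _) _.
  apply: sum_le_const => k; rewrite (bilZl hB) normrM.
  by rewrite ler_pM// rV_entry_le.
have Brest y : `|B eps u0 (zeta - sz) y| <= KB * (mu * `|h|) * `|y|.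
  by apply: le_trans (hKB _ _) _; rewrite ler_wpM2r// ler_wpM2l// ltW.
have muZ : mu * (KB + Z) <= nu * q.
  apply: (@le_trans _ _ (nu * p)); last by rewrite ler_pM2l.
  apply: le_trans muX; rewrite ler_pM2l// /X -addrA lerDl.
  by rewrite /ZA; positivity.
have zrc : `|zeta| < rc.
  apply: le_lt_trans zetale _; apply: le_lt_trans hrc.
  by rewrite mulrC ler_wpM2l// lerDl ltW.
(* To first order [zeta] is a combination of frame vectors, on which the Hessian is only
   o(eps^(al/2)); hence the factor [nu * q]. *)
have Yle : `|g eps (u0 + zeta) - g0| <= (n + 1) * nu * q * `|h|.
  apply: norm_le_dot => [|y]; first by positivity.
  have := hc zeta zrc y; have := Bsz y; have := Brest y; have y0 := normr_ge0 y.
  rewrite (bilBl hB) -/g0 !ler_norml => /andP[_ k1] /andP[_ k2] /andP[_ k3].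
  have k4 : mu * `|zeta| * `|y| <= mu * (Z * `|h|) * `|y|.
    by rewrite ler_wpM2r// ler_pM2l.
  have k5 : mu * (KB + Z) * (`|h| * `|y|) <= nu * q * (`|h| * `|y|).
    by rewrite ler_wpM2r// mulr_ge0.
  have k6 : KB * (mu * `|h|) * `|y| + mu * (Z * `|h|) * `|y| =
    mu * (KB + Z) * (`|h| * `|y|) by ring.
  have k7 : (n + 1) * nu * q * `|h| * `|y| =
    n * (`|h| * (nu * q * `|y|)) + nu * q * (`|h| * `|y|) by ring.
  rewrite k7; clear -k1 k2 k3 k4 k5 k6; lra.
have zE : z t1 + W0 = u0 + zeta by rewrite /u0 /zeta [z t + W0]addrC -addrA [z t + (_ - _)]addrC subrK addrC.
have Dle : `|D| <= A * nu * q * `|h|.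
  have hh : 0 <= Le * `|h| by positivity.
  have := hK eps eps t t1 W0 W1 (Le * `|h|) epK epK tK t1K w0K w1K sol0 sol1 hh dele.
  rewrite zE -/u0 -/g0 -/D => /le_trans; apply.
  have -> : A * nu * q * `|h| = K * ((n + 1) * nu * q * `|h| + nu * q * `|h|).
    by rewrite /A; ring.
  rewrite ler_pM2l// lerD//.
  apply: (@le_trans _ _ (2 * (Kw * p) * (Le * `|h|))).
    by rewrite ler_wpM2r// mulr_natl mulr2n lerD.
  have -> : 2 * (Kw * p) * (Le * `|h|) = q * (2 * Kw * Le) * (q * `|h|).
    by rewrite pq; ring.
  rewrite -[leRHS]mulrA ler_wpM2r//; first by positivity.
  by rewrite -ler_pdivlMr// !mulr_gt0.
have qh : nu * q * `|h| <= `|h|.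
  by rewrite ler_piMl// mulr_ile1// ltW.
have Dle1 : `|D| <= A * `|h|.
  by apply: le_trans Dle _; rewrite -mulrA -mulrA ler_pM2l// mulrA.
set k := zeta + D.
have kle : `|k| <= ZA * `|h|.
  by apply: le_trans (ler_normD _ _) _; rewrite /ZA mulrDl lerD.
have krc : `|k| < rc by apply: le_lt_trans kle _; rewrite mulrC.
have g1E : g1 = g eps (u0 + k).
  congr (g eps _); rewrite /k addrA -zE /D -addrA; congr (_ + _).
  by rewrite addrC subrK.
have gk y : `|dot (g1 - g0) y - B eps u0 k y| <= mu * `|k| * `|y|.
  by rewrite g1E; exact: hc.
have dgle : `|g1 - g0| <= (KB + 1) * ZA * `|h|.
  apply: norm_le_dot => [|y]; first by positivity.
  have := gk y; have := hKB k y; rewrite !ler_norml => /andP[_ k1] /andP[_ k2].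
  have k3 : mu * `|k| * `|y| <= 1 * `|k| * `|y|.
    by rewrite -!mulrA ler_wpM2r// mulr_ge0.
  have k4 : (KB + 1) * `|k| * `|y| <= (KB + 1) * (ZA * `|h|) * `|y|.
    by rewrite ler_wpM2r// ler_pM2l// addr_gt0.
  have k5 : (KB + 1) * `|k| * `|y| = KB * `|k| * `|y| + 1 * `|k| * `|y| by ring.
  rewrite -(mulrA (KB + 1)); clear -k1 k2 k3 k4 k5; lra.
have [_ [a ga]] := sol0; rewrite -/u0 -/g0 in ga.
have g0e2 : dot g0 (\sum_k h 0 k *: e2 k j t) = 0.
  rewrite (bil_sumr dot_sym) big1// => i _.
  rewrite (bilZr dot_sym) ga (bil_lincombl dot_sym) big1 ?mulr0// => l _.
  by rewrite dotC (ex_e2_orth hex) mulr0.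
set se := \sum_k h 0 k *: e2 k j t in g0e2.
have hbj := hb j; rewrite -/se in hbj.
pose S := \sum_i h 0 i * B eps u0 (e i t) (e j t).
pose S' := \sum_i h 0 i * H i j.
have e1 : `|S - p * S'| <= n * (`|h| * (nu * p)).
  have -> : S - p * S' = \sum_i h 0 i * (B eps u0 (e i t) (e j t) - p * H i j).
    by rewrite mulr_sumr -sumrB; apply: eq_bigr => i _; ring.
  apply: le_trans (ler_norm_sum _ _ _) _; apply: sum_le_const => i.
  by rewrite normrM ler_pM// ?rV_entry_le//; exact: hE4.
have SE : B eps u0 sz (e j t) = S.
  by rewrite (bil_suml hB); apply: eq_bigr => i _; rewrite (bilZl hB).
have e3 : `|B eps u0 D (e j t)| <= A * (nu * p) * `|h|.
  rewrite (bilC hB); apply: le_trans (hE3 j D) _.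
  apply: (@le_trans _ _ (nu * q * (A * nu * q * `|h|))).
    by rewrite ler_wpM2l//; positivity.
  have -> : nu * q * (A * nu * q * `|h|) = nu * (A * (nu * p) * `|h|).
    by rewrite pq; ring.
  by rewrite ler_piMl//; positivity.
have e4 := Brest (e j t); rewrite (bilBl hB) SE in e4.
have e5 := gk (e j t); rewrite (bilDl hB) in e5.
rewrite (ex_e_norm hex) in e4 e5.
have e6 : `|dot g1 (e j t1 - e j t - se)| <= nu * p * `|h|.
  apply: le_trans (dot_le _ _) _.
  apply: (@le_trans _ _ (Kw * p * (mu * `|h|))); first by rewrite ler_pM.
  have -> : Kw * p * (mu * `|h|) = p * (mu * Kw) * `|h| by ring.
  rewrite ler_wpM2r//; apply: le_trans (_ : mu * Kw <= _).
    by rewrite ler_piMl//; positivity.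
  apply: le_trans muX; rewrite ler_pM2l// /X lerDr; positivity.
have e7 : `|dot (g1 - g0) se| <= nu * p * `|h|.
  apply: le_trans (dot_le _ _) _.
  apply: (@le_trans _ _ ((KB + 1) * ZA * `|h| * (n * M * `|h|))).
    by rewrite ler_pM// s2le.
  have -> : (KB + 1) * ZA * `|h| * (n * M * `|h|) =
    `|h| * ((KB + 1) * ZA * (n * M)) * `|h| by ring.
  rewrite ler_wpM2r//; apply: le_trans (ltW hrQ).
  by rewrite ler_wpM2l// /Q lerDl.
have e8 : mu * `|k| * c + KB * (mu * `|h|) * c <= nu * p * `|h|.
  apply: (@le_trans _ _ (mu * X * `|h|)); last by rewrite ler_wpM2r.
  have f1 : mu * `|k| * c <= mu * (ZA * `|h|) * c.
    by rewrite ler_pM2r// ler_pM2l.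
  have f2 : 0 <= mu * (KB + Z + Kw) * `|h| by positivity.
  have -> : mu * X * `|h| = mu * (ZA * `|h|) * c + KB * (mu * `|h|) * c +
    mu * (KB + Z + Kw) * `|h| by rewrite /X /ZA; ring.
  clear -f1 f2; lra.
(* The frame increment is split into [se] and its remainder. [se] is orthogonal to [g0], so it meets
   only the change of gradient. *)
have split_eq : dot g1 (e j t1) - dot g0 (e j t) - p * S' =
  (dot (g1 - g0) (e j t) - (B eps u0 zeta (e j t) + B eps u0 D (e j t))) +
  (B eps u0 zeta (e j t) - S) + (S - p * S') + B eps u0 D (e j t) +
  dot g1 (e j t1 - e j t - se) + dot (g1 - g0) se.
  rewrite !(bilBr dot_sym) !(bilBl dot_sym) g0e2.
  move: (B eps u0 zeta _) (B eps u0 D _) (dot g1 _) (dot g1 _) (dot g1 _) (dot g0 _).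
  by move=> x1 x2 x3 x4 x5 x6; ring.
rewrite split_eq.
have tri (x1 x2 x3 x4 x5 x6 y1 y2 y3 y4 y5 y6 : R) : `|x1| <= y1 -> `|x2| <= y2 ->
    `|x3| <= y3 -> `|x4| <= y4 -> `|x5| <= y5 -> `|x6| <= y6 ->
    `|x1 + x2 + x3 + x4 + x5 + x6| <= y1 + y2 + y3 + y4 + y5 + y6.
  by move=> *; do 5![apply: le_trans (ler_normD _ _) _; apply: lerD => //].
apply: le_trans (tri _ _ _ _ _ _ _ _ _ _ _ _ e5 e4 e1 e3 e6 e7) _.
have e9 : nu * (n + A + 3) * (p * `|h|) <= eta * (p * `|h|).
  by rewrite ler_wpM2r//; positivity.
have e10 : n * (`|h| * (nu * p)) + A * (nu * p) * `|h| + 3 * (nu * p * `|h|) =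
  nu * (n + A + 3) * (p * `|h|) by ring.
rewrite -mulrA; clear -e8 e9 e10; lra.
Qed.

End ReducedInjectivity.

Lemma nbhs_dist {R : realType} {V : normedModType R} (x : V) (r : R) :
  0 < r -> nbhs x [set y | `|y - x| < r].
Proof.
by move=> r0; have : \forall y \near x, `|y - x| < r by apply/nbhs_distP; exists r.
Qed.

Lemma dist_continuous {R : realType} {V : normedModType R} (a : V) :
  continuous (fun t : V => `|t - a|).
Proof.
by move=> t; apply: cvg_norm; apply: cvgB; [exact: cvg_id | exact: cvg_cst].
Qed.

Section ReducedCurve.
Context {R : realType} {E : hilbertType R} {d : nat}.
Variables (z : 'rV[R]_d -> E) (e : 'I_d -> 'rV[R]_d -> E)
  (e2 : 'I_d -> 'I_d -> 'rV[R]_d -> E)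
  (g : R -> E -> E) (B : R -> E -> E -> E -> R)
  (T : 'rV[R]_d -> E -> E -> E -> R) (H : 'M[R]_d)
  (al c : R) (theta : 'rV[R]_d).
Hypothesis hex : expansion z e e2 g B T H al c theta.

Variable C : R.
Hypothesis C_gt0 : 0 < C.
Hypothesis hC : forall x (m k : R),
  0 <= m -> 0 <= k -> (forall i, `|dot x (e i theta)| <= m) ->
  (forall y, (forall i, dot y (e i theta) = 0) ->
    B 0 (z theta) x y <= k * `|y|) -> `|x| <= C * (m + k).

Variable w : R -> 'rV[R]_d -> E.
Hypothesis w_solves : near0 theta (fun eps t => solves z e g eps t (w eps t)).
Hypothesis w_small : forall eta : R, 0 < eta ->
  near0 theta (fun eps t => `|w eps t| <= eta).

(** [f] pairs the reduced gradient with [h] along the segment and removes the linear growth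
    [s * p * Q], leaving a small Lipschitz constant. Zeros at both ends give |Q| at most [n * eta]
    times |h|^2, below the lower bound by [cH] unless [h = 0]. *)
Lemma reduced_gradient_injective (cH : R) : 0 < cH ->
  (forall x : 'rV[R]_d, cH * `|x| ^+ 2 <= `|(x *m H *m x^T) 0 0|) ->
  exists2 r, 0 < r & forall eps t0 t1, 0 < eps -> eps < r ->
    `|t0 - theta| < r -> `|t1 - theta| < r ->
    g eps (z t0 + w eps t0) = 0 -> g eps (z t1 + w eps t1) = 0 -> t0 = t1.
Proof.
move=> cH0 hH; pose n : R := d%:R; have n0 : 0 <= n by exact: ler0n.
have n1 : 0 < n + 1 by rewrite ltr_wpDl.
pose eta := cH / (2 * (n + 1)).
have eta0 : 0 < eta by rewrite divr_gt0// mulr_gt0.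
have [r r0 hr] := reduced_gradient_increment hex C_gt0 hC w_solves w_small eta0.
exists r => // eps t0 t1 ep0 epr t0r t1r g0 g1.
pose h := t1 - t0; pose p := eps `^ al.
have p0 : 0 < p by rewrite powR_gt0.
have ht : t0 + h = t1 by rewrite /h [t0 + _]addrC subrK.
pose Q := (h *m H *m h^T) 0 0.
pose G t := g eps (z t + w eps t).
pose f (s : R) := \sum_j dot (G (t0 + s *: h)) (e j (t0 + s *: h)) * h 0 j - s * p * Q.
have hhpos := normr_ge0 h.
have Lf : `|f 1 - f 0| <= n * (eta * p * `|h| * `|h|).
  apply: locally_lipschitz_segment => s hs.
  have sr : `|t0 + s *: h - theta| < r by apply: segment_dist_lt => //; rewrite ht.
  have [rho rho0 hrho] := hr eps _ ep0 epr sr.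
  exists (rho / (`|h| + 1)) => [|s' hs']; first by rewrite divr_gt0// ltr_wpDl.
  rewrite ltr_pdivlMr ?ltr_wpDl// => hss.
  pose k := (s' - s) *: h.
  have kn : `|k| = `|s' - s| * `|h| by rewrite normrZ.
  have kr : `|k| < rho.
    by rewrite kn; apply: le_lt_trans hss; rewrite ler_wpM2l// lerDl.
  have tk : t0 + s *: h + k = t0 + s' *: h.
    by rewrite /k -addrA -scalerDl [s + _]addrC subrK.
  have := hrho k kr; rewrite tk => hk.
  have -> : f s' - f s = \sum_j (dot (G (t0 + s' *: h)) (e j (t0 + s' *: h)) -
      dot (G (t0 + s *: h)) (e j (t0 + s *: h)) - p * \sum_i k 0 i * H i j) * h 0 j.
    have -> : f s' - f s = (\sum_j dot (G (t0 + s' *: h)) (e j (t0 + s' *: h)) * h 0 j -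
       \sum_j dot (G (t0 + s *: h)) (e j (t0 + s *: h)) * h 0 j) - p * (s' - s) * Q.
      by rewrite /f; ring.
    have -> : p * (s' - s) * Q = \sum_j p * (\sum_i k 0 i * H i j) * h 0 j.
      rewrite /Q quadE exchange_big mulr_sumr; apply: eq_bigr => j _ /=.
      rewrite -[RHS]mulrA mulr_suml !mulr_sumr; apply: eq_bigr => i _.
      by rewrite [k _ _]mxE; ring.
    by rewrite -!sumrB; apply: eq_bigr => j _; ring.
  apply: le_trans (ler_norm_sum _ _ _) _.
  rewrite -mulrA; apply: sum_le_const => j; rewrite normrM.
  have -> : eta * p * `|h| * `|h| * `|s' - s| = eta * p * `|k| * `|h|.
    by rewrite kn; ring.
  by rewrite ler_pM// ?rV_entry_le//; exact: hk.
have f1 : f 1 = - (p * Q).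
  rewrite /f scale1r ht big1 => [|j _]; first by ring.
  by rewrite /G g1 (bil0l dot_sym) mul0r.
have f0 : f 0 = 0.
  rewrite /f scale0r addr0 big1 => [|j _]; first by ring.
  by rewrite /G g0 (bil0l dot_sym) mul0r.
rewrite f1 f0 subr0 normrN normrM (gtr0_norm p0) in Lf.
have h1 : p * (cH * `|h| ^+ 2) <= p * (cH / 2 * `|h| ^+ 2).
  apply: (@le_trans _ _ (p * `|Q|)); first by rewrite ler_pM2l//; exact: hH.
  apply: le_trans Lf _.
  have -> : n * (eta * p * `|h| * `|h|) = p * (n * eta * `|h| ^+ 2) by ring.
  rewrite ler_pM2l// ler_wpM2r ?sqr_ge0//.
  have -> : n * eta = cH / 2 * (n / (n + 1)).
    by rewrite /eta; field; rewrite gt_eqF.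
  have q1 : n / (n + 1) <= 1 by rewrite ler_pdivrMr// mul1r lerDl.
  by rewrite ler_piMr// divr_ge0// ltW.
rewrite ler_pM2l// in h1.
have h2 : `|h| ^+ 2 <= 0.
  have : cH / 2 * `|h| ^+ 2 <= 0 by lra.
  by rewrite pmulr_rle0// divr_gt0.
have : `|h| = 0 by apply/eqP; rewrite -sqrf_eq0 eq_le h2 sqr_ge0.
by move/eqP; rewrite normr_eq0 subr_eq0 => /eqP ->.
Qed.

(** The comparison estimate against the fixed solution at [(eps0, t0)], with [delta] the oscillation
    of the frame and the gradient at fixed [w] controlled by joint continuity. *)
Lemma w_continuous : exists2 r, 0 < r & forall eps0 t0, 0 < eps0 -> eps0 < r ->
  `|t0 - theta| < r -> forall eta : R, 0 < eta -> exists2 rho, 0 < rho &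
    forall eps t, `|eps - eps0| < rho -> `|t - t0| < rho ->
      `|w eps t - w eps0 t0| < eta.
Proof.
have [K K0 [rK rK0 hK]] := reduction_lipschitz hex C_gt0 hC.
have [r r0 hr] := near0_and w_solves (near0_balls hex w_small rK0).
exists r => // eps0 t0 ep0 epr tr eta eta0.
have [sol0 [epK _ _ [tK w0K]]] := hr eps0 t0 ep0 epr tr.
set W0 := w eps0 t0 in sol0 w0K *.
set g0 := g eps0 (z t0 + W0).
pose M := `|W0| + `|g0| + 1; have M0 : 0 < M by rewrite ltr_wpDl// addr_ge0.
pose mu := eta / (3 * K); have mu0 : 0 < mu by rewrite divr_gt0// mulr_gt0.
pose dl := mu / M; have dl0 : 0 < dl by rewrite divr_gt0.
have [r1 r10 hr1] := ex_g_cts hex eps0 (z t0 + W0) mu0.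
have [r2 r20 hr2] := z_continuous hex t0 r10.
have [r3 r30 hr3] : exists2 r3, 0 < r3 & forall t, `|t - t0| < r3 ->
    forall i, `|e i t - e i t0| < dl.
  apply/nbhs_distP; apply: near_forall_ord => i; apply/nbhs_distP.
  by have [q q0 hq] := e_continuous hex i t0 dl0; exists q.
pose rho := Num.min (Num.min r1 r2) (Num.min r3 (Num.min eps0
  (Num.min (r - eps0) (r - `|t0 - theta|)))).
exists rho; first by rewrite !lt_min r10 r20 r30 ep0 !subr_gt0 epr tr.
move=> eps t; rewrite !lt_min => /and4P[]/andP[he1 _] _ he2 /andP[he3 _].
move=> /and4P[]/andP[_ ht1] ht2 _ /andP[_ ht3].
have ep1 : 0 < eps by have := ler_norm (eps0 - eps); rewrite distrC; lra.
have epr1 : eps < r by have := ler_norm (eps - eps0); lra.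
have tr1 : `|t - theta| < r.
  have -> : t - theta = (t - t0) + (t0 - theta) by rewrite addrA subrK.
  by apply: le_lt_trans (ler_normD _ _) _; rewrite -ltrBrDr.
have [sol1 [epK1 _ _ [tK1 w1K]]] := hr eps t ep1 epr1 tr1.
have hdl i : `|e i t - e i t0| <= dl by apply: ltW; exact: hr3.
have h := hK eps0 eps t0 t W0 (w eps t) dl epK epK1 tK tK1 w0K w1K sol0 sol1 (ltW dl0) hdl.
apply: le_lt_trans h _.
have h1 : `|g eps (z t + W0) - g0| < mu.
  apply: hr1 => //; rewrite opprD addrACA subrr addr0; exact: hr2.
have h2 : (`|W0| + `|g0|) * dl <= mu.
  rewrite /dl mulrCA; apply: ler_piMr; first exact: ltW.
  by rewrite ler_pdivrMr// mul1r /M lerDl.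
have -> : eta = K * (3 * mu) by rewrite /mu; field; rewrite gt_eqF.
rewrite ltr_pM2l//; rewrite -/g0; lra.
Qed.

Variables (cH : R) (th : R -> 'rV[R]_d) (u : R -> E).
Hypothesis cH_gt0 : 0 < cH.
Hypothesis hH : forall x : 'rV[R]_d,
  cH * `|x| ^+ 2 <= `|(x *m H *m x^T) 0 0|.
Hypothesis th_lim : forall r : R, 0 < r -> exists2 s, 0 < s &
  forall eps, 0 < eps -> eps < s -> `|th eps - theta| < r.
Hypothesis u_crit : exists2 s, 0 < s & forall eps, 0 < eps -> eps < s ->
  g eps (u eps) = 0 /\ u eps = z (th eps) + w eps (th eps).

(* On a compact ball the zero th eps of the reduced gradient is unique, so it
   depends continuously on eps. *)
Lemma reduced_curve_continuous : exists2 s, 0 < s &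
  forall eps0, 0 < eps0 -> eps0 < s -> {for eps0, continuous u}.
Proof.
have [r1 r10 inj] := reduced_gradient_injective cH_gt0 hH.
have [r2 r20 wc] := w_continuous.
(* Halving puts the closed ball of radius [r] inside the open balls of injectivity and
   continuity. *)
pose r := Num.min r1 r2 / 2.
have m0 : 0 < Num.min r1 r2 by rewrite lt_min r10.
have r0 : 0 < r by rewrite divr_gt0.
have rm : r < Num.min r1 r2 by rewrite /r ltr_pdivrMr// ltr_pMr ?ltr1n.
have rr : r < r1 /\ r < r2 by move: rm; rewrite lt_min => /andP[].
have [s1 s10 ths] := th_lim r0.
have [s2 s20 us] := u_crit.
exists (Num.min (Num.min s1 s2) (Num.min r1 r2)) => [|eps0 ep0].
  by rewrite !lt_min s10 s20 r10.
rewrite !lt_min => /andP[/andP[e1 e2'] /andP[e3 e4]].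
have uc t0 : `|t0 - theta| <= r -> forall eta : R, 0 < eta -> exists2 rho, 0 < rho &
    forall eps t, `|eps - eps0| < rho -> `|t - t0| < rho ->
      `|z t + w eps t - (z t0 + w eps0 t0)| < eta.
  move=> t0r eta eta0; have eta2 : 0 < eta / 2 by rewrite divr_gt0.
  have [q1 q10 h1] := wc eps0 t0 ep0 e4 (le_lt_trans t0r rr.2) _ eta2.
  have [q2 q20 h2] := z_continuous hex t0 eta2.
  exists (Num.min q1 q2) => [|eps t]; first by rewrite lt_min q10.
  rewrite !lt_min => /andP[g1 _] /andP[g2 g3].
  rewrite opprD addrACA; apply: le_lt_trans (ler_normD _ _) _.
  by rewrite [eta]splitr ltrD//; [exact: h2 | exact: h1].
have thc (eta : R) : 0 < eta -> \forall eps \near eps0, `|th eps - th eps0| < eta.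
  move=> eta0.
  (* Possible zeros away from [th eps0]. At [eps0] injectivity excludes them; compactness then
     excludes them on all of [K] for every [eps] near [eps0]. *)
  pose K := [set t : 'rV[R]_d | `|t - theta| <= r] `&` [set t | eta <= `|t - th eps0|].
  have cK : compact K.
    apply: bounded_closed_compact.
      exists (r + `|theta|); split; first exact: num_real.
      move=> M M1 t /= [h _]; have -> : t = (t - theta) + theta by rewrite subrK.
      by apply: le_trans (ler_normD _ _) _; apply: ltW; apply: le_lt_trans M1; rewrite lerD2r.
    apply: closedI.
      apply: (@closed_comp _ _ (fun t : 'rV[R]_d => `|t - theta|) [set x | x <= r]) => [t _|].
        exact: dist_continuous.
      exact: closed_le.
    apply: (@closed_comp _ _ (fun t : 'rV[R]_d => `|t - th eps0|) [set x | eta <= x]) => [t _|].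
      exact: dist_continuous.
    exact: closed_ge.
  have cov : \forall eps \near eps0, K `<=` (fun t => g eps (z t + w eps t) != 0).
    have cov := iffLR (compact_near_coveringP K) cK.
    apply: (cov R (nbhs eps0) (fun eps t => g eps (z t + w eps t) != 0) _).
    move=> t [tr teta].
    have gn : 0 < `|g eps0 (z t + w eps0 t)|.
      rewrite normr_gt0; apply/negP => /eqP g0.
      have [g0' uE] := us eps0 ep0 e2'; rewrite uE in g0'.
      have tt : t = th eps0.
        apply: (inj eps0) => //; first exact: le_lt_trans tr rr.1.
        exact: lt_trans (ths _ ep0 e1) rr.1.
      by move: teta; rewrite /= tt subrr normr0 leNgt eta0.
    have [q1 q10 h1] := ex_g_cts hex eps0 (z t + w eps0 t) gn.
    have [q2 q20 h2] := uc t tr q1 q10.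
    have m12 : 0 < Num.min q1 q2 by rewrite lt_min q10.
    exists ([set t' | `|t' - t| < Num.min q1 q2], [set eps | `|eps - eps0| < Num.min q1 q2]) => /=.
      by split; exact: nbhs_dist.
    move=> [t' eps] /=; rewrite !lt_min => -[/andP[g1 g2] /andP[g3 g4]].
    apply/negP => /eqP gz; have := h1 eps (z t' + w eps t') g3 (h2 _ _ g4 g2).
    by rewrite gz sub0r normrN ltxx.
  have near1 : \forall eps \near eps0, 0 < eps /\ eps < Num.min s1 s2.
    apply/nbhs_distP; exists (Num.min eps0 (Num.min s1 s2 - eps0)).
      by rewrite lt_min ep0 subr_gt0 lt_min e1.
    move=> eps; rewrite lt_min => /andP[h1 h2].
    have := ler_norm (eps - eps0); have := ler_norm (eps0 - eps); rewrite distrC.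
    by split; lra.
  apply: filterS2 cov near1 => eps hK' [ep]; rewrite lt_min => /andP[es1 es2].
  rewrite ltNge; apply/negP => hge.
  have [g0 uE] := us eps ep es2; rewrite uE in g0.
  have /negP[] : g eps (z (th eps) + w eps (th eps)) != 0.
    by apply: hK'; split => //=; apply: ltW; exact: ths.
  by rewrite g0.
have near2 : \forall eps \near eps0, 0 < eps /\ eps < s2.
  apply/nbhs_distP; exists (Num.min eps0 (s2 - eps0)).
    by rewrite lt_min ep0 subr_gt0.
  move=> eps; rewrite lt_min => /andP[h1 h2].
  have := ler_norm (eps - eps0); have := ler_norm (eps0 - eps); rewrite distrC.
  by split; lra.
apply/cvgrPdist_lt => eta eta0.
have [rho rho0 hrho] := uc (th eps0) (ltW (ths _ ep0 e1)) eta eta0.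
apply: filterS3 (thc rho rho0) near2 (near_dist_lt eps0 rho0) => eps k1 [k2 k3] k4.
have [_ ->] := us eps k2 k3; have [_ ->] := us eps0 ep0 e2'.
by rewrite distrC; apply: hrho => //; rewrite distrC.
Qed.

End ReducedCurve.

(** If [P] failed arbitrarily close to [(0, x)], a curve through a sequence of failures, equal to
    [x] elsewhere, would still tend to [x]. *)
Lemma near0_of_curves {R : realType} {V : normedModType R} (x : V)
    (P : R -> V -> Prop) :
  (forall t : R -> V, t eps @[eps --> 0^'+] --> x ->
     \forall eps \near 0^'+, P eps (t eps)) -> near0 x P.
Proof.
move=> hP; apply: contrapT => hn.
have bad (n : nat) : exists q : R * V, [/\ 0 < q.1, q.1 < n.+1%:R^-1,
    `|q.2 - x| < n.+1%:R^-1 & ~ P q.1 q.2].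
  apply: contrapT => hb; apply: hn.
  exists n.+1%:R^-1 => [|eps y e0 en yn]; first by rewrite invr_gt0.
  by apply: contrapT => hPe; apply: hb; exists (eps, y).
have [q hq] := choice bad.
(* the curve takes the value (q n).2 at (q n).1 for some n *)
pose t eps : V := if pselect (exists n, eps = (q n).1) is left h
  then (q (projT1 (cid h))).2 else x.
have tP eps : (exists n, eps = (q n).1) -> exists2 n, eps = (q n).1 & t eps = (q n).2.
  move=> h; rewrite /t; case: pselect => [h'|//].
  by case: (cid h') => n /= hn'; exists n.
have tlim : t eps @[eps --> 0^'+] --> x.
  apply/cvgrPdist_lt => eta eta0.
  have [N hN] : exists N : nat, N.+1%:R^-1 < eta.
    by have [N _ /(_ N (leqnn N))] := near_infty_natSinv_lt (PosNum eta0); exists N.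
  (* Below [r], an [eps] is none of the first [N] parameters, so an index chosen for it is at least
     [N] and its point is within [N.+1%:R^-1] of [x]. *)
  have [r r0 hr] : exists2 r, 0 < r & forall n, (n < N)%N -> r <= (q n).1.
    elim: (N) => [|k [r r0 hr]]; first by exists 1.
    have [qk _ _ _] := hq k.
    exists (Num.min r (q k).1) => [|n]; first by rewrite lt_min r0.
    rewrite ltnS leq_eqVlt => /orP[/eqP ->|nk]; first by rewrite ge_min lexx orbT.
    by rewrite ge_min hr.
  near=> eps.
  have epsr : eps < r by near: eps; exact: nbhs_right_lt.
  have [h|h] := pselect (exists n, eps = (q n).1); last first.
    by rewrite /t; case: pselect => // _; rewrite subrr normr0.
  have [n en ->] := tP _ h; have [_ _ hx _] := hq n.
  rewrite distrC; apply: lt_le_trans hx _; apply: le_trans (ltW hN).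
  rewrite lef_pV2 ?posrE// ler_nat ltnS leqNgt; apply/negP => nN.
  by have := hr n nN; rewrite -en leNgt epsr.
have : \forall eps \near (0 : R), 0 < eps -> P eps (t eps) := hP t tlim.
move=> /near0P[r r0 hr].
have [N hN] : exists N : nat, N.+1%:R^-1 < r.
  by have [N _ /(_ N (leqnn N))] := near_infty_natSinv_lt (PosNum r0); exists N.
have [q0 qN _ _] := hq N.
have h : exists n, (q N).1 = (q n).1 by exists N.
have [n en tn] := tP _ h; have [_ _ _] := hq n; apply.
rewrite -tn -en; apply: hr => //.
by rewrite gtr0_norm//; exact: lt_trans qN hN.
Unshelve. all: by end_near. Qed.

Lemma near0_curve {R : realType} {V : normedModType R} (x : V)
    (P : R -> V -> Prop) (t : R -> V) :
  t eps @[eps --> 0^'+] --> x -> near0 x P -> \forall eps \near 0^'+, P eps (t eps).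
Proof.
move=> ht [r r0 hr].
have /cvgrPdist_lt/(_ r r0) tr := ht.
near=> eps; apply: hr.
- by near: eps; exact: nbhs_right_gt.
- by near: eps; exact: nbhs_right_lt.
- by rewrite distrC; near: eps; exact: tr.
Unshelve. all: by end_near. Qed.

Lemma near_rightP {R : realType} (P : R -> Prop) :
  (\forall eps \near 0^'+, P eps) <->
  exists2 s, 0 < s & forall eps, 0 < eps -> eps < s -> P eps.
Proof.
split=> [h|[s s0 h]].
  have /near0P[s s0 hs] : \forall eps \near (0 : R), 0 < eps -> P eps := h.
  by exists s => // eps e0 es; apply: hs => //; rewrite gtr0_norm.
near=> eps; apply: h.
- by near: eps; exact: nbhs_right_gt.
- by near: eps; exact: nbhs_right_lt.
Unshelve. all: by end_near. Qed.

Lemma linear_small_eq0 {R : realType} {V W : normedModType R} (l : V -> W) :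
  (forall a u v, l (a *: u + v) = a *: l u + l v) ->
  (forall eta : R, 0 < eta -> \forall h \near (0 : V), `|l h| <= eta * `|h|) ->
  forall h, l h = 0.
Proof.
move=> lin hl h; apply/eqP; rewrite -normr_le0; apply/ler_addgt0Pr => e e0.
rewrite add0r; pose eta := e / (`|h| + 1).
have h1 : 0 < `|h| + 1 by rewrite ltr_wpDl.
have eta0 : 0 < eta by rewrite divr_gt0.
have /near0P[r r0 hr] := hl eta eta0.
pose a := r / (2 * (`|h| + 1)); have a0 : 0 < a by rewrite divr_gt0// mulr_gt0.
have l0 : l 0 = 0.
  apply: (@addIr _ (l 0)); rewrite add0r -[X in X + _](scale1r (l 0)) -lin.
  by rewrite scale1r addr0.
have : `|l (a *: h)| <= eta * `|a *: h|.
  apply: hr; rewrite normrZ gtr0_norm// /a mulrAC ltr_pdivrMr ?mulr_gt0//.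
  by rewrite ltr_pM2l//; have := normr_ge0 h; lra.
rewrite -[a *: h]addr0 lin l0 addr0 addr0 !normrZ !gtr0_norm// mulrCA ler_pM2l//.
move=> /le_trans; apply; rewrite /eta mulrAC ler_pdivrMr// ler_pM2l// lerDl//.
Qed.

(* Product rule for the vanishing function t |-> b t (x t). *)
Lemma bilinear_chain_rule {R : realType} {V E : normedModType R}
    (b : V -> E -> R) (x : V -> E) (t0 : V) (K : R) :
  (forall t a u v, b t (a *: u + v) = a * b t u + b t v) ->
  (forall u, `|b t0 u| <= K * `|u|) ->
  (forall eta, 0 < eta -> \forall h \near (0 : V), forall u,
     `|b (t0 + h) u - b t0 u| <= eta * `|u|) ->
  differentiable x t0 -> differentiable (fun t => b t (x t0)) t0 ->
  (forall t, b t (x t) = 0) ->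
  forall h, 'd (fun t => b t (x t0)) t0 h + b t0 ('d x t0 h) = 0.
Proof.
move=> lin bd cb dx db b0.
have bB t u v : b t (u - v) = b t u - b t v.
  by rewrite addrC -scaleN1r lin mulN1r addrC.
have bD t u v : b t (u + v) = b t u + b t v.
  by rewrite -[u in LHS]scale1r lin mul1r.
have [L L0 hL] := diff_bounded dx.
have K0 : 0 < `|K| + 1 by rewrite ltr_wpDl.
apply: linear_small_eq0 => [a u v|eta eta0].
  by rewrite !linearP /= lin scalerDr addrACA.
have e3 : 0 < eta / 3 by rewrite divr_gt0.
have eK : 0 < eta / 3 / (`|K| + 1) by rewrite divr_gt0.
have eL : 0 < eta / 3 / (L + 1) by rewrite divr_gt0// addr_gt0.
have h1 := differentiable_remainder dx eK.
have h2 := differentiable_remainder db e3.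
have h3 := differentiable_remainder dx ltr01.
have h4 := cb _ eL.
apply: filterS2 (filterI h1 h2) (filterI h3 h4) => h [k1 k2] [k3 k4].
set dxh := 'd x t0 h in k1 k3 *; set dbh := 'd _ t0 h in k2 *.
pose rem := x (t0 + h) - x t0 - dxh.
have m3 : `|x (t0 + h) - x t0| <= (L + 1) * `|h|.
  have -> : x (t0 + h) - x t0 = rem + dxh by rewrite subrK.
  by apply: le_trans (ler_normD _ _) _; rewrite mulrDl addrC lerD// hL.
have m4 : `|b (t0 + h) (x (t0 + h) - x t0) - b t0 (x (t0 + h) - x t0)| <= eta / 3 * `|h|.
  apply: le_trans (k4 _) _; apply: le_trans (ler_wpM2l (ltW eL) m3) _.
  by rewrite mulrA divfK// gt_eqF// addr_gt0.
have m1 : `|b t0 rem| <= eta / 3 * `|h|.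
  apply: le_trans (bd _) _.
  apply: (@le_trans _ _ ((`|K| + 1) * (eta / 3 / (`|K| + 1) * `|h|))).
    apply: (@le_trans _ _ ((`|K| + 1) * `|rem|)); last by rewrite ler_pM2l.
    by rewrite ler_wpM2r// (le_trans (ler_norm K))// lerDl.
  by rewrite mulrA [(_ + 1) * _]mulrC divfK// gt_eqF.
(* The vanishing of [b t (x t)] at [t0] and [t0 + h] leaves the remainder of [b], the mixed
   increment, and [b t0] at the remainder of [x]. *)
have e12 : dbh + b t0 dxh = - (b (t0 + h) (x t0) - b t0 (x t0) - dbh) -
    (b (t0 + h) (x (t0 + h) - x t0) - b t0 (x (t0 + h) - x t0)) - b t0 rem.
  by rewrite /rem !bB !b0; ring.
rewrite e12; apply: le_trans (ler_normB _ _) _.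
apply: le_trans (lerD (ler_normB _ _) m1) _; rewrite normrN.
by apply: le_trans (lerD (lerD k2 m4) (lexx _)) _; lra.
Qed.

Section PartialDerivatives.
Context {R : realType} {d : nat} {W : normedModType R}.
Implicit Type f : 'rV[R]_d -> W.

Lemma pdE f i t : differentiable f t -> pd i f t = 'd f t (delta_mx 0 i).
Proof. exact: deriveE. Qed.

Lemma diff_pd f t (h : 'rV[R]_d) : differentiable f t ->
  'd f t h = \sum_k h 0 k *: pd k f t.
Proof.
move=> df; rewrite {1}[h]row_sum_delta linear_sum; apply: eq_bigr => k _.
by rewrite linearZ /= pdE.
Qed.

Lemma pd_diff f i : C2 f -> pd i f = fun t => 'd f t (delta_mx 0 i).
Proof. by move=> cf; apply/funext => t; rewrite pdE//; exact: C2_differentiable. Qed.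

Lemma differentiable_pd f i t : C2 f -> differentiable (pd i f) t.
Proof. by move=> cf; rewrite pd_diff//; exact: C2_differentiable_diff. Qed.

Lemma pd2_D2 f i j t : C2 f ->
  pd2 i j f t = D2 f t (delta_mx 0 j) (delta_mx 0 i).
Proof.
move=> cf; rewrite /pd2 pdE; last exact: differentiable_pd.
by rewrite pd_diff// D2E.
Qed.

Lemma pd_remainder f i t (eta : R) : C2 f -> 0 < eta ->
  \forall h \near (0 : 'rV[R]_d),
  `|pd i f (t + h) - pd i f t - \sum_k h 0 k *: pd2 k i f t| <= eta * `|h|.
Proof.
move=> cf eta0; have df := differentiable_pd i t cf.
apply: filterS (differentiable_remainder df eta0) => h.
by rewrite diff_pd.
Qed.

Lemma pd2_bounded f i j (t : 'rV[R]_d) : C2 f ->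
  exists M, \forall s \near t, `|pd2 i j f s| <= M.
Proof.
move=> cf; have [_ _ c2] := cf.
pose a : 'rV[R]_d := delta_mx 0 j; pose b : 'rV[R]_d := delta_mx 0 i.
exists (`|D2 f t a b| + wt2 (a, b)).
apply: filterS (c2 t 1 ltr01) => s /(_ (a, b)) /=; rewrite mul1r => h.
rewrite (pd2_D2 i j s cf) -/a -/b.
have -> : D2 f s a b = D2 f t a b + (D2 f s a b - D2 f t a b) by rewrite addrC subrK.
by apply: le_trans (ler_normD _ _) _; rewrite lerD2l.
Qed.

End PartialDerivatives.

(** * The perturbed functional *)

Section Instance.
Context {R : realType} {E : hilbertType R} {d : nat}.
Variables (F : E -> R) (G : R -> E -> R) (z : 'rV[R]_d -> E) (alpha : R)
  (Gam : E -> R).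
Hypotheses (hd : (0 < d)%N) (hF1 : C2_parametrization z).
Hypothesis hF1crit : forall th, z th = grad F (z th).
Hypothesis hF3 : forall th, tangent z th = [set v | v - hess F (z th) v = 0].
Hypothesis hF4 : C3 F.
Hypothesis hHorth : forall th (i j : 'I_d), i != j ->
  dot (pd i z th) (pd j z th) = 0.
Hypothesis hH2 : forall th (i j l : 'I_d), dot (pd2 i j z th) (pd l z th) = 0.
Hypothesis hG00 : forall u, G 0 u = 0.
Hypothesis hG2 : continuous (fun p : R * E => grad (G p.1) p.2).
Hypothesis hG2' : continuous_op wt1 (fun (p : R * E) v => hess (G p.1) p.2 v).
Hypothesis halpha : 0 < alpha.
Hypothesis hG4 : forall eps, C3 (G eps).
Hypothesis hG4' : continuous_op wt2
  (fun (p : R * E) v => third (G p.1) p.2 v.1 v.2).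
Hypothesis hG5O : forall u, (fun p : R * E => grad (G p.1) p.2)
  =O_ (filter_prod 0^'+ (nbhs u)) (fun p => p.1 `^ alpha).
Hypothesis hG5lim : forall (t : R -> 'rV[R]_d) (th0 : 'rV[R]_d),
  t eps @[eps --> 0^'+] --> th0 ->
  (forall i j : 'I_d,
     eps `^ (- alpha) * dot (grad (G eps) (z (t eps))) (pd2 i j z (t eps))
     + eps `^ (- alpha)
       * dot (hess (G eps) (z (t eps)) (pd i z (t eps))) (pd j z (t eps))
     @[eps --> 0^'+] --> pd2 i j (Gam \o z) th0) /\
  (forall i : 'I_d,
     eps `^ (- (alpha / 2)) *: hess (G eps) (z (t eps)) (pd i z (t eps))
     @[eps --> 0^'+] --> (0 : E)).
Variables (theta : 'rV[R]_d) (c : R).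
Hypothesis hc : forall th (i : 'I_d), `|pd i z th| = c.

Let f := functional F G.
Let hF0 : C2 F. Proof. by case: hF4. Qed.
Let hG1 eps : C2 (G eps). Proof. by case: (hG4 eps). Qed.
Let hz : C2 z. Proof. by case: hF1. Qed.
Let dz t : differentiable z t. Proof. exact: C2_differentiable. Qed.

Lemma tangent_pd i t : tangent z t (pd i z t).
Proof. by exists (delta_mx 0 i) => //; rewrite pdE. Qed.

Lemma tangentP t x : tangent z t x <-> exists a, x = lincomb (fun i => pd i z t) a.
Proof.
split=> [[h _ <-]|[a ->]].
  by exists (h 0); rewrite diff_pd.
exists (\row_i a i) => //; rewrite diff_pd//.
by apply: eq_bigr => i _; rewrite mxE.
Qed.

Lemma pd_kernel i t y : dot (pd i z t) y - D2 F (z t) (pd i z t) y = 0.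
Proof.
have h := tangent_pd i t; rewrite hF3 in h.
rewrite -(hess_dot (z t) (pd i z t) y hF0) -(bilBl dot_sym).
by rewrite (h : pd i z t - hess F (z t) (pd i z t) = 0) (bil0l dot_sym).
Qed.

Lemma pd_norm_gt0 : 0 < c.
Proof.
have i0 := Ordinal hd; rewrite -(hc theta i0) normr_gt0.
apply/negP => /eqP; rewrite pdE// => h; have [_ inj _] := hF1.
have := inj theta (delta_mx 0 i0) 0; rewrite h linear0 => /(_ erefl)/matrixP.
by move=> /(_ 0 i0); rewrite !mxE !eqxx /= => /eqP; rewrite oner_eq0.
Qed.

Lemma D2_functional_kernel i t y : D2 (f 0) (z t) (pd i z t) y = 0.
Proof. exact: etrans (D2_functional0 hF0 hG1 hG00 _ _ _) (pd_kernel i t y). Qed.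

Lemma D2_functional_tangent eps i t y :
  D2 (f eps) (z t) (pd i z t) y = dot (hess (G eps) (z t) (pd i z t)) y.
Proof.
apply: etrans (D2_functional hF0 hG1 _ _ _ _) _.
apply: etrans (congr1 (fun r => r + _) (pd_kernel i t y)) _.
rewrite add0r; exact: esym (hess_dot (z t) (pd i z t) y (hG1 eps)).
Qed.

Lemma grad_functional_z eps t : grad (f eps) (z t) = grad (G eps) (z t).
Proof. by rewrite (grad_functionalE hF0 hG1) -hF1crit subrr add0r. Qed.

(** For fixed [y], [b s] vanishes at [pd j z s]; differentiating along the i-th direction gives a
    third derivative of [F] plus [b t (pd2 i j z t)]. Symmetry of the third derivative restores the
    order of arguments. *)
Lemma D2_functional_pd2 i j t y :
  D2 (f 0) (z t) (pd2 i j z t) y = D3 F (z t) (pd i z t) (pd j z t) y.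
Proof.
have [K K0 hK] := D2_bounded (z t) hF0.
have bF s := C2_sym_bilinear (z s) hF0.
pose b s x := D2 F (z s) x y - dot x y.
have lin s a u v : b s (a *: u + v) = a * b s u + b s v.
  rewrite /b (bilDl (bF s)) (bilZl (bF s)) (bilDl dot_sym) (bilZl dot_sym).
  move: (D2 F (z s) u y) (D2 F (z s) v y) => p q; ring.
have bd u : `|b t u| <= ((K + 1) * `|y|) * `|u|.
  apply: le_trans (ler_normB _ _) _; apply: le_trans (lerD (hK _ _) (dot_le _ _)) _.
  by rewrite le_eqVlt; apply/orP; left; apply/eqP; ring.
have cb eta : 0 < eta -> \forall h \near (0 : 'rV[R]_d), forall u,
    `|b (t + h) u - b t u| <= eta * `|u|.
  move=> eta0; have [_ _ cF] := hF0.
  have y1 : 0 < `|y| + 1 by rewrite ltr_wpDl.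
  have e0 : 0 < eta / (`|y| + 1) by rewrite divr_gt0.
  have /nbhs_distP[r r0 hr] := cF (z t) _ e0.
  have zc := differentiable_continuous (dz t).
  have /cvgrPdist_lt/(_ r r0)/nbhs_distP[s s0 hs] := zc.
  apply/near0P; exists s => // h hsr u.
  have zr : `|z (t + h) - z t| < r.
    by rewrite distrC; apply: hs; rewrite addrAC subrr add0r.
  have := hr _ zr (u, y); rewrite /wt2 /= /b => k.
  rewrite opprB addrA subrK.
  apply: le_trans k _; rewrite mulrAC ler_pdivrMr// -!mulrA ler_pM2l//.
  by rewrite ler_wpM2l// lerDl.
have dF := C3_differentiable_D2 (z t) (pd j z t) y hF4.
have hab : is_diff t (fun s => b s (pd j z t))
    (fun h => D3 F (z t) (pd j z t) y ('d z t h)).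
  have dcomp := is_diff_comp (differentiableP (dz t)) (differentiableP dF).
  have := is_diffB dcomp (is_diff_cst (dot (pd j z t) y) t).
  by move=> D; apply: is_diff_eq D _; apply/funext => h; rewrite !fctE subr0.
have b0 s : b s (pd j z s) = 0.
  by apply/eqP; rewrite /b -oppr_eq0 opprB; apply/eqP; exact: pd_kernel.
have db : differentiable (fun s => b s (pd j z t)) t by case: hab.
have h := bilinear_chain_rule lin bd cb (differentiable_pd j t hz) db b0 (delta_mx 0 i).
have e1 : 'd (fun s => b s (pd j z t)) t (delta_mx 0 i) =
    D3 F (z t) (pd j z t) y (pd i z t).
  exact: etrans (is_diffE _ hab) (congr1 _ (esym (pdE i (dz t)))).
have e2 : 'd (pd j z) t (delta_mx 0 i) = pd2 i j z t.
  exact: esym (pdE i (differentiable_pd j t hz)).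
have {h} : D3 F (z t) (pd j z t) y (pd i z t) + b t (pd2 i j z t) = 0.
  exact: etrans (congr2 (fun p q => p + b t q) (esym e1) (esym e2)) h.
rewrite /b => h.
apply: etrans (D2_functional0 hF0 hG1 hG00 _ _ _) _.
have h2 : D3 F (z t) (pd j z t) y (pd i z t) = D3 F (z t) (pd i z t) (pd j z t) y.
  by rewrite (C3_sym23 _ _ _ _ hF4) (C3_sym12 _ _ _ _ hF4).
rewrite -h2; move: h.
move: (D3 F (z t) _ _ _) (D2 F (z t) _ _) (dot _ _) => p q r h; lra.
Qed.

Lemma grad_G_order : exists K, near0 theta (fun eps t =>
  `|grad (f eps) (z t)| <= K * eps `^ alpha).
Proof.
have /eqO_exP[K K0 hK] := hG5O (z theta).
have [r r0 hr] : near0 (z theta) (fun eps u => `|grad (G eps) u| <= K * `|eps `^ alpha|).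
  exact: (iffLR (near_right_prodP _ (fun eps u => `|grad (G eps) u| <= K * `|eps `^ alpha|)) hK).
have /cvgrPdist_lt/(_ r r0)/nbhs_distP[s s0 hs] := differentiable_continuous (dz theta).
exists K, (Num.min r s) => [|eps t e0]; first by rewrite lt_min r0.
rewrite !lt_min => /andP[er _] /andP[_ ts]; rewrite grad_functional_z.
have := hr eps (z t) e0 er; rewrite (ger0_norm (powR_ge0 _ _)); apply.
by rewrite distrC; exact: hs.
Qed.

Lemma hess_G_frame i eta : 0 < eta -> near0 theta (fun eps t => forall y,
  `|D2 (f eps) (z t) (pd i z t) y| <= eta * eps `^ (alpha / 2) * `|y|).
Proof.
move=> eta0.
have h : near0 theta (fun eps t =>
    `|eps `^ (- (alpha / 2)) *: hess (G eps) (z t) (pd i z t)| <= eta).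
  apply: near0_of_curves => t ht; have [_ /(_ i)] := hG5lim ht.
  move=> /cvgrPdist_le/(_ _ eta0); apply: filterS => eps.
  by rewrite sub0r normrN.
apply: near0_imp h => eps t e0 h y.
rewrite D2_functional_tangent; apply: le_trans (dot_le _ _) _.
rewrite ler_wpM2r//.
have p0 : 0 < eps `^ (alpha / 2) by rewrite powR_gt0.
move: h; rewrite normrZ powRN ger0_norm ?invr_ge0 ?powR_ge0//.
by rewrite ler_pdivrMl// mulrC.
Qed.

Lemma hess_G_frame_frame i j eta : 0 < eta -> near0 theta (fun eps t =>
  `|dot (grad (f eps) (z t)) (pd2 i j z t) +
    D2 (f eps) (z t) (pd i z t) (pd j z t) -
    eps `^ alpha * hessmx (Gam \o z) theta i j| <= eta * eps `^ alpha).
Proof.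
move=> eta0.
have h : near0 theta (fun eps t =>
    `|eps `^ (- alpha) * dot (grad (G eps) (z t)) (pd2 i j z t) +
      eps `^ (- alpha) * dot (hess (G eps) (z t) (pd i z t)) (pd j z t) -
      pd2 i j (Gam \o z) theta| <= eta).
  apply: near0_of_curves => t ht; have [/(_ i j) + _] := hG5lim ht.
  move=> /cvgrPdist_le/(_ _ eta0); apply: filterS => eps.
  by rewrite distrC.
apply: near0_imp h => eps t e0 h.
rewrite grad_functional_z D2_functional_tangent mxE.
have p0 : 0 < eps `^ alpha by rewrite powR_gt0.
have arith (q a b r : R) : 0 < q -> `|q^-1 * a + q^-1 * b - r| <= eta ->
    `|a + b - q * r| <= eta * q.
  move=> q0 hq; have -> : a + b - q * r = q * (q^-1 * a + q^-1 * b - r).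
    by field; rewrite gt_eqF.
  by rewrite normrM (gtr0_norm q0) mulrC ler_pM2r.
by apply: arith => //; rewrite powRN in h.
Qed.

Lemma functional_expansion : expansion z (fun i => pd i z)
  (fun i j => pd2 i j z) (fun eps u => grad (f eps) u)
  (fun eps u => D2 (f eps) u) (fun t => D3 F (z t)) (hessmx (Gam \o z) theta)
  alpha c theta.
Proof.
split.
- by move=> eps u; exact: D2_functional_sym.
- by move=> eps u; exact: D2_functional_bounded.
- by move=> eta; exact: D2_functional_near.
- by move=> eta; exact: grad_functional_near.
- by move=> eta; exact: D2_functional_increment.
- move=> eps u eta eta0.
  have [r r0 hr] := D2_functional_continuous hF0 hG1 eps u eta0.
  apply/near0P; exists r => // h hh y.
  have [s hs ->] := grad_functional_MVT hF0 hG1 eps u h y.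
  apply: hr; rewrite addrAC subrr add0r normrZ.
  apply: le_lt_trans hh; rewrite ler_piMl//.
  by case/andP: hs => s0 s1; rewrite ger0_norm.
- move=> eps0 u0 eta eta0.
  have cg : continuous (fun p : R * E => grad (f p.1) p.2).
    exact: grad_functional_continuous.
  have /cvgrPdist_lt/(_ _ eta0)/nbhs_distP[r r0 hr] := cg (eps0, u0).
  exists r => // eps u he hu; rewrite distrC; apply: (hr (eps, u)).
  by rewrite prod_normE /= gt_max he hu.
- move=> t eta eta0.
  apply: filterS (differentiable_remainder (dz t) eta0) => h.
  by rewrite diff_pd.
- by move=> i t eta; exact: pd_remainder.
- exact: pd_norm_gt0.
- by move=> i t; exact: hc.
- by move=> i j t; exact: hHorth.
- by move=> i j l t; exact: hH2.
- have h i j := pd2_bounded i j theta hz.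
  have [M hM] := choice (fun q : 'I_d * 'I_d => h q.1 q.2).
  exists (\sum_q `|M q|) => i j; apply: filterS (hM (i, j)) => t /= /le_trans; apply.
  apply: le_trans (ler_norm _) _; rewrite (bigD1 (i, j))//= lerDl.
  by rewrite sumr_ge0.
- by have [K _ hK] := D3_bounded (z theta) hF4; exists K.
- move=> eta eta0; have [_ _ cF] := hF4.
  have /nbhs_distP[r r0 hr] := cF (z theta) _ eta0.
  have /cvgrPdist_lt/(_ r r0)/nbhs_distP[s s0 hs] := differentiable_continuous (dz theta).
  apply/nbhs_distP; exists s => // t ts x y v.
  have zr : `|z t - z theta| < r by rewrite distrC; exact: hs.
  by have := hr _ zr (x, y, v); rewrite /wt3 /= !mulrA.
- by move=> t; rewrite (grad_functional0 hF0 hG1 hG00) -hF1crit subrr.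
- exact: D2_functional_kernel.
- exact: D2_functional_pd2.
- exact: halpha.
- exact: grad_G_order.
- exact: hess_G_frame.
- exact: hess_G_frame_frame.
Qed.

End Instance.

Theorem theorem5p2 (R : realType) (E : hilbertType R) (d : nat)
  (F : E -> R) (G : R -> E -> R) (z : 'rV[R]_d -> E)
  (alpha : R) (Gam : E -> R)
  (* (F0), (F1), (F2), (F3), (F4)' *)
  (hF0 : C2 F)
  (hd : (0 < d)%N)
  (hF1 : C2_parametrization z)
  (hF1crit : forall th, z th = grad F (z th))
  (hF2 : forall th, compact_op (hess F (z th)))
  (hF3 : forall th, tangent z th = [set v | v - hess F (z th) v = 0])
  (hF4 : C3 F)
  (* (H) *)
  (hHorth : forall th (i j : 'I_d), i != j -> dot (pd i z th) (pd j z th) = 0)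
  (hHnorm : exists c : R, forall th (i : 'I_d), `|pd i z th| = c)
  (hH2 : forall th (i j l : 'I_d), dot (pd2 i j z th) (pd l z th) = 0)
  (* (G0), (G1), (G2) *)
  (hG0 : continuous (fun p : R * E => G p.1 p.2))
  (hG00 : forall u, G 0 u = 0)
  (hG1 : forall eps, C2 (G eps))
  (hG2 : continuous (fun p : R * E => grad (G p.1) p.2))
  (hG2' : continuous_op wt1 (fun (p : R * E) v => hess (G p.1) p.2 v))
  (* (G3) *)
  (halpha : 0 < alpha)
  (hGam : {within range z, continuous Gam})
  (hG3 : forall x, range z x ->
     eps `^ (- alpha) * G eps x @[eps --> 0^'+] --> Gam x)
  (hG3' : forall x, range z x ->
     (fun eps => grad (G eps) x) =o_ (0^'+) (fun eps => eps `^ (alpha / 2)))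
  (* (G4)' *)
  (hG4 : forall eps, C3 (G eps))
  (hG4' : continuous_op wt2
     (fun (p : R * E) v => third (G p.1) p.2 v.1 v.2))
  (* (G5)' *)
  (hG5O : forall u, (fun p : R * E => grad (G p.1) p.2)
     =O_ (filter_prod 0^'+ (nbhs u)) (fun p => p.1 `^ alpha))
  (hG5Gam : C2 (Gam \o z))
  (hG5lim : forall (t : R -> 'rV[R]_d) (th0 : 'rV[R]_d),
     t eps @[eps --> 0^'+] --> th0 ->
     (forall i j : 'I_d,
        eps `^ (- alpha) * dot (grad (G eps) (z (t eps))) (pd2 i j z (t eps))
        + eps `^ (- alpha)
          * dot (hess (G eps) (z (t eps)) (pd i z (t eps))) (pd j z (t eps))
        @[eps --> 0^'+] --> pd2 i j (Gam \o z) th0) /\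
     (forall i : 'I_d,
        eps `^ (- (alpha / 2)) *: hess (G eps) (z (t eps)) (pd i z (t eps))
        @[eps --> 0^'+] --> (0 : E)))
  (* the reduction, and the critical points u_eps on Z_eps *)
  (w : R -> 'rV[R]_d -> E) (hw : reduction (functional F G) z w)
  (theta : 'rV[R]_d) (th : R -> 'rV[R]_d) (u : R -> E)
  (hth : th eps @[eps --> 0^'+] --> theta)
  (hu : \forall eps \near 0^'+,
     critical (functional F G eps) (u eps) /\
     u eps = z (th eps) + w eps (th eps))
  (* nondegeneracy at theta *)
  (m0 : nat)
  (hnd : nondegenerate_on (D2 (functional F G 0) (z theta))
           (orth (tangent z theta)))
  (hm0 : morse_index (D2 (functional F G 0) (z theta))
           (orth (tangent z theta)) m0)
  (hdef : posdefmx (hessmx (Gam \o z) theta) \/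
          negdefmx (hessmx (Gam \o z) theta)) :
  (\forall eps \near 0^'+,
     [/\ critical (functional F G eps) (u eps),
         nondegenerate_on (D2 (functional F G eps) (u eps)) setT,
         posdefmx (hessmx (Gam \o z) theta) ->
           morse_index (D2 (functional F G eps) (u eps)) setT m0 &
         negdefmx (hessmx (Gam \o z) theta) ->
           morse_index (D2 (functional F G eps) (u eps)) setT (m0 + d)%N]) /\
  (\forall eps \near 0^'+, {for eps, continuous u}).
Proof.
have hz : C2 z by case: hF1.
have [c hc] := hHnorm.
pose f := functional F G.
have hex := functional_expansion hd hF1 hF1crit hF3 hF4 hHorth hH2 hG00 hG2
  hG2' halpha hG4 hG4' hG5O hG5lim theta hc.
set S := orth (tangent z theta) in hnd hm0.
have SE x : S x <-> forall i, dot x (pd i z theta) = 0.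
  split=> [Sx i|h t /(tangentP hF1)[a ->]]; first exact/Sx/tangent_pd.
  by rewrite dotC (bil_lincombl dot_sym) big1// => i _; rewrite dotC h mulr0.
have S0 : S 0 by apply/SE => i; rewrite (bil0l dot_sym).
have SD a x y : S x -> S y -> S (a *: x + y).
  move=> /SE hx /SE hy; apply/SE => i.
  by rewrite (bilDl dot_sym) (bilZl dot_sym) hx hy mulr0 addr0.
have B0s := ex_sym hex 0 (z theta).
have [C C0 hC] := nondegenerate_on_bounded_below B0s S0 SD hnd.
(* Differences of solutions at different [t] are only almost normal at [theta], so the bound on [S]
   is extended to all vectors at the price of their frame coordinates. *)
have [C' C'0 hC'] : exists2 C', 0 < C' & forall x (m k : R),
    0 <= m -> 0 <= k -> (forall i, `|dot x (pd i z theta)| <= m) ->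
    (forall y, (forall i, dot y (pd i z theta) = 0) ->
      D2 (functional F G 0) (z theta) x y <= k * `|y|) -> `|x| <= C' * (m + k).
  apply: (coercive_mod_frame hex C0) => x k hx k0 hk.
  by apply: hC => //; [exact/SE | move=> y /SE; exact: hk].
have w_solves : near0 theta
    (fun eps t => solves z (fun i => pd i z) (fun eps u => grad (f eps) u) eps t (w eps t)).
  have [[r r0 hr] _] := hw theta.
  have : near0 theta (fun eps t => auxiliary f z eps t (w eps t)).
    apply/near_right_prodP; apply: filterS hr => q [h _]; exact: h.
  apply: near0_imp => eps t _ [ht hg]; split=> [k|].
    exact/ht/tangent_pd.
  by have [a ->] := iffLR (tangentP hF1 _ _) hg; exists a.
have w_small eta : 0 < eta -> near0 theta (fun eps t => `|w eps t| <= eta).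
  move=> eta0; have [_ /cvgrPdist_le/(_ _ eta0) h] := hw theta.
  apply/near_right_prodP; apply: filterS h => q /=.
  by rewrite sub0r normrN.
have [v [c0 [c00 vi vS vneg vpos]]] :=
  form_splitting B0s S0 SD (ex_bounded hex 0 (z theta)) hnd hm0.
have vS' k : forall i, dot (v k) (pd i z theta) = 0 by apply/SE; exact: vS.
have vpos' x : (forall i, dot x (pd i z theta) = 0) ->
    (forall k, D2 (functional F G 0) (z theta) x (v k) = 0) ->
    c0 * `|x| ^+ 2 <= D2 (functional F G 0) (z theta) x x.
  by move=> hx; apply: vpos; exact/SE.
have block eta := @hessian_block _ _ _ _ _ _ _ _ _ _ _ _ _ hex _ C'0 hC' _
  w_solves w_small eta.
have tolim P : near0 theta P -> \forall eps \near 0^'+, P eps (th eps).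
  exact: near0_curve.
split.
  have common n :
      near0 theta (fun eps t =>
        morse_index (D2 (f eps) (z t + w eps t)) setT n /\ nondegenerate_on (D2 (f eps) (z t + w eps t)) setT) ->
      \forall eps \near 0^'+, [/\ critical (f eps) (u eps),
        nondegenerate_on (D2 (f eps) (u eps)) setT &
        morse_index (D2 (f eps) (u eps)) setT n].
    move=> /tolim h; apply: filterS2 hu h => eps [cu ue] [h1 h2].
    by rewrite -ue in h1 h2; split.
  (* As [d >= 1], the Hessian of Gamma cannot have both signs, so in each case the other implication
     is vacuous. *)
  have d_contra : posdefmx (hessmx (Gam \o z) theta) ->
      negdefmx (hessmx (Gam \o z) theta) -> False.
    move=> hp hn; pose x : 'rV[R]_d := delta_mx 0 (Ordinal hd).
    have x0 : x != 0.
      apply/eqP => /matrixP/(_ 0 (Ordinal hd)); rewrite !mxE !eqxx /= => /eqP.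
      by rewrite oner_eq0.
    have := hp x x0; have := hn x x0; rewrite mulmxN mulNmx mxE; lra.
  case: hdef => hd'.
    have := common m0 (reduced_index_pos hex c00 vi vneg vpos' block hd').
    apply: filterS => eps [h1 h2 h3]; split=> //.
    by move=> hn; case: (d_contra hd' hn).
  have := common _ (reduced_index_neg hex c00 vi vneg vpos' block hd').
  apply: filterS => eps [h1 h2 h3]; split=> //.
  by move=> hp; case: (d_contra hp hd').
(* Injectivity of the reduced gradient depends only on the absolute value of the quadratic form, so
   both signs are treated together. *)
have [cH cH0 hH] : exists2 cH, 0 < cH & forall x : 'rV[R]_d,
    cH * `|x| ^+ 2 <= `|(x *m hessmx (Gam \o z) theta *m x^T) 0 0|.
  case: hdef => [/posdefmx_coercive|/negdefmx_coercive] [cH cH0 h]; exists cH => // x.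
    exact: le_trans (h x) (ler_norm _).
  by rewrite -[leRHS]normrN; apply: le_trans _ (ler_norm _); rewrite lerNr.
apply/near_rightP.
apply: (reduced_curve_continuous hex C'0 hC' w_solves w_small cH0 hH).
  move=> r r0; apply/near_rightP.
  have /cvgrPdist_lt/(_ _ r0) := hth.
  by apply: filterS => eps h; rewrite distrC; exact: h.
exact/near_rightP.
Qed.
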